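(* Let $(M,g)$ be a smooth Riemannian manifold of dimension $n\ge2$ of nonnegative constant sectional curvature $K$. Let $\Gamma\subset\mathbb R^n$ be an open convex cone with vertex at the origin satisfying $\{\lambda:\lambda_i>0\ \forall i\}\subset\Gamma\subset\{\lambda:\sum_i\lambda_i>0\}$, and let $F:\Gamma\to\mathbb R$ be a $C^2$ symmetric function, homogeneous of degree one, with $F(1,\dots,1)=1$, such that in $\Gamma$: (S0) $F>0$; (S1) $F$ is concave; (S2) $\partial F/\partial\lambda_i>0$ for all $i$. Let $a$ be a constant, let $f(x,z)$ and $h(p)$ be positive functions, and suppose $h_{p_ip_j}\ge\epsilon\,\delta_{ij}$ for some $\epsilon>0$. Let $u$ be a $C^4$ solution, in a bounded domain $\Omega\subset M$, of $$F\big(g^{-1}(\nabla^2u+a\,du\otimes du+K g)\big)=f(x,u)\,h(\nabla u),$$ where the eigenvalues of $g^{-1}(\nabla^2u+a\,du\otimes du+Kg)$ lie in $\Gamma$. Then $$\sup_{\overline\Omega}|\nabla^2u|\le C_4,$$ where $C_4$ depends only on $n,a,K,\epsilon,e_{\sup},c_{\sup},c_{\inf},\|u\|_{C^1(\overline\Omega)},\sup_{\partial\Omega}|\nabla^2u|$.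
   Context: All derivatives of $u$ are covariant derivatives with respect to $g$. For a symmetric $(0,2)$ tensor $W$, $F(g^{-1}W)$ means $F$ applied to the eigenvalues of the $(1,1)$ tensor $g^{-1}W$. The functions $f,h$ are assumed at least $C^2$, and $u$ is understood to be regular enough up to $\partial\Omega$ (e.g. $C^2(\overline\Omega)$) for the quantities to make sense. The variable $p$ stands for the gradient $\nabla u(x)\in T_xM\cong\mathbb R^n$ (orthonormal frame); $h=h(\nabla u)$ means $h$ has no explicit dependence on $x$ (its covariant $x$-derivative with $p$ held fixed vanishes). For the given solution $u$, $$c_{\inf}=\inf_{x\in\Omega}f(x,u),$$ $$c_{\sup}=\sup_{x\in\Omega}\big(f+|\nabla_xf|+|f_z|+|\nabla_x^2f|+|\nabla_xf_z|+|f_{zz}|\big)(x,u),$$ $$e_{\sup}=\sup_{x\in\Omega}\big(h+|\nabla_ph|+|\nabla_p^2h|\big)(\nabla u).$$ Here $\nabla_x$ denotes differentiation in $x$ with $z$ held fixed and $\nabla_p$ differentiation in $p$. *)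

(* Defs.v *)
From HB Require Import structures.
From mathcomp Require Import all_boot all_order all_algebra perm.
From mathcomp Require Import all_classical all_reals all_analysis.

Set Implicit Arguments.
Unset Strict Implicit.
Unset Printing Implicit Defensive.

Import Order.TTheory GRing.Theory Num.Theory.
Import numFieldNormedType.Exports.

Local Open Scope classical_set_scope.
Local Open Scope ring_scope.

(* f is of class C^k on the open set U.  For finite-dimensional V this is the
   usual notion: all iterated directional derivatives up to order k exist and
   are continuous on U. *)
Fixpoint Ck (R : realType) (V : normedModType R) (k : nat) (U : set V)
    (f : V -> R) : Prop :=
  (forall x, U x -> {for x, continuous f}) /\
  (if k is k'.+1 then
     forall v : V, (forall x, U x -> derivable f x v) /\ Ck k' U ('D_v f)
   else True).

Section EuclideanCalculus.
Context {R : realType} {n : nat}.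

Definition basis_vec (i : 'I_n) : 'rV[R]_n := delta_mx 0 i.

Definition partials (f : 'rV[R]_n -> R) (y : 'rV[R]_n) : 'rV[R]_n :=
  \row_i 'D_(basis_vec i) f y.

Definition partials2 (f : 'rV[R]_n -> R) (y : 'rV[R]_n) : 'M[R]_n :=
  \matrix_(i, j) 'D_(basis_vec i) ('D_(basis_vec j) f) y.

(* Norm of a covector w, resp. of a (0,2)-tensor B, with respect to the inner
   product with Gram matrix g:
   |w|^2 = g^{ij} w_i w_j  and  |B|^2 = g^{ik} g^{jl} B_ij B_kl. *)
Definition covec_norm (g : 'M[R]_n) (w : 'rV[R]_n) : R :=
  Num.sqrt ((w *m invmx g *m w^T) 0 0).

Definition tensor_norm (g B : 'M[R]_n) : R :=
  Num.sqrt (\tr (invmx g *m B *m invmx g *m B^T)).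

Definition is_spectrum (A : 'M[R]_n) (lam : 'rV[R]_n) : Prop :=
  char_poly A = \prod_(i < n) ('X - (lam 0 i)%:P).

(* The conditions on the cone Gamma and on the function F : Gamma -> R; the
   values of F outside Gamma play no role. *)
Record admissible (Gamma : set 'rV[R]_n) (F : 'rV[R]_n -> R) : Prop := {
  cone_open : open Gamma;
  cone_convex : convex_set Gamma;
  cone_scale : forall (t : R) lam, 0 < t -> Gamma lam -> Gamma (t *: lam);
  cone_sub_pos : [set lam : 'rV[R]_n | forall i, 0 < lam 0 i] `<=` Gamma;
  cone_sup_sum : Gamma `<=` [set lam : 'rV[R]_n | 0 < \sum_i lam 0 i];
  (* symmetry of F includes invariance of its domain *)
  cone_sym : forall (s : 'S_n) lam, Gamma lam -> Gamma (col_perm s lam);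
  F_sym : forall (s : 'S_n) lam, Gamma lam -> F (col_perm s lam) = F lam;
  F_C2 : Ck 2 Gamma F;
  F_homogeneous : forall (t : R) lam, 0 < t -> Gamma lam ->
    F (t *: lam) = t * F lam;
  F_one : F (const_mx 1) = 1;
  F_pos : forall lam, Gamma lam -> 0 < F lam;
  F_concave : convex_function Gamma (fun lam => - F lam);
  F_monotone : forall lam i, Gamma lam -> 0 < 'D_(basis_vec i) F lam }.

End EuclideanCalculus.

(* A smooth n-manifold given by a smooth atlas, with a smooth Riemannian
   metric given by its Gram matrices in the charts.  A tangent vector at x is
   represented in a chart by the row of its components; the Jacobian 'J acts on
   rows by right multiplication.  cinv c is the inverse of local_coord c; both are
   unconstrained outside dom c and its image. *)
Record riemannianManifold (R : realType) (n : nat) := RiemannianManifold {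
  carrier :> topologicalType;
  carrier_hausdorff : hausdorff_space carrier;
  carrier_second_countable : @second_countable carrier;
  chart : Type;
  dom : chart -> set carrier;
  local_coord : chart -> carrier -> 'rV[R]_n;
  cinv : chart -> 'rV[R]_n -> carrier;
  dom_open : forall c, open (dom c);
  dom_cover : forall x, exists c, dom c x;
  local_coordK : forall c x, dom c x -> cinv c (local_coord c x) = x;
  image_open : forall c, open (local_coord c @` dom c);
  local_coord_continuous : forall c, {within dom c, continuous (local_coord c)};
  cinv_continuous : forall c,
    {within local_coord c @` dom c, continuous (cinv c)};
  transition_smooth : forall c c' (j : 'I_n) k,
    Ck k (local_coord c @` (dom c `&` dom c'))
         (fun y => local_coord c' (cinv c y) 0 j);
  metric : chart -> 'rV[R]_n -> 'M[R]_n;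
  metric_smooth : forall c (i j : 'I_n) k,
    Ck k (local_coord c @` dom c) (fun y => metric c y i j);
  metric_symmetric : forall c x, dom c x ->
    (metric c (local_coord c x))^T = metric c (local_coord c x);
  metric_pos : forall c x (v : 'rV[R]_n), dom c x -> v != 0 ->
    0 < (v *m metric c (local_coord c x) *m v^T) 0 0;
  metric_change : forall c c' x, dom c x -> dom c' x ->
    let J := 'J (local_coord c' \o cinv c) (local_coord c x) in
    metric c (local_coord c x) = J *m metric c' (local_coord c' x) *m J^T }.

Section RiemannianCalculus.
Context {R : realType} {n : nat} (M : riemannianManifold R n).
Implicit Types (c : chart M) (x : M) (y p v : 'rV[R]_n) (A Omega : set M).

(* (christoffel c y k) i j = Gamma^k_ij *)
Definition christoffel c y (k : 'I_n) : 'M[R]_n :=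
  \matrix_(i, j) (2^-1 * \sum_l invmx (metric c y) k l *
     ('D_(basis_vec i) (fun y' => metric c y' j l) y
      + 'D_(basis_vec j) (fun y' => metric c y' i l) y
      - 'D_(basis_vec l) (fun y' => metric c y' i j) y)).

(* R^l_kij, with R(d_i, d_j) d_k = R^l_kij d_l and
   R(X, Y) Z = D_X D_Y Z - D_Y D_X Z - D_[X, Y] Z *)
Definition riemann c y (l k i j : 'I_n) : R :=
  'D_(basis_vec i) (fun y' => christoffel c y' l j k) y
  - 'D_(basis_vec j) (fun y' => christoffel c y' l i k) y
  + \sum_m (christoffel c y m j k * christoffel c y l i m
            - christoffel c y m i k * christoffel c y l j m).

Definition inner c y p v : R := (p *m metric c y *m v^T) 0 0.

(* g(R(X, Y) Y, X) / (|X|^2 |Y|^2 - g(X, Y)^2) *)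
Definition sectional_curvature c y p v : R :=
  (\sum_i \sum_j \sum_k \sum_l \sum_m
     p 0 i * v 0 j * v 0 k * riemann c y l k i j * metric c y l m * p 0 m)
  / (inner c y p p * inner c y v v - inner c y p v ^+ 2).

Definition constant_sectional_curvature (K : R) : Prop :=
  forall c x p v, dom c x -> row_free (col_mx p v) ->
    sectional_curvature c (local_coord c x) p v = K.

(* Components of the covariant Hessian of a function with first partials w and
   second partials H at the point y of the chart c. *)
Definition cov_hessian c y (w : 'rV[R]_n) (H : 'M[R]_n) : 'M[R]_n :=
  H - \sum_k w 0 k *: christoffel c y k.

(* Supremum and infimum over A of a function on M whose value at x is computed
   in a chart around x (all the functions used below are chart-independent).
   The supremum of the empty set is 0. *)
Definition sup_on A (q : chart M -> M -> R) : R :=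
  sup [set r | exists c x, [/\ A x, dom c x & r = q c x]].
Definition inf_on A (q : chart M -> M -> R) : R :=
  inf [set r | exists c x, [/\ A x, dom c x & r = q c x]].

(* For open Omega: the topological boundary. *)
Definition frontier Omega : set M := closure Omega `\` Omega.

(* The closure is required to be compact: on a complete manifold this is
   boundedness (Hopf-Rinow). *)
Definition bounded_domain Omega : Prop :=
  [/\ open Omega, connected Omega, Omega !=set0 & compact (closure Omega)].

Definition C_on (k : nat) Omega (u : M -> R) : Prop :=
  forall c, Ck k (local_coord c @` (dom c `&` Omega)) (u \o cinv c).

(* u is C^2 up to the boundary: in each chart its first and second partial
   derivatives on Omega extend continuously to closure Omega, du and d2u being
   the extensions. *)
Record C2_closure Omega (u : M -> R) (du : chart M -> M -> 'rV[R]_n)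
    (d2u : chart M -> M -> 'M[R]_n) : Prop := {
  C2_closure_u : {within closure Omega, continuous u};
  C2_closure_du : forall c,
    {within closure Omega `&` dom c, continuous (du c)};
  C2_closure_d2u : forall c,
    {within closure Omega `&` dom c, continuous (d2u c)};
  C2_closure_duE : forall c x, Omega x -> dom c x ->
    du c x = partials (u \o cinv c) (local_coord c x);
  C2_closure_d2uE : forall c x, Omega x -> dom c x ->
    d2u c x = partials2 (u \o cinv c) (local_coord c x) }.

Section Jet.
Variables (u : M -> R) (du : chart M -> M -> 'rV[R]_n).
Variable d2u : chart M -> M -> 'M[R]_n.

(* components g^{ij} u_j of the gradient vector *)
Definition gradient c x : 'rV[R]_n := du c x *m invmx (metric c (local_coord c x)).

Definition hessian c x : 'M[R]_n := cov_hessian c (local_coord c x) (du c x) (d2u c x).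

Definition gradient_norm c x : R :=
  covec_norm (metric c (local_coord c x)) (du c x).

Definition hessian_norm c x : R :=
  tensor_norm (metric c (local_coord c x)) (hessian c x).

(* the (1,1)-tensor g^{-1} (D^2 u + a du (x) du + K g) *)
Definition augmented_hessian (a K : R) c x : 'M[R]_n :=
  let g := metric c (local_coord c x) in
  invmx g *m (hessian c x + a *: ((du c x)^T *m du c x) + K *: g).

Definition C1_norm A : R :=
  sup_on A (fun _ x => `|u x|) + sup_on A gradient_norm.

End Jet.

(* f = f(x, z) *)
Section FunctionOfPointAndValue.
Variable f : M -> R -> R.

Definition C2_point_value : Prop := forall c,
  Ck 2 [set yz : 'rV[R]_n * R | (local_coord c @` dom c) yz.1]
       (fun yz : 'rV[R]_n * R => f (cinv c yz.1) yz.2).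

(* f + |D_x f| + |f_z| + |D_x^2 f| + |D_x f_z| + |f_zz| at (x, z) *)
Definition f_jet_norm c x (z : R) : R :=
  let y := local_coord c x in
  let g := metric c y in
  let fz := fun y' : 'rV[R]_n => f (cinv c y') z in
  f x z + covec_norm g (partials fz y) + `|derive1 (f x) z|
  + tensor_norm g (cov_hessian c y (partials fz y) (partials2 fz y))
  + covec_norm g (partials (fun y' => derive1 (f (cinv c y')) z) y)
  + `|derive1n 2 (f x) z|.

End FunctionOfPointAndValue.

(* A function h on the tangent bundle is represented by its expressions
   h c y p, where p is the row of components of a tangent vector at the point
   with coordinates y. *)
Section FunctionOnTangentBundle.
Variable h : chart M -> 'rV[R]_n -> 'rV[R]_n -> R.

Definition tangent_function : Prop :=
  forall c c' x p, dom c x -> dom c' x ->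
    h c (local_coord c x) p =
    h c' (local_coord c' x) (p *m 'J (local_coord c' \o cinv c) (local_coord c x)).

Definition C2_tangent : Prop := forall c,
  Ck 2 [set yp : 'rV[R]_n * 'rV[R]_n | (local_coord c @` dom c) yp.1]
       (fun yp : 'rV[R]_n * 'rV[R]_n => h c yp.1 yp.2).

(* h has no explicit dependence on x: its covariant x-derivative
   h_{y^i} - Gamma^k_ij p^j h_{p^k} with p held fixed (that is, parallel)
   vanishes. *)
Definition x_independent : Prop := forall c x p (i : 'I_n), dom c x ->
  let y := local_coord c x in
  'D_(basis_vec i) (fun y' => h c y' p) y
  - \sum_k \sum_j christoffel c y k i j * p 0 j * 'D_(basis_vec k) (h c y) p
  = 0.

(* h_{p_i p_j} >= eps delta_ij in an orthonormal frame *)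
Definition uniformly_convex_in_p (eps : R) : Prop := forall c x p v, dom c x ->
  eps * inner c (local_coord c x) v v
  <= (v *m partials2 (h c (local_coord c x)) p *m v^T) 0 0.

(* h + |D_p h| + |D_p^2 h| at (x, p) *)
Definition h_jet_norm c x p : R :=
  let y := local_coord c x in
  let g := metric c y in
  h c y p + covec_norm g (partials (h c y) p)
  + tensor_norm g (partials2 (h c y) p).

End FunctionOnTangentBundle.

End RiemannianCalculus.

(* Main.v *)
Require Import Defs.
From HB Require Import structures.
From mathcomp Require Import all_boot all_order all_algebra perm.
From mathcomp Require Import all_classical all_reals all_analysis.
From mathcomp Require Import ring lra.
Import Order.TTheory GRing.Theory Num.Theory.
Import numFieldNormedType.Exports.
Local Open Scope classical_set_scope.
Local Open Scope ring_scope.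
Set Implicit Arguments.
Unset Strict Implicit.
Unset Printing Implicit Defensive.

(* The largest eigenvalue of W = D^2u + a du (x) du + K g is bounded at its
   maximum, and the trace of W is nonnegative, so D^2u is bounded.  If the
   maximum is on the frontier it is bounded by the boundary data.  At an
   interior maximum x0 take coordinates with g = 1, dg = 0 and W = diag(lam),
   lam_1 maximal.  The function W_11 - lam_1 g_11 has a maximum at x0 in every
   direction.  On the other hand, with F_i = dF/dlam_i and
   E = 1 - (g - 1) / 2, concavity and homogeneity of F together with a
   perturbed version of Schur's majorization theorem show that
   sum_i F_i (E W E)_ii - f h is bounded below by -o(t^2) along the first axis,
   with equality at x0; hence two inequalities for the second derivatives of W,
   and no derivative of an eigenvalue is needed.  Commuting derivatives with
   constant curvature K >= 0 gives (f h)_11 + 2 a u_1 (f h)_1 <= 0.  The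
   convexity of h in the gradient makes (f h)_11 at least of order u_11^2, while
   all the other terms are of order |u_11|. *)

(** The obstacle is that eigenvalues need not be differentiable where they coincide, while the
    equation must be differentiated twice. The weights F_i are therefore frozen at x0: the
    supporting hyperplane of [F] at lam bounds [F] of the eigenvalues, in any order, by a linear
    function, and a linear function of the diagonal entries of E W E is smooth. E is the first-order
    Taylor polynomial of the inverse square root of g at g = 1, hence affine in g; since dg = 0 at
    x0, the frame fails to be orthonormal only by o(t^2), which a second derivative test tolerates.
    Third derivatives of u enter (f h)_11 only through h_p. The vanishing of dW_11 turns them into
    curvature terms and terms -2 a u_1 u_1k, and the latter cancel against 2 a u_1 f h_1 in the
    final inequality. What remains is c_inf eps u_11^2 <= p + q |u_11| with p and q made of the
    listed quantities, whence an explicit constant. Up to the boundary only continuity of the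
    extended derivatives in charts is available, so identities valid inside are carried to the
    closure by density. *)

Lemma cvg_sumr (K : numFieldType) (T I : Type) (F : set_system T) {FF : Filter F}
    (r : seq I) (f : I -> T -> K) (l : I -> K) :
  (forall i, f i x @[x --> F] --> l i) ->
  \sum_(i <- r) f i x @[x --> F] --> \sum_(i <- r) l i.
Proof.
move=> h; elim: r => [|i r IH].
  under eq_fun do rewrite big_nil; rewrite big_nil; exact: cvg_cst.
by under eq_fun do rewrite big_cons; rewrite big_cons; apply: cvgD.
Qed.

(** * Quadratic forms and majorization *)

Section QuadraticForms.
Context {R : realType}.

Definition bform {n} (B : 'M[R]_n) (x y : 'rV[R]_n) : R := (x *m B *m y^T) 0 0.

Lemma bformE n (B : 'M[R]_n) x y :
  bform B x y = \sum_i \sum_j x 0 i * B i j * y 0 j.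
Proof.
rewrite /bform mxE exchange_big; apply: eq_bigr => j _.
by rewrite !mxE mulr_suml; apply: eq_bigr => i _.
Qed.

Lemma bformDl n (B : 'M[R]_n) x y z : bform B (x + y) z = bform B x z + bform B y z.
Proof. by rewrite /bform !mulmxDl mxE. Qed.
Lemma bformDr n (B : 'M[R]_n) x y z : bform B x (y + z) = bform B x y + bform B x z.
Proof. by rewrite /bform linearD mulmxDr mxE. Qed.
Lemma bformZl n (B : 'M[R]_n) a x y : bform B (a *: x) y = a * bform B x y.
Proof. by rewrite /bform -!scalemxAl mxE. Qed.
Lemma bformZr n (B : 'M[R]_n) a x y : bform B x (a *: y) = a * bform B x y.
Proof. by rewrite /bform linearZ -scalemxAr mxE. Qed.
Lemma bformNl n (B : 'M[R]_n) x y : bform B (- x) y = - bform B x y.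
Proof. by rewrite -scaleN1r bformZl mulN1r. Qed.
Lemma bformD n (B C : 'M[R]_n) x y : bform (B + C) x y = bform B x y + bform C x y.
Proof. by rewrite /bform mulmxDr mulmxDl mxE. Qed.
Lemma bformN n (B : 'M[R]_n) x y : bform (- B) x y = - bform B x y.
Proof. by rewrite /bform mulmxN mulNmx mxE. Qed.
Lemma bformZ n (a : R) (B : 'M[R]_n) x y : bform (a *: B) x y = a * bform B x y.
Proof. by rewrite /bform -scalemxAr -scalemxAl mxE. Qed.
Lemma bformC n (B : 'M[R]_n) x y : B^T = B -> bform B x y = bform B y x.
Proof.
move=> sB; rewrite /bform -[in RHS](trmxK y) -{2}sB -mulmxA.
by rewrite -!trmx_mul [RHS]mxE mulmxA.
Qed.
Lemma bform_mul n (B V : 'M[R]_n) x y : bform B (x *m V) (y *m V) = bform (V *m B *m V^T) x y.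
Proof. by rewrite /bform trmx_mul !mulmxA. Qed.
Lemma bform_delta n (B : 'M[R]_n) i j : bform B (delta_mx 0 i) (delta_mx 0 j) = B i j.
Proof.
by rewrite /bform -rowE trmx_delta -colE !mxE.
Qed.
Lemma bform0 n (B : 'M[R]_n) y : bform B 0 y = 0.
Proof. by rewrite /bform !mul0mx mxE. Qed.

Definition posdef {n} (B : 'M[R]_n) :=
  B^T = B /\ forall x, x != 0 -> 0 < bform B x x.
Definition psd {n} (B : 'M[R]_n) :=
  B^T = B /\ forall x, 0 <= bform B x x.

Lemma posdef1 n : posdef (1%:M : 'M[R]_n).
Proof.
split=> [|x x0]; first exact: trmx1.
rewrite /bform mulmx1 mxE lt_neqAle eq_sym.
rewrite sumr_ge0 ?andbT => [|i _]; last by rewrite mxE -expr2 sqr_ge0.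
apply: contra x0; rewrite psumr_eq0 => [/allP h|i _]; last by rewrite mxE -expr2 sqr_ge0.
apply/eqP/rowP => i; rewrite mxE.
by have /= := h i (mem_index_enum _); rewrite mxE mulf_eq0 orbb => /eqP.
Qed.

(** Cauchy-Schwarz: were b = B(x, y) nonzero for some y, the form would be negative at x + t y with
    t = -b / (1 + c), where c = B(y, y). Dividing by 1 + c instead of c covers c = 0. *)
Lemma psd_null n (B : 'M[R]_n) x : psd B -> bform B x x = 0 -> x *m B = 0.
Proof.
move=> [sB pB] x0.
have key y : bform B x y = 0.
  apply/eqP; apply: contraT => b0.
  set b := bform B x y in b0 *; set c := bform B y y.
  have c0 : 0 <= c by exact: pB.
  have h := pB (x + (- b / (1 + c)) *: y); have c1 : 0 < 1 + c by lra.
  have b2 : 0 < b ^+ 2 by rewrite exprn_even_gt0.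
  have e : bform B (x + (- b / (1 + c)) *: y) (x + (- b / (1 + c)) *: y)
      = - (b ^+ 2 * (2 + c)) / (1 + c) ^+ 2.
    rewrite !(bformDl, bformDr, bformZl, bformZr) x0 (bformC y x sB) -/b -/c.
    by field; rewrite gt_eqF.
  move: h; rewrite e ler_pdivlMr ?exprn_gt0// mul0r oppr_ge0 leNgt mulr_gt0//; lra.
apply/rowP => j; have := key (delta_mx 0 j).
by rewrite /bform trmx_delta -colE !mxE.
Qed.

Lemma posdef_unit n (B : 'M[R]_n) : posdef B -> B \in unitmx.
Proof.
move=> [sB pB]; rewrite -row_free_unit -kermx_eq0.
apply/rowV0P => v /sub_kermxP vB; apply/eqP; apply: contraT => /pB.
by rewrite /bform vB mul0mx mxE ltxx.
Qed.

Lemma posdef_congr n (B V : 'M[R]_n) : V \in unitmx -> posdef B -> posdef (V *m B *m V^T).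
Proof.
move=> uV [sB pB]; split; first by rewrite !trmx_mul trmxK sB mulmxA.
move=> x x0; rewrite -bform_mul; apply: pB; apply: contra x0 => /eqP h.
by rewrite -(mulmxK uV x) h mul0mx.
Qed.

Lemma continuous_bform n (B : 'M[R]_n) : continuous (fun x => bform B x x).
Proof.
move=> x; rewrite /bform.
under [X in continuous_at _ X]eq_fun do rewrite -/(bform B _ _) bformE.
rewrite /continuous_at.
apply: (@cvg_sumr R _ _ (nbhs x)) => i; apply: (@cvg_sumr R _ _ (nbhs x)) => j.
by apply: cvgM; [apply: cvgM; [exact: coord_continuous|exact: cvg_cst]|exact: coord_continuous].
Qed.

End QuadraticForms.

(** * Spectral theorem for real symmetric matrices *)

Section Spectral.
Context {R : realType}.

Definition sqn {n} (x : 'rV[R]_n) : R := \sum_i x 0 i ^+ 2.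

Lemma bform1 n (x : 'rV[R]_n) : bform 1%:M x x = sqn x.
Proof.
by rewrite /bform mulmx1 mxE; apply: eq_bigr => i _; rewrite mxE expr2.
Qed.

Lemma sqn_ge0 n (x : 'rV[R]_n) : 0 <= sqn x.
Proof. by apply: sumr_ge0 => i _; exact: sqr_ge0. Qed.

Lemma sqn_gt0 n (x : 'rV[R]_n) : x != 0 -> 0 < sqn x.
Proof. by move=> x0; rewrite -bform1; exact: (posdef1 n).2. Qed.

Lemma sqr_coord_le n (x : 'rV[R]_n) i : x 0 i ^+ 2 <= sqn x.
Proof.
rewrite /sqn (bigD1 i)//= lerDl sumr_ge0// => j _; exact: sqr_ge0.
Qed.

Lemma compact_sphere n : compact [set x : 'rV[R]_n | sqn x = 1].
Proof.
apply: bounded_closed_compact.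
  exists 1; split => // r r1 x /= x1.
  rewrite [leLHS]mx_normrE; apply: bigmax_le; first by lra.
  move=> [i j] _ /=; rewrite ord1.
  have := sqr_coord_le x j; rewrite x1 -real_normK ?num_real// => h.
  by have := normr_ge0 (x 0 j); nra.
have -> : [set x : 'rV[R]_n | sqn x = 1] = (fun x => bform 1%:M x x) @^-1` [set 1].
  by apply/seteqP; split => x /=; rewrite bform1.
apply: closed_comp; last exact: closed_eq.
by move=> x _; exact: continuous_bform.
Qed.

Lemma nz_sphere n (x : 'rV[R]_n) : x != 0 -> sqn ((Num.sqrt (sqn x))^-1 *: x) = 1.
Proof.
move=> x0; have s0 := sqn_gt0 x0.
rewrite -bform1 bformZl bformZr bform1 mulrA -expr2 exprVn sqr_sqrtr ?ltW//.
by rewrite mulVf// gt_eqF.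
Qed.

Lemma sphere_max n (B : 'M[R]_n) : (0 < n)%N ->
  exists2 x, sqn x = 1 & forall y, bform B y y <= bform B x x * sqn y.
Proof.
move=> n0; pose i0 := Ordinal n0.
have nS : [set x : 'rV[R]_n | sqn x = 1] !=set0.
  exists (delta_mx 0 i0) => /=; rewrite -bform1 bform_delta mxE eqxx//.
have cB : {within [set x : 'rV[R]_n | sqn x = 1], continuous (fun x => bform B x x)}.
  by apply: continuous_subspaceT => x; exact: continuous_bform.
have [x /[!inE] /= x1 xm] := EVT_max_rV nS (@compact_sphere n) cB.
exists x => // y; have [->|y0] := eqVneq y 0.
  by rewrite bform0 -bform1 bform0 mulr0.
have := xm _ (mem_set (nz_sphere y0)).
rewrite bformZl bformZr mulrA -expr2 exprVn sqr_sqrtr ?sqn_ge0//.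
by rewrite ler_pdivrMl ?sqn_gt0// mulrC.
Qed.

(** The eigenvector is a maximum point x of the quadratic form on the unit sphere: with mu the
    maximum, the form mu - B is semidefinite and vanishes at x, so x lies in its kernel. No complex
    eigenvalue is involved. *)
Lemma sym_eigen n (B : 'M[R]_n) : (0 < n)%N -> B^T = B ->
  exists x mu, sqn x = 1 /\ x *m B = mu *: x.
Proof.
move=> n0 sB; have [x x1 xm] := sphere_max B n0.
exists x, (bform B x x); split=> //.
have p : psd (bform B x x *: 1%:M - B).
  split=> [|y]; first by rewrite linearB linearZ /= trmx1 sB.
  by rewrite bformD bformN bformZ bform1 subr_ge0.
have /(psd_null p) : bform (bform B x x *: 1%:M - B) x x = 0.
  by rewrite bformD bformN bformZ bform1 x1 mulr1 subrr.
by rewrite mulmxBr -scalemxAr mulmx1 => /eqP; rewrite subr_eq0 => /eqP.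
Qed.

(** [H] is the reflection exchanging x and the first basis vector, 1 - 2 w^T w / |w|^2 with w their
    difference. The degenerate case w = 0 takes the identity. *)
Lemma householder n (x : 'rV[R]_n.+1) : sqn x = 1 ->
  exists H : 'M[R]_n.+1, [/\ H^T = H, H *m H = 1%:M & delta_mx 0 0 *m H = x].
Proof.
move=> x1; have [w wE] : {w | w = delta_mx 0 0 - x} by eexists.
have [w0|w0] := eqVneq w 0.
  exists 1%:M; split; rewrite ?trmx1 ?mulmx1//.
  by move/eqP: w0; rewrite wE subr_eq0 => /eqP.
pose s := sqn w; have s0 : 0 < s by exact: sqn_gt0.
have ss : w *m w^T = s%:M.
  by rewrite [LHS]mx11_scalar /s -bform1 /bform mulmx1.
have sE : s = 2 * (1 - x 0 0).
  rewrite /s -bform1 wE bformDl bformNl !bformDr.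
  rewrite -scaleN1r !bformZr bform_delta bform1 x1.
  rewrite (bformC (B := 1%:M) x); last exact: trmx1.
  have -> : bform 1%:M (delta_mx 0 0) x = x 0 0.
    by rewrite /bform mulmx1 -rowE !mxE.
  by rewrite !mxE eqxx /=; ring.
exists (1%:M - (2 / s) *: (w^T *m w)); split.
- by rewrite linearB linearZ /= trmx1 trmx_mul trmxK.
- rewrite mulmxBl mul1mx mulmxBr mulmx1 -scalemxAl -scalemxAr.
  rewrite -mulmxA (mulmxA w) ss mul_scalar_mx -scalemxAr !scalerA.
  rewrite (_ : 2 / s * (2 / s * s) = 2 / s + 2 / s); last by field; rewrite gt_eqF.
  by rewrite scalerDl opprB addrK subrK.
- rewrite mulmxBr mulmx1 -scalemxAr mulmxA.
  have -> : delta_mx 0 0 *m w^T = (1 - x 0 0)%:M :> 'M[R]_1.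
    rewrite [LHS]mx11_scalar; congr (_%:M).
    by rewrite -rowE wE !mxE !eqxx.
  rewrite mul_scalar_mx scalerA (_ : 2 / s * (1 - x 0 0) = 1).
    by rewrite scale1r wE opprB addrC subrK.
  have : 1 - x 0 0 != 0 by rewrite sE in s0; apply/eqP => h; rewrite h in s0; lra.
  by rewrite sE => h; field.
Qed.

(** Induction on the size. A reflection carries a unit eigenvector to the first basis vector, so the
    conjugate [C] has first row mu e_0; by symmetry the first column has the same form, and the
    induction hypothesis diagonalizes the lower block. *)
Lemma spectral n (B : 'M[R]_n) : B^T = B ->
  exists (Q : 'M[R]_n) d, Q *m Q^T = 1%:M /\ Q *m B *m Q^T = diag_mx d.
Proof.
elim: n B => [|n IH] B sB.
  by exists 1%:M, 0; split; apply/matrixP => -[].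
have [//|x [mu [x1 xB]]] := @sym_eigen n.+1 B _ sB.
have [H [sH HH eH]] := householder x1.
pose C : 'M[R]_(1 + n) := H *m B *m H.
have sC : C^T = C by rewrite /C !trmx_mul sH sB mulmxA.
have rC : (delta_mx 0 0 : 'rV_n.+1) *m C = mu *: delta_mx 0 0.
  by rewrite /C !mulmxA eH xB -scalemxAl -eH -mulmxA HH mulmx1.
have C00 j : C 0 j = mu * (0 == j)%:R.
  have := congr1 (fun v : 'rV_n.+1 => v 0 j) rC.
  by rewrite -rowE !mxE eqxx /= eq_sym.
have CH : C = H *m B *m H by [].
clearbody C.
have CE : C = block_mx mu%:M 0 0 (drsubmx C).
  rewrite -[C in LHS]submxK; congr block_mx.
  - apply/matrixP => i j; rewrite !ord1 !mxE.
    by rewrite (_ : lshift n 0 = 0) ?C00 ?eqxx ?mulr1 //; apply: val_inj.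
  - apply/matrixP => i j; rewrite !ord1 !mxE.
    by rewrite (_ : lshift n 0 = 0) ?C00 ?mulr0 //; apply: val_inj.
  - apply/matrixP => i j; rewrite !ord1 !mxE -sC mxE.
    by rewrite (_ : lshift n 0 = 0) ?C00 ?mulr0 //; apply: val_inj.
have sD : (drsubmx C)^T = drsubmx C by rewrite trmx_drsub sC.
have [Q [d [QQ Qd]]] := IH _ sD.
pose P : 'M[R]_(1 + n) := block_mx 1%:M 0 0 Q.
have PT : P^T = block_mx (1%:M : 'M[R]_1) 0 0 (Q^T).
  by rewrite /P tr_block_mx !trmx0 trmx1.
exists (P *m H), (row_mx mu%:M d); split.
  rewrite trmx_mul sH -mulmxA (mulmxA H) HH mul1mx.
  rewrite PT; have -> : P *m block_mx (1%:M : 'M[R]_1) 0 0 (Q^T) =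
      block_mx 1%:M 0 0 (Q *m Q^T).
    by rewrite /P mulmx_block !mulmx0 !mul0mx !mulmx1 !addr0 add0r.
  by rewrite QQ -scalar_mx_block.
rewrite trmx_mul sH (_ : _ *m _ = P *m C *m P^T); last by rewrite CH !mulmxA.
rewrite PT CE; have -> : P *m block_mx mu%:M 0 0 (drsubmx C) *m
    block_mx (1%:M : 'M[R]_1) 0 0 (Q^T) = block_mx mu%:M 0 0 (diag_mx d).
  rewrite /P !mulmx_block.
  by rewrite !mulmx0 !mul0mx !mulmx1 !mul1mx !addr0 !add0r !mul0mx Qd.
transitivity (block_mx (diag_mx (mu%:M : 'rV[R]_1)) 0 0 (diag_mx d)); last first.
  by apply/esym; exact: (@diag_mx_row R n 1 mu%:M d).
suff -> : diag_mx (mu%:M : 'rV[R]_1) = mu%:M by [].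
by apply/matrixP => i j; rewrite !ord1 !mxE.
Qed.

(** The rows of [E] are an orthonormal basis for [G]: diagonalize, then divide each axis by the
    square root of its eigenvalue. *)
Lemma posdef_frame n (G : 'M[R]_n) : posdef G ->
  exists E : 'M[R]_n, E *m G *m E^T = 1%:M.
Proof.
move=> [sG pG]; have [Q [d [QQ Qd]]] := spectral sG.
have uQ : Q \in unitmx by case: (mulmx1_unit QQ).
have d0 i : 0 < d 0 i.
  have := (posdef_congr uQ (conj sG pG)).2 (delta_mx 0 i).
  rewrite Qd bform_delta mxE eqxx mulr1n; apply.
  by apply/eqP => /rowP/(_ i); rewrite !mxE !eqxx => /eqP; rewrite oner_eq0.
pose S : 'M[R]_n := diag_mx (\row_i (Num.sqrt (d 0 i))^-1).
exists (S *m Q); rewrite trmx_mul tr_diag_mx !mulmxA.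
rewrite -(mulmxA S) -(mulmxA S) Qd.
rewrite /S !mulmx_diag; apply/matrixP => i j; rewrite !mxE.
have [_|_] := eqVneq i j; last by rewrite mulr0n.
rewrite mulr1n mulrAC -expr2 exprVn sqr_sqrtr ?ltW// mulVf ?gt_eqF//.
Qed.

(** A rotation keeps an orthonormal frame of [G] orthonormal, so the second form can be diagonalized
    afterwards. *)
Lemma simdiag n (G B : 'M[R]_n) : posdef G -> B^T = B ->
  exists (V : 'M[R]_n) d, V *m G *m V^T = 1%:M /\ V *m B *m V^T = diag_mx d.
Proof.
move=> /posdef_frame[E EG] sB.
have [|Q [d [QQ Qd]]] := @spectral n (E *m B *m E^T).
  by rewrite !trmx_mul trmxK sB mulmxA.
exists (Q *m E), d; rewrite trmx_mul; split; last by rewrite -Qd !mulmxA.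
have -> : Q *m E *m G *m (E^T *m Q^T) = Q *m (E *m G *m E^T) *m Q^T by rewrite !mulmxA.
by rewrite EG mulmx1.
Qed.

End Spectral.

(** * Eigenvalues of a form relative to a metric *)

Section Spectrum.
Context {R : realType}.

Lemma char_poly_similar n (A P : 'M[R]_n) : P \in unitmx ->
  char_poly (P *m A *m invmx P) = char_poly A.
Proof.
move=> uP; rewrite /char_poly /char_poly_mx.
have -> : 'X%:M - map_mx polyC (P *m A *m invmx P) =
    map_mx polyC P *m ('X%:M - map_mx polyC A) *m map_mx polyC (invmx P).
  rewrite mulmxBr mulmxBl !map_mxM; congr (_ - _).
  by rewrite scalar_mxC -mulmxA -map_mxM mulmxV// map_mx1 mulmx1.
rewrite !det_mulmx mulrC mulrA -det_mulmx -map_mxM mulVmx//.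
by rewrite map_mx1 det1 mul1r.
Qed.

(** The relation on [G] says invmx G = V^T V, so invmx G *m B is the conjugate of diag d by V^T. *)
Lemma is_spectrum_frame n (G B V : 'M[R]_n) d : G \in unitmx ->
  V *m G *m V^T = 1%:M -> V *m B *m V^T = diag_mx d ->
  is_spectrum (invmx G *m B) d.
Proof.
move=> uG VG VB.
have uV : V \in unitmx by have [] := mulmx1_unit VG; rewrite unitmx_mul => /andP[].
have uVT : V^T \in unitmx by rewrite unitmx_tr.
have GE : invmx G = V^T *m V.
  have VGV : V^T *m (V *m G) = 1%:M by apply: mulmx1C.
  by rewrite -[LHS]mul1mx -VGV !mulmxA mulmxK.
rewrite /is_spectrum.
have -> : invmx G *m B = V^T *m diag_mx d *m invmx V^T.
  by rewrite GE -VB !mulmxA mulmxK.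
rewrite char_poly_similar// char_poly_trig ?diag_mx_is_trig//.
by apply: eq_bigr => i _; rewrite mxE eqxx mulr1n.
Qed.

(** Unique factorization of the characteristic polynomial into linear factors. *)
Lemma is_spectrum_uniq n (A : 'M[R]_n) d d' : is_spectrum A d -> is_spectrum A d' ->
  exists s : 'S_n, d' = col_perm s d.
Proof.
rewrite /is_spectrum => -> h.
pose t := [tuple d 0 i | i < n]; pose t' := [tuple d' 0 i | i < n].
have /tuple_permP[s st] : perm_eq t' t.
  apply/prod_XsubC_eq; rewrite !big_tuple.
  under eq_bigr do rewrite /t' tnth_mktuple.
  by under [RHS]eq_bigr do rewrite /t tnth_mktuple.
exists s; apply/rowP => i; rewrite mxE.
have nt (g : 'I_n -> R) : [tuple g j | j < n]`_i = g i.
  by rewrite -tnth_nth tnth_mktuple.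
by have := congr1 (fun x => nth 0 x i) st; rewrite !nt tnth_mktuple.
Qed.

Lemma sort_perm n (x : 'I_n -> R) :
  exists s : 'S_n, forall i j : 'I_n, (i <= j)%N -> x (s i) <= x (s j).
Proof.
pose t := [tuple x i | i < n].
have /tuple_permP[s st] : perm_eq (sort <=%R t) t by rewrite perm_sort.
exists s => i j ij.
have nt (g : 'I_n -> R) (k : 'I_n) : [tuple g j | j < n]`_k = g k.
  by rewrite -tnth_nth tnth_mktuple.
have e (k : 'I_n) : (sort <=%R t)`_k = x (s k) by rewrite st nt tnth_mktuple.
rewrite -!e; apply: (sorted_leq_nth le_trans lexx) => //; rewrite ?inE ?size_sort ?size_tuple//.
by apply: sort_sorted; exact: le_total.
Qed.

End Spectrum.

(** * Schur majorization for almost orthogonal matrices *)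

Section SchurHorn.
Context {R : realType}.

(* b is a discrete Legendre potential: it makes the antimonotone pairing of f
   and m optimal among all assignments, by linear programming duality. *)
Lemma legendre_potential N (f m : nat -> R) :
  (forall i j, (i <= j <= N)%N -> f j <= f i) ->
  (forall i j, (i <= j <= N)%N -> m i <= m j) ->
  let b j := \sum_(0 <= k < j) f k.+1 * (m k.+1 - m k) in
  forall i j, (i <= N)%N -> (j <= N)%N -> b j - b i <= f i * (m j - m i).
Proof.
move=> hf hm b.
have bS j : b j.+1 = b j + f j.+1 * (m j.+1 - m j) by rewrite /b big_nat_recr.
have up i j : (i <= j)%N -> (j <= N)%N ->
    b j - b i <= f i * (m j - m i) /\ f j * (m j - m i) <= b j - b i.
  elim: j => [|j IH] ij jN.
    by move: ij; rewrite leqn0 => /eqP ->; rewrite !subrr !mulr0.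
  move: ij; rewrite leq_eqVlt => /orP[/eqP ->|ij]; first by rewrite !subrr !mulr0.
  have [h1 h2] := IH ij (ltnW jN); rewrite bS.
  have m1 : m j <= m j.+1 by apply: hm; rewrite leqnSn.
  have m2 : m i <= m j by apply: hm; rewrite -ltnS ij ltnW.
  have f1 : f j.+1 <= f i by apply: hf; rewrite ltnW//.
  have f2 : f j.+1 <= f j by apply: hf; rewrite leqnSn.
  by split; nra.
move=> i j iN jN; have [ij|ji] := leqP i j; first by have [] := up i j ij jN.
by have [h1 h2] := up j i (ltnW ji) iN; lra.
Qed.

(** Linear programming duality for the assignment problem. Sorting [F] downwards and [mu] upwards
    gives the permutation of least pairing; the Legendre potential b gives the dual variables al = f
    x - b and be = b, whose constraints are exactly [legendre_potential]. Their bounds matter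
    because they later multiply the defect of an almost orthogonal matrix. *)
Lemma assignment_dual n (F mu : 'I_n -> R) (Fm m : R) :
  (forall i, 0 <= F i <= Fm) -> (forall i, `|mu i| <= m) ->
  exists (pi : 'S_n) (al be : 'I_n -> R),
    [/\ forall i j, al i + be j <= F i * mu j,
        \sum_i al i + \sum_j be j = \sum_i F i * mu (pi i) &
        forall i, `|al i| <= 3 * Fm * m /\ `|be i| <= 3 * Fm * m].
Proof.
case: n F mu => [|n] F mu hF hmu.
  by exists 1%g, (fun=> 0), (fun=> 0); split=> [[]//||[]//]; rewrite !big_ord0 addr0.
have [r hr] := sort_perm (fun i => - F i).
have [s hs] := sort_perm mu.
pose f k := F (r (inord k)); pose x k := mu (s (inord k)).
pose b j := \sum_(0 <= k < j) f k.+1 * (x k.+1 - x k).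
have fE (i : 'I_n.+1) : f i = F (r i) by rewrite /f inord_val.
have xE (i : 'I_n.+1) : x i = mu (s i) by rewrite /x inord_val.
have hf i j : (i <= j <= n)%N -> f j <= f i.
  move=> /andP[ij jn]; rewrite -lerN2; apply: hr.
  by rewrite !inordK// ltnS// (leq_trans ij).
have hx i j : (i <= j <= n)%N -> x i <= x j.
  move=> /andP[ij jn]; apply: hs.
  by rewrite !inordK// ltnS// (leq_trans ij).
have pot := legendre_potential hf hx; rewrite -/b /= in pot.
have b0 : b 0%N = 0 by rewrite /b big_geq.
have Fm0 : 0 <= Fm by have /andP[] := hF ord0; exact: le_trans.
(* As b 0 = 0, the inequality between the indices 0 and j, used both ways, places b j between f j (x
   j - x 0) and f 0 (x j - x 0). *)
have hb j : (j <= n)%N -> `|b j| <= 2 * Fm * m.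
  move=> jn; have h1 := pot 0%N j (leq0n _) jn; have h2 := pot j 0%N jn (leq0n _).
  rewrite -/(b j) -/(b 0%N) b0 in h1 h2.
  have /andP[f0 f0m] := hF (r (inord 0)); rewrite -/(f 0%N) in f0 f0m.
  have /andP[fj fjm] := hF (r (inord j)); rewrite -/(f j) in fj fjm.
  have := hmu (s (inord 0)); rewrite -/(x 0%N) ler_norml => /andP[x01 x02].
  have := hmu (s (inord j)); rewrite -/(x j) ler_norml => /andP[xj1 xj2].
  have x0j : x 0%N <= x j by apply: hx; rewrite jn.
  by rewrite ler_norml; apply/andP; split; nra.
exists (r^-1 * s)%g, (fun i => f (r^-1 i)%g * x (r^-1 i)%g - b (r^-1 i)%g), (fun j => b (s^-1 j)%g).
split.
- move=> i j; have := pot (r^-1 i)%g (s^-1 j)%g (leq_ord _) (leq_ord _).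
  rewrite fE permKV (xE (s^-1 j)%g) permKV; lra.
- rewrite (reindex_inj (@perm_inj _ r)) /=.
  rewrite [X in _ + X](reindex_inj (@perm_inj _ s)) /= -big_split /=.
  rewrite [RHS](reindex_inj (@perm_inj _ r)) /=; apply: eq_bigr => i _.
  by rewrite !permK permM permK subrK fE xE.
- move=> i; split; last first.
    apply: le_trans (hb _ (leq_ord _)) _.
    by have := le_trans (normr_ge0 _) (hmu ord0); nra.
  apply: le_trans (ler_normB _ _) _.
  have := hb _ (leq_ord (r^-1 i)%g); rewrite fE permKV xE normrM.
  have /andP[F0 F1] := hF i; have := hmu (s (r^-1 i)%g).
  rewrite (ger0_norm F0); have := normr_ge0 (mu (s (r^-1 i)%g)); nra.
Qed.

(** The two products have equal trace and equal trace of the square. As the defects are symmetric,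
    both sides are squared Frobenius norms. *)
Lemma trace_sqr_defect n (Q : 'M[R]_n) :
  \tr ((Q^T *m Q - 1%:M) *m (Q^T *m Q - 1%:M)) = \tr ((Q *m Q^T - 1%:M) *m (Q *m Q^T - 1%:M)).
Proof.
have e (A : 'M[R]_n) : \tr ((A - 1%:M) *m (A - 1%:M)) = \tr (A *m A) - \tr A *+ 2 + n%:R.
  rewrite mulmxBl mulmxBr mulmx1 mul1mx !linearB /= mxtrace1; ring.
rewrite !e (mxtrace_mulC Q^T Q); congr (_ - _ + _).
by rewrite -(mulmxA Q^T) mxtrace_mulC !mulmxA.
Qed.

(** Near orthonormality passes from the rows to the columns at the cost of a factor n: the two
    defects have the same Frobenius norm, and one of them is a sum of n^2 squares, each at most
    d^2. *)
Lemma diag_defect n (Q : 'M[R]_n) (d : R) :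
  (forall i j, `|(Q *m Q^T - 1%:M) i j| <= d) ->
  forall j, `|(Q^T *m Q) j j - 1| <= n%:R * d.
Proof.
move=> hd j.
have d0 : 0 <= d by apply: le_trans (hd j j).
have tE (A : 'M[R]_n) : A^T = A -> \tr (A *m A) = \sum_i \sum_k A i k ^+ 2.
  move=> sA; apply: eq_bigr => i _; rewrite mxE; apply: eq_bigr => k _.
  by rewrite expr2 -[in X in _ * X]sA mxE.
have h := trace_sqr_defect Q; rewrite !tE in h; last 2 first.
  by rewrite linearB /= trmx1 trmx_mul trmxK.
  by rewrite linearB /= trmx1 trmx_mul trmxK.
have h1 : ((Q^T *m Q - 1%:M) j j) ^+ 2 <= (n%:R * d) ^+ 2.
  apply: (@le_trans _ _ (\sum_i \sum_k ((Q^T *m Q - 1%:M) i k) ^+ 2)).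
    rewrite (bigD1 j)//= (bigD1 j)//= -addrA lerDl addr_ge0//.
      by apply: sumr_ge0 => i _; exact: sqr_ge0.
    by apply: sumr_ge0 => i _; apply: sumr_ge0 => k _; exact: sqr_ge0.
  rewrite h; apply: (@le_trans _ _ (\sum_(i < n) \sum_(k < n) d ^+ 2)).
    apply: ler_sum => i _; apply: ler_sum => k _.
    by rewrite -real_normK ?num_real// ler_pXn2r// nnegrE.
  by rewrite !sumr_const card_ord -mulrnA mulr_natl exprMn_n mulnn.
have -> : (Q^T *m Q) j j - 1 = (Q^T *m Q - 1%:M) j j by rewrite !mxE eqxx.
rewrite -(@ler_pXn2r _ 2%N) ?nnegrE ?normr_ge0 ?mulr_ge0//.
by rewrite real_normK ?num_real.
Qed.

Lemma sum_ge_const n (f : 'I_n -> R) c : (forall i, - c <= f i) -> - (n%:R * c) <= \sum_i f i.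
Proof.
move=> h; apply: (@le_trans _ _ (\sum_(i < n) - c)); last exact: ler_sum.
by rewrite sumr_const card_ord mulNrn mulr_natl.
Qed.

(** For orthogonal Q the squares Q_ij^2 form a doubly stochastic matrix; the dual inequality al_i +
    be_j <= F_i mu_j, weighted by them, then gives sum al + sum be, the least pairing. Duality
    replaces Birkhoff's theorem here, and it survives perturbation: in general the row sums are off
    by d and the column sums by n d. *)
Lemma almost_schur_horn n (F : 'I_n -> R) (mu : 'rV[R]_n) (Q : 'M[R]_n) (Fm m d : R) :
  (forall i, 0 <= F i <= Fm) -> (forall i, `|mu 0 i| <= m) ->
  (forall i j, `|(Q *m Q^T - 1%:M) i j| <= d) ->
  exists pi : 'S_n,
    \sum_i F i * mu 0 (pi i) <=
    \sum_i F i * (Q *m diag_mx mu *m Q^T) i i + 6 * n%:R ^+ 2 * Fm * m * d.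
Proof.
move=> hF hmu hd.
have [n0|n0] := posnP n.
  by exists 1%g; subst n; rewrite !big_ord0 expr2 !(mulr0, mul0r) addr0.
have i0 : 'I_n := Ordinal n0.
have d0 : 0 <= d by apply: le_trans (hd i0 i0).
have m0 : 0 <= m by apply: le_trans (hmu i0).
have Fm0 : 0 <= Fm by have /andP[] := hF i0; exact: le_trans.
have hd' := diag_defect hd.
have [pi [al [be [h1 h2 h3]]]] := assignment_dual hF hmu.
exists pi; rewrite -h2.
have QE i : (Q *m diag_mx mu *m Q^T) i i = \sum_j Q i j ^+ 2 * mu 0 j.
  rewrite mxE; apply: eq_bigr => j _; rewrite mul_mx_diag !mxE; ring.
have rE i : \sum_j Q i j ^+ 2 = (Q *m Q^T - 1%:M) i i + 1.
  rewrite !mxE eqxx subrK; apply: eq_bigr => j _; rewrite mxE expr2//.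
have cE j : \sum_i Q i j ^+ 2 = ((Q^T *m Q) j j - 1) + 1.
  rewrite subrK mxE; apply: eq_bigr => i _; rewrite mxE expr2//.
have hS : \sum_i \sum_j Q i j ^+ 2 * (al i + be j) <=
    \sum_i F i * (Q *m diag_mx mu *m Q^T) i i.
  apply: ler_sum => i _; rewrite QE mulr_sumr; apply: ler_sum => j _.
  by rewrite mulrCA ler_wpM2l ?sqr_ge0.
apply: le_trans (lerD hS (lexx _)).
have -> : \sum_i \sum_j Q i j ^+ 2 * (al i + be j) =
   \sum_i al i + \sum_j be j + (\sum_i al i * (Q *m Q^T - 1%:M) i i
     + \sum_j be j * ((Q^T *m Q) j j - 1)).
  have -> : \sum_i \sum_j Q i j ^+ 2 * (al i + be j) =
      \sum_i al i * (\sum_j Q i j ^+ 2) + \sum_j be j * (\sum_i Q i j ^+ 2).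
    under [X in _ = _ + X]eq_bigr do rewrite mulr_sumr.
    rewrite [X in _ = _ + X]exchange_big -big_split /=; apply: eq_bigr => i _.
    rewrite mulr_sumr -big_split /=; apply: eq_bigr => j _; ring.
  under eq_bigr do rewrite rE mulrDr mulr1.
  under [X in _ + X = _]eq_bigr do rewrite cE mulrDr mulr1.
  rewrite !big_split /=; ring.
(* Each of the n rows costs 3 c and each of the n columns 3 n c, together at most 6 n^2 c since n >=
   1. *)
rewrite -addrA lerDl; set c := Fm * m * d.
have c0 : 0 <= c by rewrite !mulr_ge0.
have nc : 0 <= n%:R * c by rewrite mulr_ge0.
have n1 : 1 <= n%:R :> R by rewrite ler1n.
have s1 : - (n%:R * (3 * c)) <= \sum_i al i * (Q *m Q^T - 1%:M) i i.
  apply: sum_ge_const => i; have [h _] := h3 i.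
  apply: lerNnormlW; rewrite normrM (_ : 3 * c = 3 * Fm * m * d); last by rewrite /c; ring.
  exact: ler_pM.
have s2 : - (n%:R * (n%:R * (3 * c))) <= \sum_j be j * ((Q^T *m Q) j j - 1).
  apply: sum_ge_const => i; have [_ h] := h3 i.
  apply: lerNnormlW; rewrite normrM (_ : n%:R * (3 * c) = 3 * Fm * m * (n%:R * d)); last by rewrite /c; ring.
  exact: ler_pM.
rewrite (_ : 6 * n%:R ^+ 2 * Fm * m * d = 6 * (n%:R * (n%:R * c))); last by rewrite /c; ring.
by nra.
Qed.

End SchurHorn.

Lemma near_open (T : topologicalType) (U : set T) x : open U -> U x -> \forall y \near x, U y.
Proof. by move=> oU Ux; exact: open_nbhs_nbhs. Qed.

Lemma derive_sub {K : numFieldType} {V : normedModType K} (f g : V -> K) x v :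
  derivable f x v -> derivable g x v ->
  derivable (fun t => f t - g t) x v /\ 'D_v (fun t => f t - g t) x = 'D_v f x - 'D_v g x.
Proof. by move=> df dg; split; [exact: derivableB|exact: deriveB]. Qed.

(** * Functions of class C^k *)

Section LineCalculus.
Context {R : realType} {V : normedModType R}.

Lemma derivable_lineP (W : normedModType R) (f : V -> W) (x v : V) (s : R) :
  derivable f (s *: v + x) v <-> derivable (fun t : R => f (t *: v + x)) s 1.
Proof.
rewrite derivable1P [X in _ <-> X]derivable1P.
rewrite (_ : (fun h : R => f (h *: v + (s *: v + x))) =
  (fun h : R => f ((h *: 1 + s) *: v + x)))//.
by apply/funext => h; rewrite [_ *: 1]mulr1 scalerDl addrA.
Qed.

Lemma derive_line (W : normedModType R) (f : V -> W) (x v : V) (s : R) :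
  'D_1 (fun t : R => f (t *: v + x)) s = 'D_v f (s *: v + x).
Proof.
rewrite /derive (_ : (fun h : R => h^-1 *: (_ - _)) =
  fun h : R => h^-1 *: ((f \o shift (s *: v + x)) (h *: v) - f (s *: v + x)))//.
by apply/funext => h /=; rewrite [_ *: 1]mulr1 scalerDl addrA.
Qed.

(** Stated with |s| <= |h| so as to cover steps of either sign and the zero step. *)
Lemma line_MVT (f : V -> R) (x v : V) (h : R) :
  (forall s : R, `|s| <= `|h| -> derivable f (s *: v + x) v) ->
  exists2 s : R, `|s| <= `|h| & f (h *: v + x) - f x = h * 'D_v f (s *: v + x).
Proof.
move=> df; pose g t := f (t *: v + x).
have dg (s : R) : `|s| <= `|h| -> is_derive s 1 g ('D_v f (s *: v + x)).
  move=> sh; rewrite -derive_line; apply: derivableP.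
  exact/derivable_lineP/df.
have g0 : g 0 = f x by rewrite /g scale0r add0r.
have cg (s : R) : `|s| <= `|h| -> {for s, continuous g}.
  move=> sh; apply: differentiable_continuous.
  by apply/derivable1_diffP; have [] := dg _ sh.
have [h0|h0|->] := ltgtP h 0; last 1 first.
- by exists 0; rewrite ?normr0// scale0r add0r subrr mul0r.
- have [|||c] := @MVT _ g (fun s => 'D_v f (s *: v + x)) h 0 => //.
  + move=> s; rewrite in_itv /= => /andP[h1 h2]; apply: dg.
    by rewrite !ltr0_norm// lerN2 ltW.
  + apply/continuous_in_subspaceT => s; rewrite inE /= in_itv /= => /andP[h1 h2].
    by apply: cg; rewrite (ler0_norm h2) ltr0_norm// lerN2.
  + rewrite in_itv /= => /andP[h1 h2] e; exists c.
      by rewrite !ltr0_norm// lerN2 ltW.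
    by rewrite -g0 -/(g h); lra.
- have [|||c] := @MVT _ g (fun s => 'D_v f (s *: v + x)) 0 h => //.
  + move=> s; rewrite in_itv /= => /andP[h1 h2]; apply: dg.
    by rewrite !gtr0_norm// ltW.
  + apply/continuous_in_subspaceT => s; rewrite inE /= in_itv /= => /andP[h1 h2].
    by apply: cg; rewrite (ger0_norm h1) gtr0_norm.
  + rewrite in_itv /= => /andP[h1 h2] e; exists c.
      by rewrite !gtr0_norm// ltW.
    by rewrite -g0 -/(g h); lra.
Qed.

End LineCalculus.

Section CkBasics.
Context {R : realType} {V : normedModType R}.
Implicit Types (U : set V) (f g : V -> R).

Lemma Ck_continuous k U f x : Ck k U f -> U x -> {for x, continuous f}.
Proof. by case: k => [|k] [cf _]; exact: cf. Qed.

Lemma Ck_derivable k U f x v : Ck k.+1 U f -> U x -> derivable f x v.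
Proof. by case=> _ /(_ v)[h _] Ux; exact: h. Qed.

Lemma Ck_derive k U f v : Ck k.+1 U f -> Ck k U ('D_v f).
Proof. by case=> _ /(_ v)[]. Qed.

Lemma Ck_pred k U f : Ck k.+1 U f -> Ck k U f.
Proof.
elim: k f => [|k IH] f [cf df]; split=> // v; have [h1 h2] := df v.
by split=> //; exact: IH.
Qed.

Lemma Ck_le k l U f : (k <= l)%N -> Ck l U f -> Ck k U f.
Proof.
elim: l => [|l IH]; first by rewrite leqn0 => /eqP ->.
by rewrite leq_eqVlt => /orP[/eqP ->//|kl /Ck_pred]; exact: IH.
Qed.

Lemma Ck_sub k U U' f : U' `<=` U -> Ck k U f -> Ck k U' f.
Proof.
move=> UU'; elim: k f => [|k IH] f [cf df]; split=> //.
- by move=> x /UU'; exact: cf.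
- by move=> x /UU'; exact: cf.
- by move=> v; have [h1 h2] := df v; split=> [x /UU'|]; [exact: h1|exact: IH].
Qed.

Lemma eq_on_open U f g x : open U -> {in U, f =1 g} -> U x -> {near x, f =1 g}.
Proof.
move=> oU fg Ux; near=> y; apply: fg; rewrite inE; near: y; exact: near_open.
Unshelve. all: by end_near. Qed.

Lemma eq_derive_on U f g x v : open U -> {in U, f =1 g} -> U x ->
  'D_v f x = 'D_v g x.
Proof. by move=> oU fg Ux; apply: near_eq_derive; exact: eq_on_open fg Ux. Qed.

(** Derivatives are local, so equality on an open set passes to all iterated derivatives. *)
Lemma Ck_congr k U f g : open U -> {in U, f =1 g} -> Ck k U f -> Ck k U g.
Proof.
move=> oU; have key f' g' : {in U, f' =1 g'} -> (forall x, U x -> {for x, continuous f'}) ->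
    forall x, U x -> {for x, continuous g'}.
  move=> fg cf x Ux; have fgx := eq_on_open oU fg Ux.
  have : f' y @[y --> x] --> f' x := cf x Ux.
  rewrite (nbhs_singleton fgx) => h; apply: cvg_trans h; apply: near_eq_cvg.
  exact: fgx.
elim: k f g => [|k IH] f g fg [cf df]; split; try exact: key fg cf.
- by [].
- move=> v; have [h1 h2] := df v; split.
    by move=> x Ux; apply: near_eq_derivable (h1 x Ux); exact: eq_on_open fg Ux.
  apply: IH h2 => x /[!inE] Ux; exact: eq_derive_on fg Ux.
Qed.

Lemma Ck_cst k U (c : R) : Ck k U (fun=> c).
Proof.
elim: k c => [|k IH] c; split=> //; try by move=> x _; exact: cvg_cst.
move=> v; split=> [x _|]; first exact: derivable_cst.
rewrite (_ : 'D_v _ = fun=> 0); first exact: IH.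
by apply/funext => x; rewrite derive_cst.
Qed.

Lemma Ck_D k U f g : open U -> Ck k U f -> Ck k U g -> Ck k U (fun x => f x + g x).
Proof.
move=> oU; elim: k f g => [|k IH] f g [cf df] [cg dg]; split=> //.
- by move=> x Ux; apply: cvgD; [exact: cf|exact: cg].
- by move=> x Ux; apply: cvgD; [exact: cf|exact: cg].
- move=> v; have [f1 f2] := df v; have [g1 g2] := dg v; split=> [x Ux|].
    by apply: derivableD; [exact: f1|exact: g1].
  apply: (@Ck_congr k U (fun x => 'D_v f x + 'D_v g x)) => //; last exact: IH.
  by move=> x /[!inE] Ux; rewrite deriveD//; [exact: f1|exact: g1].
Qed.

Lemma Ck_M k U f g : open U -> Ck k U f -> Ck k U g -> Ck k U (fun x => f x * g x).
Proof.
move=> oU; elim: k f g => [|k IH] f g cf cg.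
  by split=> // x Ux; apply: cvgM; [exact: cf.1|exact: cg.1].
split=> [x Ux|v]; first by apply: cvgM; [exact: cf.1|exact: cg.1].
have [f1 f2] := cf.2 v; have [g1 g2] := cg.2 v; split=> [x Ux|].
  by apply: derivableM; [exact: f1|exact: g1].
apply: (@Ck_congr k U (fun x => f x * 'D_v g x + g x * 'D_v f x)) => //.
  by move=> x /[!inE] Ux; rewrite deriveM//; [exact: f1|exact: g1].
by apply: Ck_D => //; apply: IH => //; exact: Ck_pred.
Qed.

Lemma Ck_N k U f : open U -> Ck k U f -> Ck k U (fun x => - f x).
Proof.
move=> oU cf; apply: (@Ck_congr k U (fun x => -1 * f x)) => //.
  by move=> x _; rewrite mulN1r.
by apply: Ck_M => //; exact: Ck_cst.
Qed.

Lemma Ck_B k U f g : open U -> Ck k U f -> Ck k U g -> Ck k U (fun x => f x - g x).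
Proof. by move=> oU cf cg; apply: Ck_D => //; exact: Ck_N. Qed.

Lemma Ck_sum (I : Type) (r : seq I) k U (F : I -> V -> R) : open U ->
  (forall i, Ck k U (F i)) -> Ck k U (fun x => \sum_(i <- r) F i x).
Proof.
move=> oU cF; elim: r => [|i r IH].
  by under eq_fun do rewrite big_nil; exact: Ck_cst.
by under eq_fun do rewrite big_cons; exact: Ck_D.
Qed.

Lemma Ck_prod (I : Type) (r : seq I) k U (F : I -> V -> R) : open U ->
  (forall i, Ck k U (F i)) -> Ck k U (fun x => \prod_(i <- r) F i x).
Proof.
move=> oU cF; elim: r => [|i r IH].
  by under eq_fun do rewrite big_nil; exact: Ck_cst.
by under eq_fun do rewrite big_cons; exact: Ck_M.
Qed.

Lemma Ck_V k U f : open U -> (forall x, U x -> f x != 0) -> Ck k U f ->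
  Ck k U (fun x => (f x)^-1).
Proof.
move=> oU f0; elim: k => [|k IH] cf.
  by split=> // x Ux; apply: cvgV; [exact: f0|exact: cf.1].
split=> [x Ux|v]; first by apply: cvgV; [exact: f0|exact: cf.1].
have [f1 f2] := cf.2 v; split=> [x Ux|].
  by apply: derivableV; [exact: f0|exact: f1].
apply: (@Ck_congr k U (fun x => - ((f x)^-1 * (f x)^-1) * 'D_v f x)) => //.
  move=> x /[!inE] Ux; rewrite deriveV; [|exact: f0|exact: f1].
  by rewrite [_ *: _]/(_ * _) expr2 invfM.
by apply: Ck_M => //; apply: Ck_N => //; apply: Ck_M => //; apply: IH; exact: Ck_pred.
Qed.

Lemma Ck_linear k U (f : {linear V -> R}) : continuous f -> Ck k U f.
Proof.
move=> cf; have cx x : U x -> {for x, continuous f} by move=> _; exact: cf.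
case: k => [|k]; split; [exact: cx|by []|exact: cx|].
move=> v; split=> [x _|]; first exact/diff_derivable/linear_differentiable.
rewrite (_ : 'D_v f = fun=> f v); first exact: Ck_cst.
apply/funext => x; rewrite deriveE; last exact: linear_differentiable.
by rewrite diff_lin.
Qed.

(** The hypothesis says that [L] is affine with linear part [l]; the difference quotient of the
    composite along v is then that of f along l v. This carries regularity from functions of a pair
    to functions of a single row made of two blocks. *)
Lemma Ck_comp_affine (V' : normedModType R) k (U : set V') (f : V' -> R)
    (l L : V -> V') : continuous L ->
  (forall h v x, L (h *: v + x) = h *: l v + L x) ->
  Ck k U f -> Ck k (L @^-1` U) (f \o L).
Proof.
move=> cL hL.
have e (g : V' -> R) v x : (fun h : R => h^-1 *: (((g \o L) \o shift x) (h *: v) - (g \o L) x))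
   = (fun h : R => h^-1 *: ((g \o shift (L x)) (h *: l v) - g (L x))).
  by apply/funext => h /=; rewrite hL.
elim: k f => [|k IH] f [cf df];
  have cx x : (L @^-1` U) x -> {for x, continuous (f \o L)} by
    (move=> Ux; apply: continuous_comp; [exact: cL|exact: cf]).
- by split; [exact: cx|].
- split; first exact: cx.
  move=> v; have [h1 h2] := df (l v); split=> [x Ux|].
    by rewrite /derivable e; exact: h1.
  rewrite (_ : 'D_v (f \o L) = ('D_(l v) f) \o L); first exact: IH.
  by apply/funext => x; rewrite /derive e.
Qed.

End CkBasics.

(** The differential is a chosen linear map, so a candidate is exhibited and the epsilon estimate is
    rewritten as a little-o remainder at 0. *)
Lemma differentiable_intro (K : numFieldType) (V W : normedModType K) (f : V -> W)
    (df : {linear V -> W}) x :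
  continuous df -> (forall e, 0 < e -> \forall h \near (0 : V),
    `|f (h + x) - f x - df h| <= e * `|h|) -> differentiable f x.
Proof.
move=> dfc hf; apply/diffP => /=.
apply: (@getPex _ (fun (df : {linear V -> W}) => continuous df /\
  forall y, f y = f (lim (nbhs x)) + df (y - lim (nbhs x))
                  +o_(y \near x) (y - lim (nbhs x)))).
exists df; split=> //; apply: eqaddoEx => z.
have e : f \o shift x = cst (f x) + df +o_ 0 id.
  apply/eqaddoP => e e0; have := hf e e0; apply: filterS => h /=.
  suff -> : (f \o shift x - (cst (f x) + df)) h = f (h + x) - f x - df h by [].
  by rewrite -addrA -opprD.
have {}e : (df : V -> W) = f \o shift x - cst (f x) +o_ 0 id.
  apply: eqaddoE.
  rewrite e addrAC -!addrA addrC !addrA subrK.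
  rewrite -[LHS]addr0 -addrA; congr (_ + _).
  by apply/eqP; rewrite eq_sym addrC addr_eq0 oppo.
rewrite e !addrA lim_id // /(_ \o _) /= subrK [f _ + _]addrC addrK.
rewrite -addrA -[LHS]addr0; congr (_ + _).
apply/eqP; rewrite eq_sym addrC addr_eq0 oppox; apply/eqP.
rewrite [in LHS]littleo_center0 (comp_centerK x id).
by rewrite -[- _ in RHS](comp_centerK x).
Qed.

(** * Differentiability and the chain rule on row vectors *)

Section RowCalculus.
Context {R : realType} {n : nat}.
Implicit Types (U : set 'rV[R]_n) (f g : 'rV[R]_n -> R) (x v w : 'rV[R]_n).
Local Notation e_ := (@basis_vec R n).

Lemma row_basis v : v = \sum_i v 0 i *: e_ i.
Proof. by rewrite {1}[v]row_sum_delta. Qed.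

Lemma coord_le_norm v i : `|v 0 i| <= `|v|.
Proof.
rewrite [leRHS]mx_normrE.
exact: (le_bigmax _ (fun k : 'I_1 * 'I_n => `|v k.1 k.2|) (0, i)).
Qed.

Lemma row_norm_le v c : 0 <= c -> (forall i, `|v 0 i| <= c) -> `|v| <= c.
Proof.
move=> c0 h; rewrite [leLHS]mx_normrE; apply: bigmax_le => //= -[i j] _ /=.
by rewrite ord1.
Qed.

Lemma basis_vecE i j : e_ i 0 j = (j == i)%:R.
Proof. by rewrite mxE eqxx. Qed.

(** The increment is telescoped along a path that switches on the coordinates of h one at a time;
    the mean value theorem on each edge and the continuity of the partial derivatives bound the
    error. *)
Lemma C1_differentiable U f x : open U -> Ck 1 U f -> U x -> differentiable f x.
Proof.
move=> oU cf Ux.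
pose df v := \sum_i v 0 i * 'D_(e_ i) f x.
have dfl : linear df.
  move=> a v w; rewrite /df scaler_sumr -big_split /=; apply: eq_bigr => i _.
  by rewrite !mxE mulrDl -mulrA.
pose L : {linear 'rV[R]_n -> R} := HB.pack df (GRing.isLinear.Build _ _ _ _ df dfl).
apply: (@differentiable_intro R _ _ f L).
  move=> v; rewrite /continuous_at /L /= /df.
  apply: (@cvg_sumr R _ _ (nbhs v)) => i; apply: cvgM; last exact: cvg_cst.
  exact: coord_continuous.
move=> e e0.
have n1 : 0 < n%:R + 1 :> R by rewrite ltr_wpDl.
(* Each of the n edges contributes at most e' |h|; n + 1 in place of n also covers n = 0. *)
pose e' := e / (n%:R + 1); have e'0 : 0 < e' by rewrite divr_gt0.
have near_x : \forall y \near x, U y /\ forall i, `|'D_(e_ i) f y - 'D_(e_ i) f x| <= e'.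
  apply: filterI; first exact: (open_nbhs_nbhs (conj oU Ux)).
  have h i : \forall y \near x, `|'D_(e_ i) f y - 'D_(e_ i) f x| <= e'.
    have /cvgrPdist_le/(_ _ e'0) := Ck_continuous (Ck_derive (e_ i) cf) Ux.
    by apply: filterS => y; rewrite distrC.
  exact: (filter_forall _ h).
have /nbhs_ballP[d /= d0 hd] := near_x.
apply/nbhs_ballP; exists d => //= h; rewrite -ball_normE /ball_ /= sub0r normrN => hd'.
(* [p k] keeps the first k coordinates of h. In the sup norm no point of the path is longer than h,
   so the path stays in the ball. *)
pose p k := \sum_(i < n | (i < k)%N) h 0 i *: e_ i.
have pE k j : p k 0 j = if (j < k)%N then h 0 j else 0.
  rewrite /p summxE (eq_bigr (fun i : 'I_n => h 0 i * (j == i)%:R)); last first.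
    by move=> i _; rewrite mxE basis_vecE.
  case: ifP => jk; last first.
    rewrite big1// => i ik; case: eqP => [ji|]; last by rewrite mulr0.
    by rewrite ji ik in jk.
  rewrite (bigD1 j)//= eqxx mulr1 big1 ?addr0// => i /andP[_ ij].
  by rewrite eq_sym (negbTE ij) mulr0.
have pn : p n = h.
  by apply/rowP => j; rewrite pE ltn_ord.
have p0 : p 0%N = 0 by apply/rowP => j; rewrite pE mxE.
have step (k : 'I_n) : `|f (p k.+1 + x) - f (p k + x) - h 0 k * 'D_(e_ k) f x| <= e' * `|h|.
  have pS : p k.+1 = h 0 k *: e_ k + p k.
    apply/rowP => j; rewrite !mxE !pE ltnS eqxx /= eq_sym.
    have [->|jk] := eqVneq j k; first by rewrite leqnn ltnn mulr1 addr0.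
    by rewrite mulr0 add0r leq_eqVlt val_eqE (negbTE jk).
  have inb s : `|s| <= `|h 0 k| -> ball x d (s *: e_ k + (p k + x)).
    move=> sh; rewrite -ball_normE /ball_ /= -normrN opprB addrA addrK.
    apply: le_lt_trans hd'; apply: row_norm_le => // j.
    rewrite mxE mxE pE basis_vecE.
    have [->|jk] := eqVneq j k.
      by rewrite ltnn mulr1 addr0 (le_trans sh)// coord_le_norm.
    rewrite mulr0 add0r; case: ifP => _; first exact: coord_le_norm.
    by rewrite normr0.
  have [|s sh se] := @line_MVT R _ f (p k + x) (e_ k) (h 0 k).
    by move=> s sh; apply: Ck_derivable cf _; apply: (hd _ _).1; exact: inb.
  have pS' : p k.+1 + x = h 0 k *: e_ k + (p k + x) by rewrite pS addrA.
  rewrite pS' se -mulrBr normrM mulrC ler_pM//; last exact: coord_le_norm.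
  exact: (hd _ (inb _ sh)).2.
have -> : f (h + x) - f x - L h =
    \sum_(k < n) (f (p k.+1 + x) - f (p k + x) - h 0 k * 'D_(e_ k) f x).
  rewrite big_split /= sumrN -/(df h); congr (_ - _).
  rewrite -(big_mkord xpredT (fun k => f (p k.+1 + x) - f (p k + x))).
  by rewrite telescope_sumr// pn p0 add0r.
apply: le_trans (ler_norm_sum _ _ _) _.
apply: le_trans (ler_sum _ (fun k _ => step k)) _.
rewrite sumr_const card_ord -mulr_natl mulrA ler_wpM2r//.
rewrite /e' mulrA ler_pdivrMr// mulrC mulrDr mulr1 lerDl; lra.
Qed.

Lemma Ck_differentiable k U f x : open U -> Ck k.+1 U f -> U x -> differentiable f x.
Proof. by move=> oU cf; apply: C1_differentiable oU (Ck_le _ cf). Qed.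

Lemma derive_basis f x v : differentiable f x ->
  'D_v f x = \sum_i v 0 i * 'D_(e_ i) f x.
Proof.
move=> df; rewrite deriveE// {1}[v]row_basis linear_sum; apply: eq_bigr => i _.
by rewrite linearZ /= deriveE.
Qed.

Lemma continuous_rV (T : topologicalType) (phi : T -> 'rV[R]_n) (x : T) :
  (forall i, {for x, continuous (fun y => phi y 0 i)}) -> {for x, continuous phi}.
Proof.
move=> h; apply/cvgrPdist_le => e e0; near=> y.
apply: row_norm_le; first exact: ltW.
move=> i; rewrite !mxE; move: i; near: y; apply: filter_forall => i.
by have /cvgrPdist_le/(_ _ e0) := h i.
Unshelve. all: by end_near. Qed.

Section Composition.
Context {V : normedModType R}.
Implicit Types (phi : V -> 'rV[R]_n) (a b : V).

Lemma derive_rV phi a b : (forall i, derivable (fun y => phi y 0 i) a b) ->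
  derivable phi a b /\ 'D_b phi a = \row_i 'D_b (fun y => phi y 0 i) a.
Proof.
move=> h; have d : derivable phi a b.
  by apply/derivable_mxP => i j; rewrite ord1; exact: h.
by split=> //; rewrite derive_mx//; apply/rowP => i; rewrite !mxE.
Qed.

(** Only the restriction of [phi] to a line through a is differentiated, so [V] may be any normed
    space and [phi] need not be differentiable. *)
Lemma chain_derivable f phi a b : (forall i, derivable (fun y => phi y 0 i) a b) ->
  differentiable f (phi a) ->
  derivable (f \o phi) a b /\
  'D_b (f \o phi) a = \sum_i 'D_b (fun y => phi y 0 i) a * 'D_(e_ i) f (phi a).
Proof.
move=> h df; have [dphi Dphi] := derive_rV h.
pose g := fun t : R => phi (t *: b + a).
have dg : differentiable g 0.
  by move/derivable1P : dphi => /derivable1_diffP.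
have dfg : differentiable f (g 0) by rewrite /g scale0r add0r.
have dc : differentiable (f \o g) 0 by exact: differentiable_comp.
split; first by apply/derivable1P; apply/derivable1_diffP.
have Dg : 'd g 0 1 = 'D_b phi a.
  by rewrite -deriveE// derive_line scale0r add0r.
transitivity ('d (f \o g) 0 1).
  by rewrite -deriveE// (derive_line (f \o phi)) scale0r add0r.
rewrite diff_comp// /= Dg /g scale0r add0r -deriveE// derive_basis// Dphi.
by apply: eq_bigr => i _; rewrite mxE.
Qed.

Lemma Ck_comp k (U : set V) (U' : set 'rV[R]_n) f phi :
  open U -> open U' -> (forall a, U a -> U' (phi a)) ->
  (forall i, Ck k U (fun y => phi y 0 i)) -> Ck k U' f -> Ck k U (f \o phi).
Proof.
move=> oU oU' UU'.
elim: k f => [|k IH] f cphi cf;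
  have cx a : U a -> {for a, continuous (f \o phi)} by
   (move=> Ua; apply: continuous_comp;
    [apply: continuous_rV => i; exact: Ck_continuous (cphi i) Ua|
     exact: Ck_continuous cf (UU' _ Ua)]).
- by split; [exact: cx|].
- split; first exact: cx.
  have ch a b : U a -> _ := fun Ua => @chain_derivable f phi a b
    (fun i => Ck_derivable (v := b) (cphi i) Ua) (Ck_differentiable oU' cf (UU' _ Ua)).
  move=> b; split; first by move=> a /(ch a b)[].
  apply: (@Ck_congr _ _ k U (fun a => \sum_i 'D_b (fun y => phi y 0 i) a * 'D_(e_ i) f (phi a))) => //.
    by move=> a /[!inE] /(ch a b)[_ ->].
  apply: Ck_sum => // i; apply: Ck_M => //; first exact: Ck_derive.
  apply: (IH ('D_(e_ i) f)); last exact: Ck_derive.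
  by move=> j; exact: Ck_pred.
Qed.

End Composition.

End RowCalculus.

(* Locked, since unification would otherwise unfold the limits behind 'D_v f. *)
HB.lock Definition pd {R : realType} {V : normedModType R} (v : V) (f : V -> R) (x : V) : R :=
  'D_v f x.
HB.lock Definition smooth {R : realType} {V : normedModType R} k (U : set V) (f : V -> R) : Prop :=
  Ck k U f.

Lemma pdE {R : realType} {V : normedModType R} (v : V) (f : V -> R) : 'D_v f = pd v f.
Proof. by rewrite pd.unlock. Qed.

Lemma pdxE {R : realType} {V : normedModType R} (v : V) (f : V -> R) x : 'D_v f x = pd v f x.
Proof. by rewrite pd.unlock. Qed.

(** * Symmetry of second derivatives *)

Section Schwarz.
Context {R : realType} {V : normedModType R}.

Lemma pd_line (f : V -> R) (x v : V) (s : R) :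
  pd (1 : R) (fun t : R => f (t *: v + x)) s = pd v f (s *: v + x).
Proof. by rewrite -(pdxE v) -(pdxE (1 : R)) derive_line. Qed.

Lemma pd_sub (f g : V -> R) x v : derivable f x v -> derivable g x v ->
  pd v (fun t => f t - g t) x = pd v f x - pd v g x.
Proof. by move=> df dg; rewrite -!pdxE; have [_ ->] := derive_sub df dg. Qed.

Lemma line_MVT_pd (f : V -> R) (x v : V) (h : R) :
  (forall s : R, `|s| <= `|h| -> derivable f (s *: v + x) v) ->
  exists2 s : R, `|s| <= `|h| & f (h *: v + x) - f x = h * pd v f (s *: v + x).
Proof. by move=> /line_MVT[s sh]; rewrite pdxE => e; exists s. Qed.

Lemma derivable_translate (f : V -> R) (a x v : V) :
  derivable f (a + x) v -> derivable (fun y => f (a + y)) x v /\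
  pd v (fun y => f (a + y)) x = pd v f (a + x).
Proof.
move=> d; have e : (fun t : R => f (a + (t *: v + x))) = (fun t : R => f (t *: v + (a + x))).
  by apply/funext => t; rewrite addrCA.
split.
  by apply/(derivable1P (fun y => f (a + y)) x v); rewrite e; apply/(derivable1P f (a + x) v).
by rewrite -[x in LHS]add0r -[in LHS](scale0r v) -pd_line e pd_line scale0r add0r.
Qed.

(** The mean value theorem twice: in direction v for the difference y |-> f (h w + y) - f y, then in
    direction w for the derivative of f along v. *)
Lemma mixed_difference (U : set V) (f : V -> R) x v w h :
  Ck 2 U f -> (forall s t : R, `|s| <= `|h| -> `|t| <= `|h| -> U (s *: v + (t *: w + x))) ->
  exists s t, [/\ `|s| <= `|h|, `|t| <= `|h| &
   f (h *: v + (h *: w + x)) - f (h *: v + x) - f (h *: w + x) + f x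
   = h ^+ 2 * pd w (pd v f) (s *: v + (t *: w + x))].
Proof.
move=> cf hU.
have hU0 (s : R) : `|s| <= `|h| -> U (s *: v + x).
  by move=> sh; have := hU s 0 sh; rewrite normr0 scale0r add0r; apply.
pose g y := f (h *: w + y) - f y.
have dg (s : R) : `|s| <= `|h| -> derivable g (s *: v + x) v /\
    pd v g (s *: v + x) = pd v f (h *: w + (s *: v + x)) - pd v f (s *: v + x).
  move=> sh.
  have d1 : derivable f (h *: w + (s *: v + x)) v.
    by apply: Ck_derivable cf _; rewrite addrCA; apply: hU.
  have d2 : derivable f (s *: v + x) v by apply: Ck_derivable cf _; exact: hU0.
  have [d3 d4] := derivable_translate d1.
  by split; [exact: (derive_sub d3 d2).1|rewrite (pd_sub d3 d2) d4].
have [|s sh se] := @line_MVT_pd g x v h; first by move=> s /dg[].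
have [|t th te] := @line_MVT_pd (pd v f) (s *: v + x) w h.
  move=> t th; rewrite -pdE; apply: Ck_derivable (Ck_derive v cf) _.
  by rewrite addrCA; apply: hU.
exists s, t; split; [exact: sh|exact: th|].
rewrite (addrCA (s *: v)) expr2 -mulrA -te -(dg _ sh).2 -se /g (addrCA (h *: w)); ring.
Qed.

(** The second difference is symmetric in v and w, so the two mixed derivatives take a common value
    at two points close to x; continuity carries this to x. *)
Lemma schwarz (U : set V) (f : V -> R) x v w : open U -> Ck 2 U f -> U x ->
  pd w (pd v f) x = pd v (pd w f) x.
Proof.
move=> oU cf Ux; apply/eqP; rewrite -subr_eq0 -normr_eq0 eq_le normr_ge0 andbT.
apply/ler_addgt0Pl => e e0; rewrite addr0.
have e2 : 0 < e / 2 by rewrite divr_gt0.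
have near_x : \forall y \near x, [/\ U y,
    `|pd w (pd v f) y - pd w (pd v f) x| <= e / 2 &
    `|pd v (pd w f) y - pd v (pd w f) x| <= e / 2].
  have c1 : {for x, continuous (pd w (pd v f))}.
    by rewrite -!pdE; exact: Ck_continuous (Ck_derive w (Ck_derive v cf)) Ux.
  have c2 : {for x, continuous (pd v (pd w f))}.
    by rewrite -!pdE; exact: Ck_continuous (Ck_derive v (Ck_derive w cf)) Ux.
  move/cvgrPdist_le/(_ _ e2) : c1 => c1; move/cvgrPdist_le/(_ _ e2) : c2 => c2.
  apply: filterS3 (near_open oU Ux) c1 c2 => y Uy h1 h2.
  by split; [|rewrite distrC|rewrite distrC].
have /nbhs_ballP[d /= d0 hd] := near_x.
(* Small enough to keep the parallelogram with sides h v and h w in the ball; the summand 1 avoids a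
   zero denominator. *)
pose h := d / 2 / (`|v| + `|w| + 1).
have nn : 0 < `|v| + `|w| + 1 by rewrite ltr_wpDl// addr_ge0.
have h0 : 0 < h by rewrite !divr_gt0.
have inb (v' w' : V) s t : `|v'| + `|w'| = `|v| + `|w| -> `|s| <= `|h| -> `|t| <= `|h| -> ball x d
  (s *: v' + (t *: w' + x)).
  move=> vw sh th; rewrite -ball_normE /ball_ /= -normrN opprB addrA addrK.
  apply: le_lt_trans (ler_normD _ _) _; rewrite !normrZ.
  rewrite (gtr0_norm h0) in sh th.
  have := normr_ge0 v'; have := normr_ge0 w'; move=> w0 v0.
  apply: (@le_lt_trans _ _ (h * (`|v| + `|w|))).
    by rewrite -vw mulrDr lerD// ler_wpM2r.
  apply: (@lt_trans _ _ (h * (`|v| + `|w| + 1))).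
    by rewrite ltr_pM2l// ltrDl.
  rewrite /h divfK ?gt_eqF//; lra.
have [|s [t [sh th e1]]] := @mixed_difference U f x v w h cf.
  by move=> s t sh th; have [] := hd _ (inb v w s t erefl sh th).
have [|s' [t' [sh' th' e3]]] := @mixed_difference U f x w v h cf.
  by move=> s' t' sh' th'; have [] := hd _ (inb w v s' t' (addrC _ _) sh' th').
have [_ a1 _] := hd _ (inb v w s t erefl sh th).
have [_ _ a2] := hd _ (inb w v s' t' (addrC _ _) sh' th').
have : h ^+ 2 * pd w (pd v f) (s *: v + (t *: w + x)) =
       h ^+ 2 * pd v (pd w f) (s' *: w + (t' *: v + x)).
  by rewrite -e1 -e3 (addrCA (h *: w)); ring.
have h2 : h ^+ 2 != 0 by rewrite expf_neq0// gt_eqF.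
move=> /(mulfI h2) E; rewrite E in a1.
set A := pd v _ (_ + _) in a1 a2; set B := pd w _ x in a1 *; set C := pd v (pd w f) x in a2 *.
have -> : B - C = (A - C) - (A - B) by ring.
apply: le_trans (ler_normB _ _) _; lra.
Qed.

End Schwarz.

Section Smooth.
Context {R : realType} {V : normedModType R}.
Implicit Types (U : set V) (f g : V -> R).

Lemma smoothE k U f : smooth k U f = Ck k U f.
Proof. by rewrite smooth.unlock. Qed.

Lemma smooth_continuous k U f x : smooth k U f -> U x -> {for x, continuous f}.
Proof. rewrite smoothE; exact: Ck_continuous. Qed.
Lemma smooth_derivable k U f x v : smooth k.+1 U f -> U x -> derivable f x v.
Proof. rewrite smoothE; exact: Ck_derivable. Qed.
Lemma smooth_pd k U f v : smooth k.+1 U f -> smooth k U (pd v f).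
Proof. rewrite !smoothE -pdE; exact: Ck_derive. Qed.
Lemma smooth_le k l U f : (k <= l)%N -> smooth l U f -> smooth k U f.
Proof. rewrite !smoothE; exact: Ck_le. Qed.
Lemma smooth_sub k U U' f : U' `<=` U -> smooth k U f -> smooth k U' f.
Proof. rewrite !smoothE; exact: Ck_sub. Qed.
Lemma smooth_congr k U f g : open U -> {in U, f =1 g} -> smooth k U f -> smooth k U g.
Proof. rewrite !smoothE; exact: Ck_congr. Qed.
Lemma smooth_cst k U (c : R) : smooth k U (fun=> c).
Proof. rewrite smoothE; exact: Ck_cst. Qed.
Lemma smoothD k U f g : open U -> smooth k U f -> smooth k U g -> smooth k U (fun x => f x + g x).
Proof. rewrite !smoothE; exact: Ck_D. Qed.
Lemma smoothM k U f g : open U -> smooth k U f -> smooth k U g -> smooth k U (fun x => f x * g x).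
Proof. rewrite !smoothE; exact: Ck_M. Qed.
Lemma smoothN k U f : open U -> smooth k U f -> smooth k U (fun x => - f x).
Proof. rewrite !smoothE; exact: Ck_N. Qed.
Lemma smoothB k U f g : open U -> smooth k U f -> smooth k U g -> smooth k U (fun x => f x - g x).
Proof. rewrite !smoothE; exact: Ck_B. Qed.
Lemma smooth_sum (I : Type) (r : seq I) k U (F : I -> V -> R) : open U ->
  (forall i, smooth k U (F i)) -> smooth k U (fun x => \sum_(i <- r) F i x).
Proof. by rewrite smoothE => oU h; apply: Ck_sum => // i; rewrite -smoothE. Qed.
Lemma smooth_prod (I : Type) (r : seq I) k U (F : I -> V -> R) : open U ->
  (forall i, smooth k U (F i)) -> smooth k U (fun x => \prod_(i <- r) F i x).
Proof. by rewrite smoothE => oU h; apply: Ck_prod => // i; rewrite -smoothE. Qed.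
Lemma smoothV k U f : open U -> (forall x, U x -> f x != 0) -> smooth k U f ->
  smooth k U (fun x => (f x)^-1).
Proof. rewrite !smoothE; exact: Ck_V. Qed.
Lemma smooth_linear k U (f : {linear V -> R}) : continuous f -> smooth k U f.
Proof. rewrite smoothE; exact: Ck_linear. Qed.
Lemma smooth_comp_affine (V' : normedModType R) k (U : set V') (f : V' -> R)
    (l L : V -> V') : continuous L ->
  (forall h v x, L (h *: v + x) = h *: l v + L x) ->
  smooth k U f -> smooth k (L @^-1` U) (f \o L).
Proof. rewrite smooth.unlock; exact: Ck_comp_affine. Qed.
Lemma smooth_schwarz U f x v w : open U -> smooth 2 U f -> U x ->
  pd w (pd v f) x = pd v (pd w f) x.
Proof. rewrite smoothE; exact: schwarz. Qed.

Lemma pd_eq_on U f g x v : open U -> {in U, f =1 g} -> U x -> pd v f x = pd v g x.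
Proof. by rewrite -!pdxE; exact: eq_derive_on. Qed.
Lemma pd_near f g x v : {near x, f =1 g} -> pd v f x = pd v g x.
Proof. by move=> fg; rewrite -!pdxE; exact: near_eq_derive. Qed.
Lemma pd_cst (c : R) (v x : V) : pd v (fun=> c) x = 0.
Proof. by rewrite -pdxE derive_cst. Qed.
Lemma pdD f g x v : derivable f x v -> derivable g x v ->
  pd v (fun y => f y + g y) x = pd v f x + pd v g x.
Proof. by move=> df dg; rewrite -!pdxE; exact: deriveD. Qed.
Lemma pdM f g x v : derivable f x v -> derivable g x v ->
  pd v (fun y => f y * g y) x = pd v f x * g x + f x * pd v g x.
Proof.
move=> df dg; rewrite -!pdxE; transitivity (f x *: 'D_v g x + g x *: 'D_v f x).
  exact: deriveM.
by rewrite addrC [_ *: _]mulrC.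
Qed.
Lemma pdN f x v : derivable f x v -> pd v (fun y => - f y) x = - pd v f x.
Proof. by move=> df; rewrite -!pdxE; exact: deriveN. Qed.
Lemma derivable_sumf (I : Type) (r : seq I) (F : I -> V -> R) x v :
  (forall i, derivable (F i) x v) -> derivable (fun y => \sum_(i <- r) F i y) x v.
Proof.
move=> h; elim: r => [|i r IH].
  by under eq_fun do rewrite big_nil; exact: derivable_cst.
by under eq_fun do rewrite big_cons; apply: derivableD.
Qed.
Lemma pd_sum (I : Type) (r : seq I) (F : I -> V -> R) x v :
  (forall i, derivable (F i) x v) ->
  pd v (fun y => \sum_(i <- r) F i y) x = \sum_(i <- r) pd v (F i) x.
Proof.
move=> h; elim: r => [|i r IH].
  by under eq_fun do rewrite big_nil; rewrite big_nil pd_cst.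
under eq_fun do rewrite big_cons; rewrite big_cons -IH pdD//.
exact: derivable_sumf.
Qed.
Lemma pd_affine (V' : normedModType R) (f : V' -> R) (l L : V -> V') v x :
  (forall h v x, L (h *: v + x) = h *: l v + L x) ->
  pd v (f \o L) x = pd (l v) f (L x).
Proof.
move=> hL; rewrite -!pdxE /derive.
rewrite (_ : (fun h : R => h^-1 *: (((f \o L) \o shift x) (h *: v) - (f \o L) x))
   = (fun h : R => h^-1 *: ((f \o shift (L x)) (h *: l v) - f (L x))))//.
by apply/funext => h /=; rewrite hL.
Qed.

End Smooth.

Section SmoothRow.
Context {R : realType} {n : nat}.
Local Notation e_ := (@basis_vec R n).

Lemma smooth_differentiable k (U : set 'rV[R]_n) f x : open U -> smooth k.+1 U f -> U x -> differentiable f x.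
Proof. rewrite smoothE; exact: Ck_differentiable. Qed.

Lemma pd_basis f (x v : 'rV[R]_n) : differentiable f x ->
  pd v f x = \sum_i v 0 i * pd (e_ i) f x.
Proof. by move=> df; rewrite -!pdxE derive_basis//; apply: eq_bigr => i _; rewrite -pdxE. Qed.

Lemma pd_chain (V : normedModType R) f (phi : V -> 'rV[R]_n) a b :
  (forall i, derivable (fun y => phi y 0 i) a b) -> differentiable f (phi a) ->
  pd b (f \o phi) a = \sum_i pd b (fun y => phi y 0 i) a * pd (e_ i) f (phi a).
Proof.
move=> h df; have [_] := chain_derivable h df; rewrite -!pdxE => ->.
by apply: eq_bigr => i _; rewrite -!pdxE.
Qed.

Lemma smooth_comp (V : normedModType R) k (U : set V) (U' : set 'rV[R]_n) f phi :
  open U -> open U' -> (forall a, U a -> U' (phi a)) ->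
  (forall i, smooth k U (fun y => phi y 0 i)) -> smooth k U' f -> smooth k U (f \o phi).
Proof.
move=> oU oU' UU' h; rewrite !smoothE => cf; apply: Ck_comp UU' _ cf => // i.
by rewrite -smoothE.
Qed.

Lemma smooth_coord k (U : set 'rV[R]_n) i : smooth k U (fun y => y 0 i).
Proof.
have lc : linear (fun y : 'rV[R]_n => y 0 i) by move=> a u v; rewrite !mxE.
pose L : {linear 'rV[R]_n -> R} :=
  HB.pack (fun y : 'rV[R]_n => y 0 i) (GRing.isLinear.Build _ _ _ _ (fun y : 'rV[R]_n => y 0 i) lc).
by apply: (@smooth_linear _ _ k U L) => x; exact: coord_continuous.
Qed.

Lemma pd_coord (v x : 'rV[R]_n) i : pd v (fun y : 'rV[R]_n => y 0 i) x = v 0 i.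
Proof.
have lc : linear (fun y : 'rV[R]_n => y 0 i) by move=> a u w; rewrite !mxE.
pose L : {linear 'rV[R]_n -> R} :=
  HB.pack (fun y : 'rV[R]_n => y 0 i) (GRing.isLinear.Build _ _ _ _ (fun y : 'rV[R]_n => y 0 i) lc).
have cL : continuous L by move=> y; exact: coord_continuous.
rewrite -pdxE; transitivity ('d L x v).
  by rewrite -deriveE//; exact: linear_differentiable.
by rewrite diff_lin.
Qed.

End SmoothRow.

Section SmoothRules.
Context {R : realType} {V : normedModType R}.
Variables (U : set V) (x : V) (v : V).
Hypothesis Ux : U x.
Implicit Types f g : V -> R.

Lemma spdD f g : smooth 1 U f -> smooth 1 U g ->
  pd v (fun y => f y + g y) x = pd v f x + pd v g x.
Proof. by move=> sf sg; apply: pdD; [exact: smooth_derivable sf Ux|exact: smooth_derivable sg Ux]. Qed.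
Lemma spdM f g : smooth 1 U f -> smooth 1 U g ->
  pd v (fun y => f y * g y) x = pd v f x * g x + f x * pd v g x.
Proof. by move=> sf sg; apply: pdM; [exact: smooth_derivable sf Ux|exact: smooth_derivable sg Ux]. Qed.
Lemma spdB f g : smooth 1 U f -> smooth 1 U g ->
  pd v (fun y => f y - g y) x = pd v f x - pd v g x.
Proof. by move=> sf sg; apply: pd_sub; [exact: smooth_derivable sf Ux|exact: smooth_derivable sg Ux]. Qed.
Lemma spd_sum (I : Type) (r : seq I) (F : I -> V -> R) :
  (forall i, smooth 1 U (F i)) ->
  pd v (fun y => \sum_(i <- r) F i y) x = \sum_(i <- r) pd v (F i) x.
Proof. by move=> sF; apply: pd_sum => i; exact: smooth_derivable (sF i) Ux. Qed.
Lemma spdMl (c : R) f : smooth 1 U f -> pd v (fun y => c * f y) x = c * pd v f x.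
Proof. by move=> sf; rewrite spdM ?pd_cst ?mul0r ?add0r//; exact: smooth_cst. Qed.

End SmoothRules.

Lemma mxE_add (V : nmodType) m n (A B : 'M[V]_(m, n)) i j : (A + B) i j = A i j + B i j.
Proof. by rewrite mxE. Qed.
Lemma mxE_opp (V : zmodType) m n (A : 'M[V]_(m, n)) i j : (- A) i j = - A i j.
Proof. by rewrite mxE. Qed.

(** * Connection, Hessian and curvature in coordinates *)

Section MatrixCalculus.
Context {R : realType} {n : nat}.
Local Notation E := 'rV[R]_n.
Local Notation e_ := (@basis_vec R n).

Definition mpd {p q} (i : 'I_n) (A : E -> 'M[R]_(p, q)) (y : E) : 'M[R]_(p, q) :=
  \matrix_(a, b) pd (e_ i) (fun z => A z a b) y.

Definition msmooth {p q} k (U : set E) (A : E -> 'M[R]_(p, q)) : Prop :=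
  forall a b, smooth k U (fun z => A z a b).

Lemma msmooth_mpd p q k U (A : E -> 'M[R]_(p, q)) i : msmooth k.+1 U A -> msmooth k U (mpd i A).
Proof.
move=> sA a b; have := smooth_pd (e_ i) (sA a b).
by rewrite (_ : pd (e_ i) _ = fun z => mpd i A z a b)//; apply/funext => z; rewrite mxE.
Qed.

Lemma msmooth_le p q k l U (A : E -> 'M[R]_(p, q)) : (k <= l)%N -> msmooth l U A -> msmooth k U A.
Proof. by move=> kl sA a b; exact: smooth_le kl (sA a b). Qed.

Lemma msmooth_sub p q k U U' (A : E -> 'M[R]_(p, q)) : U' `<=` U -> msmooth k U A -> msmooth k U' A.
Proof. by move=> kl sA a b; exact: smooth_sub kl (sA a b). Qed.

Lemma msmooth_derivable p q k (U : set E) (A : E -> 'M[R]_(p, q)) y v a b :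
  msmooth k.+1 U A -> U y -> derivable (fun z => A z a b) y v.
Proof. by move=> sA Uy; exact: smooth_derivable (sA a b) Uy. Qed.

Section Ops.
Variables (U : set E) (oU : open U).

Lemma msmooth_congr p q k (A B : E -> 'M[R]_(p, q)) : {in U, A =1 B} -> msmooth k U A -> msmooth k U B.
Proof. by move=> AB sA a b; apply: smooth_congr (sA a b) => // y Uy; rewrite AB. Qed.

Lemma msmooth_cst p q k (A : 'M[R]_(p, q)) : msmooth k U (fun=> A).
Proof. by move=> a b; exact: smooth_cst. Qed.

Lemma msmoothD p q k (A B : E -> 'M[R]_(p, q)) :
  msmooth k U A -> msmooth k U B -> msmooth k U (fun z => A z + B z).
Proof.
move=> sA sB a b.
rewrite (_ : (fun z => _) = fun z => A z a b + B z a b); first exact: smoothD.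
by apply/funext => z; rewrite mxE.
Qed.

Lemma msmoothN p q k (A : E -> 'M[R]_(p, q)) :
  msmooth k U A -> msmooth k U (fun z => - A z).
Proof.
move=> sA a b.
rewrite (_ : (fun z => _) = fun z => - A z a b); first exact: smoothN.
by apply/funext => z; rewrite mxE.
Qed.

Lemma msmoothB p q k (A B : E -> 'M[R]_(p, q)) :
  msmooth k U A -> msmooth k U B -> msmooth k U (fun z => A z - B z).
Proof. by move=> sA sB; apply: msmoothD => //; exact: msmoothN. Qed.

Lemma msmoothM p q r k (A : E -> 'M[R]_(p, q)) (B : E -> 'M[R]_(q, r)) :
  msmooth k U A -> msmooth k U B -> msmooth k U (fun z => A z *m B z).
Proof.
move=> sA sB a b.
rewrite (_ : (fun z => _) = fun z => \sum_c A z a c * B z c b).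
  by apply: smooth_sum => // c; exact: smoothM.
by apply/funext => z; rewrite mxE.
Qed.

Lemma msmoothZ p q k (f : E -> R) (A : E -> 'M[R]_(p, q)) :
  smooth k U f -> msmooth k U A -> msmooth k U (fun z => f z *: A z).
Proof.
move=> sf sA a b.
rewrite (_ : (fun z => _) = fun z => f z * A z a b); first exact: smoothM.
by apply/funext => z; rewrite mxE.
Qed.

Lemma msmooth_tr p q k (A : E -> 'M[R]_(p, q)) : msmooth k U A -> msmooth k U (fun z => (A z)^T).
Proof.
move=> sA a b; rewrite (_ : (fun z => _) = fun z => A z b a); first exact: sA.
by apply/funext => z; rewrite mxE.
Qed.

Lemma msmooth_sum p q k (I : Type) (r : seq I) (A : I -> E -> 'M[R]_(p, q)) :
  (forall i, msmooth k U (A i)) -> msmooth k U (fun z => \sum_(i <- r) A i z).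
Proof.
move=> sA a b; rewrite (_ : (fun z => _) = fun z => \sum_(i <- r) A i z a b).
  by apply: smooth_sum => // i; exact: sA.
by apply/funext => z; rewrite summxE.
Qed.

Lemma smooth_det p k (A : E -> 'M[R]_p) : msmooth k U A -> smooth k U (fun z => \det (A z)).
Proof.
move=> sA; rewrite /determinant; apply: smooth_sum => // s; apply: smoothM => //.
  exact: smooth_cst.
by apply: smooth_prod => // i; exact: sA.
Qed.

(** Cramer's rule reduces the inverse to determinants, which are polynomials in the entries. *)
Lemma msmooth_inv p k (A : E -> 'M[R]_p) : (forall z, U z -> A z \in unitmx) ->
  msmooth k U A -> msmooth k U (fun z => invmx (A z)).
Proof.
move=> uA sA; apply: (@msmooth_congr _ _ _ (fun z => (\det (A z))^-1 *: \adj (A z))).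
  by move=> z /[!inE] Uz; rewrite /invmx uA.
apply: msmoothZ.
  apply: smoothV => //; last exact: smooth_det.
  by move=> z /uA; rewrite unitmxE unitfE.
move=> a b; rewrite (_ : (fun z => _) = fun z => cofactor (A z) b a).
  rewrite /cofactor; apply: smoothM => //; first exact: smooth_cst.
  apply: smooth_det => i j.
  rewrite (_ : (fun z => _) = fun z => A z (lift b i) (lift a j)); first exact: sA.
  by apply/funext => z; rewrite !mxE.
by apply/funext => z; rewrite mxE.
Qed.

Variables (y : E) (Uy : U y).

Lemma mpd_eq_on p q i (A B : E -> 'M[R]_(p, q)) : {in U, A =1 B} -> mpd i A y = mpd i B y.
Proof.
move=> AB; apply/matrixP => a b; rewrite !mxE; apply: pd_eq_on Uy => // z Uz.
by rewrite AB.
Qed.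

Lemma mpd_cst p q i (A : 'M[R]_(p, q)) : mpd i (fun=> A) y = 0.
Proof. by apply/matrixP => a b; rewrite !mxE pd_cst. Qed.

Lemma mpdD p q i (A B : E -> 'M[R]_(p, q)) : msmooth 1 U A -> msmooth 1 U B ->
  mpd i (fun z => A z + B z) y = mpd i A y + mpd i B y.
Proof.
move=> sA sB; apply/matrixP => a b; rewrite !mxE.
rewrite -pdD; [|exact: msmooth_derivable sA Uy|exact: msmooth_derivable sB Uy].
by congr (pd _ _ _); apply/funext => z; rewrite mxE.
Qed.

Lemma mpdN p q i (A : E -> 'M[R]_(p, q)) : msmooth 1 U A ->
  mpd i (fun z => - A z) y = - mpd i A y.
Proof.
move=> sA; apply/matrixP => a b; rewrite !mxE.
rewrite -pdN; [|exact: msmooth_derivable sA Uy].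
by congr (pd _ _ _); apply/funext => z; rewrite mxE.
Qed.

Lemma mpdB p q i (A B : E -> 'M[R]_(p, q)) : msmooth 1 U A -> msmooth 1 U B ->
  mpd i (fun z => A z - B z) y = mpd i A y - mpd i B y.
Proof. by move=> sA sB; rewrite mpdD ?mpdN//; exact: msmoothN. Qed.

Lemma mpdM p q r i (A : E -> 'M[R]_(p, q)) (B : E -> 'M[R]_(q, r)) :
  msmooth 1 U A -> msmooth 1 U B ->
  mpd i (fun z => A z *m B z) y = mpd i A y *m B y + A y *m mpd i B y.
Proof.
move=> sA sB; apply/matrixP => a b; rewrite !mxE.
rewrite (_ : (fun z => _) = fun z => \sum_c A z a c * B z c b); last first.
  by apply/funext => z; rewrite mxE.
have dA c v : derivable (fun z => A z a c) y v by exact: msmooth_derivable sA Uy.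
have dB c v : derivable (fun z => B z c b) y v by exact: msmooth_derivable sB Uy.
rewrite pd_sum => [|c]; last exact: derivableM.
rewrite -big_split /=; apply: eq_bigr => c _; rewrite pdM// !mxE//.
Qed.

Lemma mpd_tr p q i (A : E -> 'M[R]_(p, q)) : mpd i (fun z => (A z)^T) y = (mpd i A y)^T.
Proof.
by apply/matrixP => a b; rewrite !mxE; congr (pd _ _ _); apply/funext => z; rewrite mxE.
Qed.

Lemma mpd_sum p q i (I : Type) (r : seq I) (A : I -> E -> 'M[R]_(p, q)) :
  (forall j, msmooth 1 U (A j)) ->
  mpd i (fun z => \sum_(j <- r) A j z) y = \sum_(j <- r) mpd i (A j) y.
Proof.
move=> sA; apply/matrixP => a b; rewrite mxE summxE.
under [RHS]eq_bigr do rewrite mxE.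
rewrite -pd_sum => [|j]; last exact: msmooth_derivable (sA j) Uy.
by congr (pd _ _ _); apply/funext => z; rewrite summxE.
Qed.

Lemma mpdZ p q i (f : E -> R) (A : E -> 'M[R]_(p, q)) : smooth 1 U f -> msmooth 1 U A ->
  mpd i (fun z => f z *: A z) y = pd (e_ i) f y *: A y + f y *: mpd i A y.
Proof.
move=> sf sA; apply/matrixP => a b; rewrite !mxE.
rewrite -pdM; [|exact: smooth_derivable sf Uy|exact: msmooth_derivable sA Uy].
by congr (pd _ _ _); apply/funext => z; rewrite mxE.
Qed.

Lemma mpd_schwarz p q i j (A : E -> 'M[R]_(p, q)) : msmooth 2 U A ->
  mpd i (mpd j A) y = mpd j (mpd i A) y.
Proof.
move=> sA; apply/matrixP => a b; rewrite !mxE.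
have e k : (fun z => mpd k A z a b) = pd (e_ k) (fun z => A z a b).
  by apply/funext => z; rewrite mxE.
by rewrite !e; exact: smooth_schwarz (sA a b) Uy.
Qed.

End Ops.

End MatrixCalculus.

(** Christoffel symbols of the first kind: the entry (j, l) is g_lm Gamma^m_ij. *)
Definition lowconn {R : realType} {n : nat} (G : 'rV[R]_n -> 'M[R]_n) (i : 'I_n) (y : 'rV[R]_n) : 'M[R]_n :=
  \matrix_(j, l) (2^-1 * (pd (basis_vec i) (fun z => G z j l) y + pd (basis_vec j) (fun z => G z i l) y
    - pd (basis_vec l) (fun z => G z i j) y)).

(* conn G i is the connection matrix of the i-th coordinate direction acting on
   columns of covector components: its (j, k) entry is Gamma^k_ij. *)
HB.lock Definition conn {R : realType} {n : nat} (G : 'rV[R]_n -> 'M[R]_n) (i : 'I_n)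
    (y : 'rV[R]_n) : 'M[R]_n :=
  lowconn G i y *m invmx (G y).

(** * Levi-Civita connection, curvature and their change of variables *)

Section Pullback.
Context {R : realType} {n : nat}.
Local Notation E := 'rV[R]_n.
Local Notation e_ := (@basis_vec R n).

(** The row index is the source variable, the transpose of the usual convention: [jac] acts from the
    left on columns of covector components and from the right on rows of vector components. *)
Definition jac (phi : E -> E) (z : E) : 'M[R]_n :=
  \matrix_(a, i) pd (e_ a) (fun x : E => phi x 0 i) z.

Lemma jac_smooth k (U : set E) (phi : E -> E) : (forall i, smooth k.+1 U (fun x : E => phi x 0 i))
  -> msmooth k U (jac phi).
Proof.
move=> sp a i; rewrite (_ : (fun z : E => _) = pd (e_ a) (fun x : E => phi x 0 i)).
  exact: smooth_pd.
by apply/funext => z; rewrite mxE.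
Qed.

Lemma msmooth_comp p q k (U U' : set E) (A : E -> 'M[R]_(p, q)) phi :
  open U -> open U' -> (forall z, U z -> U' (phi z)) ->
  (forall i, smooth k U (fun x : E => phi x 0 i)) -> msmooth k U' A ->
  msmooth k U (fun z : E => A (phi z)).
Proof. by move=> oU oU' UU' sp sA a b; exact: smooth_comp (sA a b). Qed.

Lemma pd_comp (U U' : set E) f phi z a :
  open U -> open U' -> (forall z, U z -> U' (phi z)) -> U z ->
  (forall i, smooth 1 U (fun x : E => phi x 0 i)) -> smooth 1 U' f ->
  pd (e_ a) (fun z : E => f (phi z)) z = \sum_i jac phi z a i * pd (e_ i) f (phi z).
Proof.
move=> oU oU' UU' Uz sp sf; rewrite (@pd_chain _ _ _ f phi z (e_ a)).
- by apply: eq_bigr => i _; rewrite mxE.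
- by move=> i; exact: smooth_derivable (sp i) Uz.
- by apply: smooth_differentiable sf _ => //; exact: UU'.
Qed.

Lemma mpd_comp p q (U U' : set E) (A : E -> 'M[R]_(p, q)) phi z a :
  open U -> open U' -> (forall z, U z -> U' (phi z)) -> U z ->
  (forall i, smooth 1 U (fun x : E => phi x 0 i)) -> msmooth 1 U' A ->
  mpd a (fun z : E => A (phi z)) z = \sum_i jac phi z a i *: mpd i A (phi z).
Proof.
move=> oU oU' UU' Uz sp sA; apply/matrixP => c d; rewrite mxE summxE.
rewrite (pd_comp a oU oU' UU' Uz sp (sA c d)); apply: eq_bigr => i _.
by rewrite !mxE.
Qed.

(* the (k, l) entry of curv G i j is R^l_kij *)
Definition curv (G : E -> 'M[R]_n) (i j : 'I_n) (y : E) : 'M[R]_n :=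
  mpd i (conn G j) y - mpd j (conn G i) y
  + (conn G j y *m conn G i y - conn G i y *m conn G j y).

Definition covd (G : E -> 'M[R]_n) (i : 'I_n) (w : E -> 'cV[R]_n) (y : E) : 'cV[R]_n :=
  mpd i w y - conn G i y *m w y.

Definition dcol (u : E -> R) (y : E) : 'cV[R]_n := \col_i pd (e_ i) u y.

Definition hess (G : E -> 'M[R]_n) (u : E -> R) (y : E) : 'M[R]_n :=
  \matrix_(i, j) covd G i (dcol u) y j 0.

(** Three derivatives are required because the curvature identity, which contains two, is later
    differentiated once. *)
Definition gmetric (U : set E) (G : E -> 'M[R]_n) :=
  [/\ open U, forall y, U y -> posdef (G y) & msmooth 3 U G].

Section LeviCivita.
Variables (U : set E) (G : E -> 'M[R]_n) (gG : gmetric U G).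

Let oU : open U. Proof. by have [] := gG. Qed.
Let pG y : U y -> posdef (G y). Proof. by move: y; have [] := gG. Qed.
Let sG k : (k <= 3)%N -> msmooth k U G.
Proof. by move=> k3; have [_ _ s] := gG; exact: msmooth_le s. Qed.

Lemma lowconn_smooth i : msmooth 2 U (lowconn G i).
Proof.
move=> j l; rewrite (_ : (fun z : E => _) = fun y => 2^-1 * (pd (e_ i) (fun z : E => G z j l) y +
  pd (e_ j) (fun z : E => G z i l) y
    - pd (e_ l) (fun z : E => G z i j) y)); last by apply/funext => z; rewrite mxE.
apply: smoothM => //; first exact: smooth_cst.
have s k a b : smooth 2 U (pd (e_ k) (fun z : E => G z a b)) by apply: smooth_pd; exact: sG.
by apply: smoothB => //; apply: smoothD.
Qed.

Lemma conn_smooth i : msmooth 2 U (conn G i).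
Proof.
rewrite conn.unlock.
apply: msmoothM => //; first exact: lowconn_smooth.
by apply: msmooth_inv => //; [move=> z /pG/posdef_unit|exact: sG].
Qed.

Lemma lowconn_sym i j l y : U y -> lowconn G i y j l = lowconn G j y i l.
Proof.
move=> Uy; rewrite !mxE; congr (_ * (_ - _)); first exact: addrC.
by apply: pd_eq_on Uy => // z /[!inE] /pG[/matrixP/(_ j i)]; rewrite mxE.
Qed.

Lemma conn_sym i j k y : U y -> conn G i y j k = conn G j y i k.
Proof.
move=> Uy; rewrite conn.unlock mxE [RHS]mxE; apply: eq_bigr => l _.
by rewrite lowconn_sym.
Qed.

Lemma connG i y : U y -> conn G i y *m G y = lowconn G i y.
Proof. by move=> Uy; rewrite conn.unlock mulmxKV// posdef_unit//; exact: pG. Qed.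

Lemma conn_metric i y : U y -> mpd i G y = conn G i y *m G y + G y *m (conn G i y)^T.
Proof.
move=> Uy; rewrite -[X in X *m _^T](pG Uy).1 -trmx_mul connG//.
have sy a b c : pd (e_ a) (fun z : E => G z b c) y = pd (e_ a) (fun z : E => G z c b) y.
  by apply: pd_eq_on Uy => // z /[!inE] /pG[/matrixP/(_ c b)]; rewrite mxE.
by apply/matrixP => j l; rewrite !mxE (sy i l j); field.
Qed.

(** The fundamental lemma of Riemannian geometry, by the Koszul formula. It recognizes a connection
    by its two properties, so that no symbol has to be computed after a change of variables. *)
Lemma conn_uniq y (S : 'I_n -> 'M[R]_n) : U y -> (forall i j k, S i j k = S j i k) ->
  (forall i, mpd i G y = S i *m G y + G y *m (S i)^T) -> forall i, S i = conn G i y.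
Proof.
move=> Uy Ssym Smet i.
have uG : G y \in unitmx by apply: posdef_unit; exact: pG.
apply: (can_inj (mulmxK uG)); rewrite connG//.
pose B a := S a *m G y.
have Bsym a b c : B a b c = B b a c.
  by rewrite /B mxE [RHS]mxE; apply: eq_bigr => k _; rewrite Ssym.
have BE a b c : pd (e_ a) (fun z : E => G z b c) y = B a b c + B a c b.
  have := Smet a; rewrite -[X in X *m (S a)^T](pG Uy).1 -trmx_mul => /matrixP/(_ b c).
  by rewrite mxE => ->; rewrite [LHS]mxE; congr (_ + _); rewrite mxE.
apply/matrixP => j l; rewrite -/(B i) [RHS]mxE !BE.
by rewrite (Bsym l i j) (Bsym l j i) (Bsym j i l); field.
Qed.

(** Second partial derivatives of [G] commute. When both orders are expressed through metric
    compatibility, the mixed products cancel and the two curvature terms remain. *)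
Lemma curv_sym i j y : U y -> curv G i j y *m G y + G y *m (curv G i j y)^T = 0.
Proof.
move=> Uy.
have sc k : msmooth 1 U (conn G k) by exact: msmooth_le (conn_smooth k).
have key a b : mpd b (mpd a G) y =
    mpd b (conn G a) y *m G y + conn G a y *m (conn G b y *m G y + G y *m (conn G b y)^T)
    + ((conn G b y *m G y + G y *m (conn G b y)^T) *m (conn G a y)^T
       + G y *m (mpd b (conn G a) y)^T).
  rewrite (@mpd_eq_on _ _ U oU y Uy _ _ b (mpd a G) (fun z : E => conn G a z *m G z + G z *m (conn G a z)^T)).
    rewrite (mpdD Uy); last 2 first.
    - by apply: msmoothM => //; exact: sG.
    - by apply: msmoothM => //; [exact: sG|exact: msmooth_tr].
    rewrite !(mpdM Uy) ?mpd_tr ?conn_metric//; try exact: sG.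
    exact: msmooth_tr.
  by move=> z /[!inE] Uz; exact: conn_metric.
have := mpd_schwarz oU Uy i j (sG (isT : (2 <= 3)%N)).
rewrite (key j i) (key i j) /curv => /eqP; rewrite -subr_eq0 => /eqP <-.
move: (mpd i _ y) (mpd j _ y) (conn G i y) (conn G j y) => Ai Aj Bi Bj.
rewrite !raddfD /= !raddfN /= !trmx_mul.
rewrite !(mulmxDl, mulmxDr, mulmxBl, mulmxBr, mulmxA, mulNmx, mulmxN, opprD, opprK).
by apply/matrixP => a b; rewrite !(mxE_add, mxE_opp); ring.
Qed.

(** The symmetry of the connection in its lower indices makes the derivative terms cancel in pairs,
    and likewise the quadratic terms. *)
Lemma bianchi i j k l y : U y -> curv G i j y k l + curv G j k y i l + curv G k i y j l = 0.
Proof.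
move=> Uy.
have sy a b c d : mpd a (conn G b) y c d = mpd a (conn G c) y b d.
  rewrite !mxE; apply: pd_eq_on Uy => // z /[!inE] Uz; exact: conn_sym.
have sm a b c d : (conn G a y *m conn G b y) c d = (conn G c y *m conn G b y) a d.
  by rewrite mxE [RHS]mxE; apply: eq_bigr => m _; rewrite conn_sym.
have cE a b c d : curv G a b y c d = mpd a (conn G b) y c d - mpd b (conn G a) y c d
    + ((conn G b y *m conn G a y) c d - (conn G a y *m conn G b y) c d).
  by rewrite /curv !mxE.
rewrite !cE (sy i j k) (sy j k i) (sy k i j) (sm j i k) (sm k j i) (sm i k j); ring.
Qed.

End LeviCivita.

Section Transformation.
Variables (U U' : set E) (G : E -> 'M[R]_n) (phi : E -> E).
Hypotheses (gG : gmetric U' G) (oU : open U) (UU' : forall z, U z -> U' (phi z)).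
Hypothesis sp : forall i, smooth 4 U (fun x : E => phi x 0 i).
Hypothesis uJ : forall z, U z -> jac phi z \in unitmx.

Let G' z := jac phi z *m G (phi z) *m (jac phi z)^T.
Let oU' : open U'. Proof. by have [] := gG. Qed.
Let J := jac phi.
(** The connection form of the target, contracted with [J] in its form index only; the matrix
    indices still refer to the frame of the target. *)
Let Abar a z := \sum_i J z a i *: conn G i (phi z).

Let sp_ k i : (k <= 4)%N -> smooth k U (fun x : E => phi x 0 i).
Proof. by move=> k4; exact: smooth_le (sp i). Qed.
Let sJ k : (k <= 3)%N -> msmooth k U J.
Proof. by move=> k3; apply: jac_smooth => i; exact: sp_. Qed.
Let sGphi k : (k <= 3)%N -> msmooth k U (fun z : E => G (phi z)).
Proof.
move=> k3; have [_ _ s] := gG.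
apply: (msmooth_comp oU oU' UU'); last exact: msmooth_le s.
by move=> i; apply: sp_; exact: leq_trans k3 _.
Qed.

Lemma pullback_metric : gmetric U G'.
Proof.
split=> //.
  move=> z Uz; apply: posdef_congr; first exact: uJ.
  by have [_ p _] := gG; exact/p/UU'.
apply: msmoothM => //; first by apply: msmoothM => //; [exact: sJ|exact: sGphi].
by apply: msmooth_tr; exact: sJ.
Qed.

Let dJ_sym z a b i : U z -> mpd a J z b i = mpd b J z a i.
Proof.
move=> Uz; rewrite !mxE.
have e c : (fun x : E => J x c i) = pd (e_ c) (fun x : E => phi x 0 i).
  by apply/funext => x; rewrite mxE.
by rewrite !e; apply: smooth_schwarz Uz => //; exact: sp_.
Qed.

Let AbarE z a : U z -> mpd a (fun x : E => G (phi x)) z = Abar a z *m G (phi z) + G (phi z) *m (Abar a z)^T.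
Proof.
move=> Uz; rewrite (mpd_comp a oU oU' UU' Uz); last 2 first.
- by move=> i; exact: sp_.
- by have [_ _ s] := gG; exact: msmooth_le s.
rewrite /Abar linear_sum /= mulmx_suml mulmx_sumr -big_split /=; apply: eq_bigr => i _.
rewrite (conn_metric gG); last exact: UU'.
by rewrite scalerDr linearZ /= -scalemxAl -scalemxAr.
Qed.

(** Gauge transformation law. The candidate (dJ + J Abar) J^-1 is symmetric, because second
    derivatives of [phi] and the target connection are, and it is compatible with the pulled back
    metric; uniqueness concludes. *)
Lemma conn_pullback z a : U z -> conn G' a z *m J z = mpd a J z + J z *m Abar a z.
Proof.
move=> Uz.
pose S b := (mpd b J z + J z *m Abar b z) *m invmx (J z).
have SJ b : S b *m J z = mpd b J z + J z *m Abar b z by rewrite /S mulmxKV// uJ.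
rewrite -SJ; congr (_ *m _); apply/esym.
apply: (@conn_uniq U G' pullback_metric z S Uz).
- move=> b c k; rewrite /S mxE [RHS]mxE; apply: eq_bigr => i _; congr (_ * _).
  rewrite mxE [RHS]mxE dJ_sym//; congr (_ + _).
  rewrite mxE [RHS]mxE.
  under eq_bigr do rewrite /Abar summxE mulr_sumr.
  under [RHS]eq_bigr do rewrite /Abar summxE mulr_sumr.
  rewrite [RHS]exchange_big /=; apply: eq_bigr => d _; apply: eq_bigr => f _.
  rewrite [X in _ * X = _]mxE [X in _ = _ * X]mxE (conn_sym gG f d i); last exact: UU'.
  by rewrite mulrCA.
- move=> b; rewrite /G'.
  have e : S b *m (J z *m G (phi z) *m (J z)^T) = (mpd b J z + J z *m Abar b z) *m G (phi z) *m (J z)^T.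
    by rewrite !mulmxA SJ.
  have [_ pG _] := gG; have sGz := (pG _ (UU' Uz)).1.
  have -> : J z *m G (phi z) *m (J z)^T *m (S b)^T = (S b *m (J z *m G (phi z) *m (J z)^T))^T.
    by rewrite trmx_mul !trmx_mul trmxK sGz !mulmxA.
  rewrite e; rewrite (mpdM Uz); last 2 first.
  - by apply: msmoothM => //; [exact: sJ|exact: sGphi].
  - by apply: msmooth_tr; exact: sJ.
  rewrite (mpdM Uz); [|exact: sJ|exact: sGphi].
  have XT : (mpd b J z + J z *m Abar b z)^T = (mpd b J z)^T + (Abar b z)^T *m (J z)^T.
    by rewrite linearD /= trmx_mul.
  rewrite -/J mpd_tr AbarE// 2!trmx_mul XT trmxK sGz.
  rewrite !(mulmxDl, mulmxDr) !mulmxA -!addrA; congr (_ + _); congr (_ + _).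
  by rewrite [LHS]addrC.
Qed.

Lemma dcol_pullback u z : U z -> smooth 1 U' u -> dcol (fun x : E => u (phi x)) z = J z *m dcol u (phi z).
Proof.
move=> Uz su; apply/colP => a; rewrite !mxE (pd_comp a oU oU' UU' Uz)//; last first.
  by move=> i; exact: sp_.
by apply: eq_bigr => i _; rewrite !mxE.
Qed.

Lemma dcol_smooth k (W : set E) (u : E -> R) : smooth k.+1 W u -> msmooth k W (dcol u).
Proof.
move=> su a b; rewrite (_ : (fun z : E => _) = pd (e_ a) u); first exact: smooth_pd.
by apply/funext => x; rewrite mxE.
Qed.

(** The inhomogeneous term dJ of the gauge law cancels the derivative that falls on [J]. *)
Lemma covd_pullback w z a : U z -> msmooth 1 U' w ->
  covd G' a (fun x : E => J x *m w (phi x)) z = J z *m (\sum_i J z a i *: covd G i w (phi z)).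
Proof.
move=> Uz sw; rewrite /covd (mpdM Uz); [|exact: sJ|]; last first.
  by apply: (msmooth_comp oU oU' UU') => // i; exact: sp_.
rewrite mulmxA conn_pullback// (mpd_comp a oU oU' UU' Uz)//; last by move=> i; exact: sp_.
rewrite mulmxDl opprD addrACA subrr add0r -mulmxA -mulmxBr; congr (_ *m _).
rewrite /Abar mulmx_suml -sumrB; apply: eq_bigr => i _.
by rewrite scalerBr -scalemxAl.
Qed.

(** The differential pulls back to J du, to which the law for covector fields applies; the direction
    of differentiation brings the second factor [J]. *)
Lemma hess_pullback u z : U z -> smooth 2 U' u ->
  hess G' (fun x : E => u (phi x)) z = J z *m hess G u (phi z) *m (J z)^T.
Proof.
move=> Uz su; apply/matrixP => a b.
have su1 : smooth 1 U' u by exact: smooth_le su.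
have -> : hess G' (fun x : E => u (phi x)) z a b = covd G' a (fun x : E => J x *m dcol u (phi x)) z b 0.
  rewrite mxE /covd (dcol_pullback Uz su1).
  suff -> : mpd a (dcol (fun x : E => u (phi x))) z = mpd a (fun x : E => J x *m dcol u (phi x)) z by [].
  by apply: (mpd_eq_on oU Uz) => x /[!inE] Ux; exact: dcol_pullback.
rewrite covd_pullback//; last exact: dcol_smooth.
rewrite mxE [RHS]mxE; apply: eq_bigr => m _.
rewrite summxE [X in _ = X * _]mxE [X in _ = _ * X]mxE mulrC; congr (_ * _).
by apply: eq_bigr => i _; rewrite mxE [hess _ _ _ _ _]mxE.
Qed.

Let Omega' b a z := mpd b (Abar a) z - mpd a (Abar b) z
  + (Abar a z *m Abar b z - Abar b z *m Abar a z).

Let sAbar a : msmooth 1 U (Abar a).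
Proof.
apply: msmooth_sum => // i; apply: msmoothZ => //.
  by have := sJ (isT : (1 <= 3)%N) a i.
apply: (msmooth_comp oU oU' UU'); first by move=> j; exact: sp_.
by apply: msmooth_le (conn_smooth gG i).
Qed.

(** Derivatives of [J] drop out because they are second derivatives of [phi], symmetric in a and
    b. *)
Let curv_pulled z b a : U z ->
  Omega' b a z = \sum_j \sum_i (J z b j * J z a i) *: curv G j i (phi z).
Proof.
move=> Uz.
have sJ1 c i : smooth 1 U (fun x : E => J x c i) by have := sJ (isT : (1 <= 3)%N) c i.
have sc i : msmooth 1 U (fun x : E => conn G i (phi x)).
  apply: (msmooth_comp oU oU' UU'); first by move=> j; exact: sp_.
  by apply: msmooth_le (conn_smooth gG i).
have d c d : mpd c (Abar d) z = \sum_i pd (e_ c) (fun x : E => J x d i) z *: conn G i (phi z)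
   + \sum_j \sum_i (J z c j * J z d i) *: mpd j (conn G i) (phi z).
  rewrite /Abar (mpd_sum Uz) => [|i]; last by apply: msmoothZ.
  under eq_bigr do rewrite (mpdZ Uz)//.
  rewrite big_split /=; congr (_ + _); rewrite exchange_big /=; apply: eq_bigr => i _.
  rewrite (mpd_comp c oU oU' UU' Uz); last 2 first.
  - by move=> j; exact: sp_.
  - by apply: msmooth_le (conn_smooth gG i).
  by rewrite scaler_sumr; apply: eq_bigr => j _; rewrite scalerA mulrC.
have sy i : pd (e_ b) (fun x : E => J x a i) z = pd (e_ a) (fun x : E => J x b i) z.
  by have := dJ_sym b a i Uz; rewrite !mxE.
rewrite /Omega' !d; under eq_bigr do rewrite sy.
have e4 (x y t : 'M[R]_n) : x + y - (x + t) = y - t by rewrite opprD addrACA subrr add0r.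
rewrite e4 [X in _ - X]exchange_big /=.
have p c d' : Abar c z *m Abar d' z = \sum_j \sum_i (J z c j * J z d' i) *: (conn G j (phi z) *m
  conn G i (phi z)).
  rewrite /Abar mulmx_suml; apply: eq_bigr => j _; rewrite mulmx_sumr; apply: eq_bigr => i _.
  by rewrite -scalemxAl -scalemxAr scalerA.
rewrite !p [X in _ + (X - _)]exchange_big /= -!sumrB -big_split /=; apply: eq_bigr => j _.
rewrite -!sumrB -big_split /=; apply: eq_bigr => i _.
by rewrite /curv (mulrC (J z a i)) -!scalerBr -scalerDr.
Qed.

(* Both Abar and conn G' are connection forms, related by the gauge
   transformation J. *)
Lemma curv_pullback z b a : U z ->
  curv G' b a z *m J z = J z *m (\sum_j \sum_i (J z b j * J z a i) *: curv G j i (phi z)).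
Proof.
move=> Uz; rewrite -curv_pulled//.
have sc c : msmooth 1 U (conn G' c).
  by apply: msmooth_le (conn_smooth pullback_metric c).
have sJ1 : msmooth 1 U J by exact: sJ.
have key c d : mpd c (conn G' d) z *m J z + conn G' d z *m mpd c J z =
    mpd c (mpd d J) z + (mpd c J z *m Abar d z + J z *m mpd c (Abar d) z).
  rewrite -(mpdM Uz)// -(mpdM Uz)// -(mpdD Uz); last 2 first.
  - by apply: msmooth_mpd; exact: sJ.
  - exact: msmoothM.
  by apply: (mpd_eq_on oU Uz) => x /[!inE] Ux; exact: conn_pullback.
have dJ c : mpd c J z = conn G' c z *m J z - J z *m Abar c z.
  by rewrite conn_pullback// addrK.
(* Equality of the two second derivatives of [J], once first derivatives are eliminated by the gauge
   law, is the relation between the two curvatures. *)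
have := mpd_schwarz oU Uz b a (sJ (isT : (2 <= 3)%N)).
have eqk c d : mpd c (mpd d J) z = mpd c (conn G' d) z *m J z + conn G' d z *m mpd c J z
   - (mpd c J z *m Abar d z + J z *m mpd c (Abar d) z).
  by rewrite key addrK.
rewrite !eqk !dJ => e; apply/eqP; rewrite -subr_eq0; apply/eqP.
move/eqP: e; rewrite -subr_eq0 => /eqP e.
rewrite -e /curv /Omega'.
move: (mpd b (conn _ a) z) (mpd a (conn _ b) z) (conn G' b z) (conn G' a z) => Ab Aa Bb Ba.
move: (mpd b (Abar a) z) (mpd a (Abar b) z) (Abar a z) (Abar b z) (J z) => ab aa ba bb j.
rewrite !(mulmxDl, mulmxDr, mulmxBl, mulmxBr, mulmxA, mulNmx, mulmxN, opprD, opprK).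
by apply/matrixP => c d; rewrite !(mxE_add, mxE_opp); ring.
Qed.

End Transformation.

End Pullback.

(** * Constant curvature and normal coordinates *)

Section CurvatureAlgebra.
Context {R : realType} {V : lmodType R}.
Variable T : V -> V -> V -> V -> R.
Hypothesis D1 : forall x x' y z w, T (x + x') y z w = T x y z w + T x' y z w.
Hypothesis D2 : forall x y y' z w, T x (y + y') z w = T x y z w + T x y' z w.
Hypothesis D3 : forall x y z z' w, T x y (z + z') w = T x y z w + T x y z' w.
Hypothesis D4 : forall x y z w w', T x y z (w + w') = T x y z w + T x y z w'.
Hypothesis A12 : forall x y z w, T x y z w = - T y x z w.
Hypothesis A34 : forall x y z w, T x y z w = - T x y w z.
Hypothesis B : forall x y z w, T x y z w + T y z x w + T z x y w = 0.
Hypothesis S : forall x y, T x y y x = 0.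

(** The octahedron argument: four instances of the cyclic identity and the two antisymmetries are
    linear relations that imply the claim. *)
Lemma curvature_pair_sym x y z w : T x y z w = T z w x y.
Proof.
move: (B x y z w) (B y z w x) (B z w x y) (B w x y z)
  (A12 x y z w) (A34 x y z w) (A34 y x z w) (A12 x z y w) (A34 x z y w) (A34 z x y w)
  (A12 x w y z) (A34 x w y z) (A34 w x y z) (A12 y z x w) (A34 y z x w) (A34 z y x w)
  (A12 y w x z) (A34 y w x z) (A34 w y x z) (A12 z w x y) (A34 z w x y) (A34 w z x y); lra.
Qed.

(** Polarization in the outer pair and then in the middle pair makes [T] antisymmetric in its first
    three slots, and the cyclic identity becomes 3 T = 0. *)
Lemma curvature_eq0 x y z w : T x y z w = 0.
Proof.
have p1 a b c : T a b b c = 0.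
  have := S (a + c) b; rewrite D1 !D4 !S.
  by rewrite (curvature_pair_sym c b b a) A12 A34; lra.
have p2 a b c d : T a b c d = - T a c b d.
  by have := p1 a (b + c) d; rewrite D2 !D3 !p1; lra.
have b := B x y z w.
by move: b (p2 x y z w) (A12 y z x w) (p2 y x z w) (A12 x y z w) (A12 z x y w) (p2 x z y w); lra.
Qed.

End CurvatureAlgebra.

Lemma sum_basis (R : realType) n (f : 'I_n -> R) a : \sum_i (@basis_vec R n a) 0 i * f i = f a.
Proof.
rewrite (bigD1 a)//= big1 ?addr0; first by rewrite basis_vecE eqxx mul1r.
by move=> j ja; rewrite basis_vecE (negbTE ja) mul0r.
Qed.

Section ConstantCurvature.
Context {R : realType} {n : nat}.
Local Notation E := 'rV[R]_n.
Local Notation e_ := (@basis_vec R n).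

(** This is g(R(p, v) s, q); for s = v and q = p it is the numerator of the sectional curvature. *)
Definition curv_tensor (G : E -> 'M[R]_n) (y p v s q : E) : R :=
  \sum_i \sum_j p 0 i * v 0 j * bform (curv G i j y *m G y) s q.

(** In indices, R^l_kij = K (g_kj delta_il - g_ki delta_jl). *)
Definition const_curv (U : set E) (G : E -> 'M[R]_n) (K : R) := forall y, U y -> forall i j,
  curv G i j y = K *: (G y *m delta_mx j i - G y *m delta_mx i j).

(** Equality case of Cauchy-Schwarz: the vector |v|^2 p - <p, v> v has squared norm |v|^2 times the
    Gram determinant, so it vanishes. *)
Lemma cauchy_strict (G : 'M[R]_n) (p v : E) : posdef G ->
  bform G p p * bform G v v - bform G p v ^+ 2 = 0 -> ~~ row_free (col_mx p v).
Proof.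
move=> [sG pG] h.
have dep a b : (a != 0) || (b != 0) -> a *: p + b *: v = 0 -> ~~ row_free (col_mx p v).
  move=> ab e; apply/negP => /row_free_inj.
  move=> /(_ 1%N (row_mx a%:M b%:M) 0); rewrite mul_row_col !mul_scalar_mx mul0mx => /(_ e).
  move=> /matrixP m0; move: ab.
  have := m0 0 (lshift 1 0); have := m0 0 (rshift 1 0).
  by rewrite row_mxEl row_mxEr !mxE !eqxx !mulr1n => -> ->; rewrite eqxx.
have [v0|v0] := eqVneq v 0.
  by apply: (dep 0 1); rewrite ?oner_eq0 ?orbT// scale0r add0r v0 scaler0.
have vv := pG _ v0.
apply: (dep (bform G v v) (- bform G p v)); first by rewrite gt_eqF.
apply/eqP; apply: contraT => /pG.
rewrite !(bformDl, bformDr, bformZl, bformZr) (bformC v p sG).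
rewrite (_ : _ + _ = bform G v v * (bform G p p * bform G v v - bform G p v ^+ 2)); last by ring.
by rewrite h mulr0 ltxx.
Qed.

Lemma curv_asym (U : set E) (G : E -> 'M[R]_n) i j y : curv G i j y = - curv G j i y.
Proof. by rewrite /curv !opprD !opprK addrC [in RHS]addrC; congr (_ + _); rewrite addrC. Qed.

(** The difference [T] between the curvature tensor and the constant curvature model has all the
    curvature symmetries. T p v v p vanishes by hypothesis for independent p, v and by antisymmetry
    for dependent ones; hence [T] is 0. *)
Lemma const_curv_of_sectional (U : set E) (G : E -> 'M[R]_n) K : gmetric U G ->
  (forall y p v, U y -> row_free (col_mx p v) ->
    curv_tensor G y p v v p = K * (bform (G y) p p * bform (G y) v v - bform (G y) p v ^+ 2)) ->
  const_curv U G K.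
Proof.
move=> gG h y Uy.
have [_ /(_ _ Uy) pG _] := gG; have [sG _] := pG.
pose RM := curv_tensor G y.
pose T p v s q := RM p v s q - K * (bform (G y) v s * bform (G y) p q - bform (G y) p s * bform (G y) v q).
have RD1 p p' v s q : RM (p + p') v s q = RM p v s q + RM p' v s q.
  rewrite /RM /curv_tensor -big_split /=; apply: eq_bigr => i _.
  by rewrite -big_split /=; apply: eq_bigr => j _; rewrite mxE; ring.
have RD2 p v v' s q : RM p (v + v') s q = RM p v s q + RM p v' s q.
  rewrite /RM /curv_tensor -big_split /=; apply: eq_bigr => i _.
  by rewrite -big_split /=; apply: eq_bigr => j _; rewrite mxE; ring.
have RZ2 p v a s q : RM p (a *: v) s q = a * RM p v s q.
  rewrite /RM /curv_tensor mulr_sumr; apply: eq_bigr => i _.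
  by rewrite mulr_sumr; apply: eq_bigr => j _; rewrite mxE; ring.
have RD3 p v s s' q : RM p v (s + s') q = RM p v s q + RM p v s' q.
  rewrite /RM /curv_tensor -big_split /=; apply: eq_bigr => i _.
  by rewrite -big_split /=; apply: eq_bigr => j _; rewrite bformDl; ring.
have RD4 p v s q q' : RM p v s (q + q') = RM p v s q + RM p v s q'.
  rewrite /RM /curv_tensor -big_split /=; apply: eq_bigr => i _.
  by rewrite -big_split /=; apply: eq_bigr => j _; rewrite bformDr; ring.
have RA12 p v s q : RM p v s q = - RM v p s q.
  rewrite /RM /curv_tensor exchange_big /= -sumrN; apply: eq_bigr => i _.
  rewrite -sumrN; apply: eq_bigr => j _.
  by rewrite (curv_asym U) mulNmx bformN; ring.
have RA34 p v s q : RM p v s q = - RM p v q s.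
  rewrite /RM /curv_tensor -sumrN; apply: eq_bigr => i _.
  rewrite -sumrN; apply: eq_bigr => j _.
  have := curv_sym gG i j Uy; rewrite -{2}sG -trmx_mul => /eqP; rewrite addr_eq0 => /eqP e.
  rewrite [in LHS]e bformN /bform.
  have -> : (s *m (curv G i j y *m G y)^T *m q^T) 0 0 = (q *m (curv G i j y *m G y) *m s^T) 0 0.
    by rewrite -[in RHS](trmxK (q *m _ *m _)) [in RHS]mxE !trmx_mul !trmxK !mulmxA.
  by ring.
have RB p v s q : RM p v s q + RM v s p q + RM s p v q = 0.
  have e p' v' s' : RM p' v' s' q = \sum_i \sum_j \sum_k p' 0 i * v' 0 j * s' 0 k *
       (\sum_l curv G i j y k l * (\sum_m G y l m * q 0 m)).
    rewrite /RM /curv_tensor; apply: eq_bigr => i _; apply: eq_bigr => j _.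
    rewrite bformE mulr_sumr; apply: eq_bigr => k _.
    rewrite -!mulrA; congr (_ * (_ * _)); rewrite mulr_sumr.
    under [LHS]eq_bigr do rewrite -mulrA mxE mulr_suml mulr_sumr.
    rewrite exchange_big /=; apply: eq_bigr => l _.
    by rewrite !mulr_sumr; apply: eq_bigr => m _; ring.
  (* The two cyclic shifts are reindexed so as to carry the same weight p_i v_j s_k; then the
     Bianchi identity applies term by term. *)
  rewrite !e [X in _ + X + _](_ : _ = \sum_i \sum_j \sum_k p 0 i * v 0 j * s 0 k *
       (\sum_l curv G j k y i l * (\sum_m G y l m * q 0 m))); last first.
    under eq_bigr do rewrite exchange_big /=; rewrite exchange_big /=; apply: eq_bigr => i _.
    by apply: eq_bigr => j _; apply: eq_bigr => k _; ring.
  rewrite [X in _ + _ + X](_ : _ = \sum_i \sum_j \sum_k p 0 i * v 0 j * s 0 k *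
       (\sum_l curv G k i y j l * (\sum_m G y l m * q 0 m))); last first.
    rewrite exchange_big /=; apply: eq_bigr => i _.
    rewrite exchange_big /=; apply: eq_bigr => j _; apply: eq_bigr => k _; ring.
  rewrite -!big_split /=; apply: big1 => i _; rewrite -!big_split /=; apply: big1 => j _.
  rewrite -!big_split /=; apply: big1 => k _; rewrite -!mulrDr.
  rewrite -!big_split /= big1 ?mulr0// => l _.
  by rewrite -!mulrDl (bianchi gG) ?mul0r.
have RS p v : T p v v p = 0.
  rewrite /T; have [/(h _ _ _ Uy) e|nf] := boolP (row_free (col_mx p v)).
    by rewrite /RM e (bformC v p sG); ring.
  have Rpp w s q : RM w w s q = 0 by have := RA12 w w s q; lra.
  have Rp0 s q : RM 0 v s q = 0 by have := RD1 0 0 v s q; rewrite addr0; lra.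
  have [[a b] /= ab e] : exists2 ab : R * R, (ab.1 != 0) || (ab.2 != 0) & ab.1 *: p + ab.2 *: v = 0.
    move: nf; rewrite -kermx_eq0 => /rowV0Pn[r /sub_kermxP r1 r0].
    exists (r 0 (lshift 1 0), r 0 (rshift 1 0)) => /=.
      apply: contraNT r0; rewrite negb_or !negbK => /andP[/eqP a0 /eqP b0].
      apply/eqP/rowP => k; rewrite mxE; case: (split_ordP k) => l ->; rewrite ord1//.
    move: r1; rewrite -{1}[r]hsubmxK mul_row_col.
    by rewrite [lsubmx r]mx11_scalar [rsubmx r]mx11_scalar !mul_scalar_mx !mxE.
  have [b0|b0] := eqVneq b 0.
    rewrite b0 eqxx orbF in ab; move: e; rewrite b0 scale0r addr0 => /eqP.
    rewrite scaler_eq0 (negbTE ab) /= => /eqP ->.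
    by rewrite Rp0 !bform0; ring.
  have -> : v = (- a / b) *: p.
    apply: (scalerI b0); rewrite scalerA mulrC divfK// scaleNr.
    by apply/eqP; rewrite -addr_eq0 addrC e.
  by rewrite RZ2 Rpp !(bformZl, bformZr); ring.
have T0 p v s q : T p v s q = 0.
  apply: curvature_eq0.
  - by move=> *; rewrite /T RD1 !bformDl; ring.
  - by move=> *; rewrite /T RD2 !bformDl; ring.
  - by move=> *; rewrite /T RD3 !bformDr; ring.
  - by move=> *; rewrite /T RD4 !bformDr; ring.
  - by move=> *; rewrite /T RA12; ring.
  - by move=> *; rewrite /T RA34; ring.
  - move=> x1 x2 x3 x4; rewrite /T; have := RB x1 x2 x3 x4.
    rewrite (bformC x3 x1 sG) (bformC x2 x1 sG) (bformC x3 x2 sG).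
    set u1 := RM _ _ _ _; set u2 := RM _ _ _ _; set u3 := RM _ _ _ _ => e.
    by rewrite -[RHS]e; ring.
  - exact: RS.
move=> i j; have uG := posdef_unit pG.
apply: (can_inj (mulmxK uG)); apply/matrixP => k m.
have tE : RM (e_ i) (e_ j) (e_ k) (e_ m) = (curv G i j y *m G y) k m.
  rewrite /RM /curv_tensor.
  under eq_bigr do (under eq_bigr do rewrite -mulrA; rewrite -mulr_sumr).
  by rewrite sum_basis sum_basis bform_delta.
have := T0 (e_ i) (e_ j) (e_ k) (e_ m); rewrite /T tE => /eqP.
rewrite subr_eq0 => /eqP ->; rewrite !bform_delta.
rewrite -scalemxAl mxE; congr (_ * _).
rewrite mulmxBl mxE_add mxE_opp -!mulmxA.
have e a b : (G y *m (delta_mx a b *m G y)) k m = G y k a * G y b m.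
  rewrite mulmxA mxE (bigD1 b)//= big1 ?addr0; last first.
    move=> c cb; rewrite mxE big1 ?mul0r// => d _; by rewrite mxE (negbTE cb) andbF mulr0.
  congr (_ * _); rewrite mxE (bigD1 a)//= big1 ?addr0; last first.
    by move=> d da; rewrite mxE (negbTE da) mulr0.
  by rewrite mxE !eqxx mulr1.
rewrite !e; have g a b : G y a b = G y b a by rewrite -[in LHS]sG mxE.
by rewrite (g k j) (g k i).
Qed.

Lemma const_curv_pullback (U U' : set E) (G : E -> 'M[R]_n) phi K :
  gmetric U' G -> open U -> (forall z, U z -> U' (phi z)) ->
  (forall i, smooth 4 U (fun x : E => phi x 0 i)) ->
  (forall z, U z -> jac phi z \in unitmx) ->
  const_curv U' G K -> const_curv U (fun z => jac phi z *m G (phi z) *m (jac phi z)^T) K.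
Proof.
move=> gG oU UU' sp uJ cc z Uz b a.
have uJz := uJ z Uz.
apply: (can_inj (mulmxK uJz)); rewrite (curv_pullback gG oU UU' sp uJ b a Uz).
set J := jac phi z in uJz *; set g := G (phi z).
have dE c d : \sum_j \sum_i (J c j * J d i) *: delta_mx j i = J^T *m delta_mx c d *m J.
  apply/matrixP => k m; rewrite summxE.
  rewrite (bigD1 k)//= [X in _ + X]big1 ?addr0; last first.
    by move=> j jk; rewrite summxE big1// => i _; rewrite !mxE eq_sym (negbTE jk) mulr0.
  rewrite summxE (bigD1 m)//= [X in _ + X]big1 ?addr0; last first.
    by move=> j jk; rewrite !mxE [m == j]eq_sym (negbTE jk) andbF mulr0.
  rewrite [LHS]mxE [X in _ * X = _]mxE !eqxx mulr1.
  rewrite [RHS]mxE (bigD1 d)//= [X in _ + X]big1 ?addr0; last first.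
    move=> j jd; rewrite mxE big1 ?mul0r// => i _; by rewrite !mxE (negbTE jd) andbF mulr0.
  rewrite [(J^T *m _) _ _]mxE (bigD1 c)//= [X in _ + X]big1 ?addr0; last first.
    by move=> j jc; rewrite !mxE (negbTE jc) mulr0.
  by rewrite !mxE !eqxx mulr1.
have dE' c d : \sum_j \sum_i (J c j * J d i) *: delta_mx i j = J^T *m delta_mx d c *m J.
  rewrite -dE exchange_big /=; apply: eq_bigr => i _; apply: eq_bigr => j _.
  by rewrite mulrC.
have -> : \sum_j \sum_i (J b j * J a i) *: curv G j i (phi z) =
   K *: (g *m (J^T *m delta_mx a b *m J) - g *m (J^T *m delta_mx b a *m J)).
  rewrite -(dE' b a) -(dE b a) !mulmx_sumr -sumrB scaler_sumr; apply: eq_bigr => j _.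
  rewrite !mulmx_sumr -sumrB scaler_sumr; apply: eq_bigr => i _.
  by rewrite (cc _ (UU' _ Uz)) -/g -!scalemxAr -scalerBr !scalerA mulrC.
by rewrite -scalemxAr -scalemxAl mulmxBr mulmxBl !mulmxA.
Qed.

End ConstantCurvature.

(** * Coordinates whose connection vanishes at a point *)

Section NormalCoordinates.
Context {R : realType} {n : nat}.
Local Notation E := 'rV[R]_n.
Local Notation e_ := (@basis_vec R n).

Definition quad (c : R) (l : E) (B : 'M[R]_n) (z : E) : R :=
  c + \sum_i z 0 i * l 0 i + bform B z z.

Lemma smooth_quad k (U : set E) c l B : open U -> smooth k U (quad c l B).
Proof.
move=> oU; rewrite /quad.
apply: smoothD => //; first apply: smoothD => //; first exact: smooth_cst.
  by apply: smooth_sum => // i; apply: smoothM => //; [exact: smooth_coord|exact: smooth_cst].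
rewrite (_ : (fun z => _) = fun z : E => \sum_i \sum_j z 0 i * B i j * z 0 j).
  apply: smooth_sum => // i; apply: smooth_sum => // j.
  apply: smoothM => //; last exact: smooth_coord.
  by apply: smoothM => //; [exact: smooth_coord|exact: smooth_cst].
by apply/funext => z; rewrite bformE.
Qed.

Lemma pd_quad c l B v x : pd v (quad c l B) x =
  \sum_i v 0 i * l 0 i + (bform B v x + bform B x v).
Proof.
have oT : open (setT : set E) by exact: openT.
have dc i : smooth 1 setT (fun z : E => z 0 i) by exact: smooth_coord.
have dcst a : smooth 1 (setT : set E) (fun=> a) by exact: smooth_cst.
have d1 i : smooth 1 setT (fun z : E => z 0 i * l 0 i) by exact: smoothM.
have d2 i j : smooth 1 setT (fun z : E => z 0 i * B i j) by exact: smoothM.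
have d3 i j : smooth 1 setT (fun z : E => z 0 i * B i j * z 0 j) by exact: smoothM.
have d4 i : smooth 1 setT (fun z : E => \sum_j z 0 i * B i j * z 0 j) by exact: smooth_sum.
have d5 : smooth 1 setT (fun z : E => \sum_i z 0 i * l 0 i) by exact: smooth_sum.
have d6 : smooth 1 setT (fun z : E => \sum_i \sum_j z 0 i * B i j * z 0 j) by exact: smooth_sum.
rewrite (_ : quad c l B = fun z : E => (c + \sum_i z 0 i * l 0 i) + \sum_i \sum_j z 0 i * B i j * z
  0 j); last first.
  by apply/funext => z; rewrite /quad bformE.
have Tx : (setT : set E) x by [].
rewrite (spdD v Tx (smoothD oT (dcst c) d5) d6) (spdD v Tx (dcst c) d5).
rewrite pd_cst add0r (spd_sum v Tx _ d1); congr (_ + _).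
  by apply: eq_bigr => i _; rewrite (spdM v Tx)// pd_coord pd_cst mulr0 addr0.
rewrite (spd_sum v Tx _ d4) !bformE -big_split /=; apply: eq_bigr => i _.
rewrite (spd_sum v Tx _ (d3 i)) -big_split /=; apply: eq_bigr => j _.
rewrite (spdM v Tx (d2 i j) (dc j)) (spdM v Tx (dc i) (dcst _)) !pd_coord pd_cst mulr0 addr0; ring.
Qed.

(** [phi] is the quadratic polynomial y0 + z F - Gamma(z F, z F) / 2, the second-order Taylor
    polynomial of the exponential map. At 0 its Jacobian is [F], and the derivative of the Jacobian
    is -Gamma(F, F), which cancels the other term of the gauge law. The connection vanishes at the
    single point 0, which is all that the estimate uses. *)
Lemma normal_coordinates (U' : set E) (G : E -> 'M[R]_n) (y0 : E) (F : 'M[R]_n) :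
  gmetric U' G -> U' y0 -> F *m G y0 *m F^T = 1%:M ->
  exists (U : set E) (phi : E -> E),
  [/\ open U /\ U 0, phi 0 = y0 /\ (forall z, U z -> U' (phi z)),
    forall i k, smooth k U (fun x : E => phi x 0 i),
    jac phi 0 = F /\ (forall z, U z -> jac phi z \in unitmx) &
    forall i, conn (fun z => jac phi z *m G (phi z) *m (jac phi z)^T) i 0 = 0].
Proof.
move=> gG Uy FG.
have [oU' pG sG] := gG.
have uF : F \in unitmx by have [] := mulmx1_unit FG; rewrite unitmx_mul => /andP[].
pose B k : 'M[R]_n := \matrix_(a, b) \sum_i \sum_j F a i * F b j * conn G i y0 j k.
have sB k : (B k)^T = B k.
  apply/matrixP => a b; rewrite !mxE exchange_big /=; apply: eq_bigr => i _.
  by apply: eq_bigr => j _; rewrite (conn_sym gG)//; ring.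
pose phi (z : E) : E := \row_k quad (y0 0 k) (\row_i F i k) (- 2^-1 *: B k) z.
have phiE k : (fun x : E => phi x 0 k) = quad (y0 0 k) (\row_i F i k) (- 2^-1 *: B k).
  by apply/funext => z; rewrite mxE.
have JE z a k : jac phi z a k = F a k - bform (B k) (e_ a) z.
  rewrite mxE phiE pd_quad !bformZ (bformC z (e_ a) (sB k)).
  by rewrite sum_basis mxE; field.
have sphi i k (W : set E) : open W -> smooth k W (fun x : E => phi x 0 i).
  by rewrite phiE; exact: smooth_quad.
have b0 (C : 'M[R]_n) (w : E) : bform C w 0 = 0 by rewrite /bform trmx0 mulmx0 mxE.
have phi0 : phi 0 = y0.
  apply/rowP => k; rewrite mxE /quad b0 addr0 big1 ?addr0// => i _.
  by rewrite [X in X * _]mxE mul0r.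
have J0 : jac phi 0 = F by apply/matrixP => a k; rewrite JE b0 subr0.
pose U := phi @^-1` U' `&` (fun z => \det (jac phi z)) @^-1` [set x | x != 0].
have oT : open (setT : set E) by exact: openT.
have cphi : continuous phi.
  move=> z; apply: continuous_rV => i.
  exact: (smooth_continuous (sphi i 0%N _ oT)).
have oU : open U.
  apply: openI; first by apply: open_comp => // z _; exact: cphi.
  apply: open_comp; last exact: open_neq.
  move=> z _; apply: (@smooth_continuous _ _ 0 setT) => //.
  apply: smooth_det => //; apply: jac_smooth => i; exact: sphi.
have UU' z : U z -> U' (phi z) by case.
have uJ z : U z -> jac phi z \in unitmx by case=> _ /=; rewrite unitmxE unitfE.
have U0 : U 0.
  by split; rewrite /= ?phi0// J0; move: uF; rewrite unitmxE unitfE.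
exists U, phi; split=> //.
  by move=> i k; exact: sphi.
move=> a; apply: (can_inj (mulmxK (uJ 0 U0))); rewrite mul0mx.
have sphi4 i : smooth 4 U (fun x : E => phi x 0 i) by exact: sphi.
rewrite (conn_pullback gG oU UU' sphi4 uJ)// J0 phi0.
apply/matrixP => b k; rewrite mxE [in RHS]mxE.
have -> : mpd a (jac phi) 0 b k = - B k b a.
  rewrite mxE.
  have -> : (fun z : E => jac phi z b k) = quad (F b k) (- (e_ b *m B k)) 0.
    apply/funext => z; rewrite JE /quad bformE -[bform 0 z z]/((z *m 0 *m z^T) 0 0).
    rewrite mulmx0 mul0mx mxE addr0; congr (_ + _).
    rewrite exchange_big /= -sumrN; apply: eq_bigr => i _.
    rewrite mxE [(e_ b *m B k) _ _]mxE mulrN; congr (- _); rewrite mulr_sumr; apply: eq_bigr => j _; ring.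
  have bz (w w' : E) : bform 0 w w' = 0 by rewrite /bform mulmx0 mul0mx mxE.
  rewrite pd_quad !bz !addr0.
  by rewrite sum_basis mxE -rowE mxE.
rewrite addrC; apply/eqP; rewrite subr_eq0; apply/eqP.
rewrite mxE [RHS]mxE; apply: eq_bigr => j _.
rewrite summxE mulr_sumr; apply: eq_bigr => i _.
by rewrite mxE (conn_sym gG i j)//; ring.
Qed.

End NormalCoordinates.

(** * The estimate at an interior maximum *)

Section SecondDerivativeTest.
Context {R : realType} {V : normedModType R}.

Lemma line_MVT_pos (f : V -> R) (x v : V) (h : R) : 0 < h ->
  (forall s : R, 0 <= s <= h -> derivable f (s *: v + x) v) ->
  exists2 s : R, 0 < s < h & f (h *: v + x) - f x = h * pd v f (s *: v + x).
Proof.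
move=> h0 df; pose g (t : R) := f (t *: v + x).
have dg (s : R) : 0 <= s <= h -> is_derive s 1 g (pd v f (s *: v + x)).
  move=> sh; rewrite -pdxE -derive_line; apply: derivableP.
  exact/derivable_lineP/df.
have [||c] := @MVT _ g (fun s => pd v f (s *: v + x)) 0 h h0.
- by move=> s; rewrite in_itv /= => /andP[h1 h2]; apply: dg; rewrite !ltW.
- apply/continuous_in_subspaceT => s; rewrite inE /= in_itv /= => sh.
  by apply: differentiable_continuous; apply/derivable1_diffP; have [] := dg _ sh.
- rewrite in_itv /= => ch e; exists c => //.
  by rewrite mulrC -(subr0 h) -e /g subr0 scale0r add0r.
Qed.

Lemma near0_itv (P : R -> Prop) : (\forall t \near (0 : R), P t) ->
  exists2 d : R, 0 < d & forall t, `|t| <= d -> P t.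
Proof.
move=> /nbhs_ballP[d /= d0 hd]; exists (d / 2); first by rewrite divr_gt0.
move=> t td; apply: hd; rewrite -ball_normE /ball_ /= sub0r normrN.
apply: le_lt_trans td _; lra.
Qed.

Lemma nbhs_line (U : set V) (x v : V) : nbhs x U ->
  \forall t \near (0 : R), U (t *: v + x).
Proof.
move=> Ux.
have c : {for (0 : R), continuous (fun t : R => t *: v + x)}.
  apply: cvgD; last exact: cvg_cst.
  by apply: cvgZr_tmp; exact: cvg_id.
have : nbhs (0 *: v + x) U by rewrite scale0r add0r.
by move/c.
Qed.

Lemma near_line (U : set V) (x v : V) : open U -> U x ->
  \forall t \near (0 : R), U (t *: v + x).
Proof. by move=> oU Ux; apply: nbhs_line; exact: open_nbhs_nbhs. Qed.

Lemma near_line_cont (f : V -> R) (x v : V) (e : R) : {for x, continuous f} -> 0 < e ->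
  \forall t \near (0 : R), `|f (t *: v + x) - f x| <= e.
Proof.
move=> cf e0; move/cvgrPdist_le/(_ _ e0) : cf => h.
by have := nbhs_line v h; apply: filterS => t; rewrite distrC.
Qed.

(** The lower bound -o(t^2) is weaker than a local minimum; it is all that the comparison function
    of the equation satisfies. *)
Lemma min2_dir (U : set V) (f : V -> R) (x v : V) : open U -> U x -> smooth 2 U f ->
  f x = 0 ->
  (forall e : R, 0 < e -> \forall t \near (0 : R), - (e * t ^+ 2) <= f (t *: v + x)) ->
  pd v f x = 0 /\ 0 <= pd v (pd v f) x.
Proof.
move=> oU Ux sf f0 hmin.
have sf1 : smooth 1 U f by exact: smooth_le sf.
have spf : smooth 1 U (pd v f) by exact: smooth_pd.
have dfx y : U y -> derivable f y v by move=> Uy; exact: smooth_derivable sf Uy.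
have dpx y : U y -> derivable (pd v f) y v by move=> Uy; exact: smooth_derivable spf Uy.
have cp : {for x, continuous (pd v f)} by exact: smooth_continuous spf Ux.
have cpp : {for x, continuous (pd v (pd v f))}.
  exact: smooth_continuous (smooth_pd v spf) Ux.
have up (w : V) : (w = v \/ w = - v) -> 0 <= pd w f x.
  move=> wv.
  have spw : smooth 1 U (pd w f) by exact: smooth_pd.
  have cw : {for x, continuous (pd w f)} by exact: smooth_continuous spw Ux.
  rewrite leNgt; apply/negP => neg.
  (* Near x the derivative along w is at most -e, so f <= -e t there, which is below the permitted
     -t^2 once t < e. *)
  pose e := - pd w f x / 2; have e0 : 0 < e by rewrite /e; lra.
  have hm : \forall t \near (0 : R), - (1 * t ^+ 2) <= f (t *: w + x).
    have [->|->] := wv; first exact: hmin.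
    have [d d0 hd] := near0_itv (hmin 1 ltr01).
    apply/nbhs_ballP; exists d => //= t; rewrite -ball_normE /ball_ /= sub0r normrN => td.
    by have := hd (- t); rewrite normrN sqrrN scaleNr -scalerN => /(_ (ltW td)).
  have [d1 d10 hd1] := near0_itv hm.
  have [d2 d20 hd2] := near0_itv (near_line w oU Ux).
  have [d3 d30 hd3] := near0_itv (near_line_cont w cw e0).
  pose t := Num.min (Num.min d1 d2) (Num.min d3 (e / 2)).
  have t0 : 0 < t by rewrite !lt_min d10 d20 d30 divr_gt0.
  have [t1 t2 t3 t4] : [/\ t <= d1, t <= d2, t <= d3 & t <= e / 2].
    by split; rewrite /t !ge_min lexx ?orbT.
  have [s /andP[s0 st] se] := @line_MVT_pos f x w t t0 (fun s h =>
    smooth_derivable (v := w) sf1 (hd2 s ltac:(case/andP: h => h1 h2; rewrite ger0_norm//; lra))).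
  have := hd1 t; rewrite (gtr0_norm t0) mul1r => /(_ t1).
  rewrite f0 subr0 in se; rewrite se.
  have := hd3 s; rewrite (gtr0_norm s0) => /(_ ltac:(lra)); rewrite ler_norml => /andP[_].
  rewrite /e in t4 *; nra.
have p0 : pd v f x = 0.
  have dx : derivable f x v by exact: dfx.
  have h1 := up v (or_introl erefl); have h2 := up (- v) (or_intror erefl).
  have e : pd (- v) f x = - pd v f x.
    rewrite -[x in LHS]add0r -[in LHS](scale0r (- v)) -pd_line.
    rewrite (_ : (fun t : R => f (t *: - v + x)) = (fun t : R => f (t *: v + x)) \o -%R); last first.
      by apply/funext => t /=; rewrite scalerN scaleNr.
    rewrite (@pd_affine _ _ _ _ -%R -%R); last by move=> h a b; rewrite opprD scalerN.
    rewrite oppr0 (_ : -1 = (-1) *: (1 : R)); last by rewrite [_ *: _]mulr1.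
    rewrite -!pdxE.
    have df0 : derivable (fun t : R => f (t *: v + x)) 0 1.
      by apply/derivable_lineP; rewrite scale0r add0r.
    rewrite deriveE; last exact/derivable1_diffP.
    rewrite linearZ /= -deriveE; last exact/derivable1_diffP.
    by rewrite derive_line scale0r add0r [_ *: _]mulN1r.
  rewrite e in h2; lra.
split=> //; rewrite leNgt; apply/negP => neg.
set D := pd v (pd v f) x in neg.
(* Where the second derivative of f is within e of D, that of f + e t^2 is at most D + e + 2 e =
   -e. *)
pose e := - D / 4; have e0 : 0 < e by rewrite /e; lra.
have [d1 d10 hd1] := near0_itv (hmin _ e0).
have [d2 d20 hd2] := near0_itv (near_line v oU Ux).
have [d3 d30 hd3] := near0_itv (near_line_cont v cpp e0).
pose t := Num.min d1 (Num.min d2 d3).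
have t0 : 0 < t by rewrite !lt_min d10 d20 d30.
have [t1 t2 t3] : [/\ t <= d1, t <= d2 & t <= d3] by split; rewrite /t !ge_min lexx ?orbT.
(* MVT for k(t) = f(t v + x) + e t^2, whose second derivative is negative near 0 *)
pose k (r : R) := f (r *: v + x) + e * r ^+ 2.
have dk (s : R) : 0 <= s <= t -> is_derive s 1 k (pd v f (s *: v + x) + 2 * e * s).
  move=> /andP[s0 st].
  have Us : U (s *: v + x) by apply: hd2; rewrite ger0_norm//; lra.
  have : is_derive s 1 (fun r : R => f (r *: v + x)) (pd v f (s *: v + x)).
    by rewrite -pdxE -derive_line; apply: derivableP; exact/derivable_lineP/dfx.
  move=> h1; rewrite /k; apply: is_derive_eq.
  by rewrite (_ : e *: (s%:A + s%:A) = e * (s * 1 + s * 1))//; ring.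
have [||c] := @MVT _ k (fun s => pd v f (s *: v + x) + 2 * e * s) 0 t t0.
- by move=> s; rewrite in_itv /= => /andP[h1 h2]; apply: dk; rewrite !ltW.
- apply/continuous_in_subspaceT => s; rewrite inE /= in_itv /= => sh.
  by apply: differentiable_continuous; apply/derivable1_diffP; have [] := dk _ sh.
rewrite in_itv /= => /andP[c0 ct]; rewrite /k scale0r add0r f0 expr0n mulr0 addr0 !subr0 => ke.
have [s /andP[s0 sc] se] := @line_MVT_pos (pd v f) x v c c0 (fun s h =>
    dpx _ (hd2 s ltac:(case/andP: h => h1 h2; rewrite ger0_norm//; lra))).
rewrite p0 subr0 in se.
have h3 := hd3 s; rewrite (gtr0_norm s0) in h3; have {}h3 := h3 ltac:(lra).
move: h3; rewrite -/D ler_norml => /andP[_ h3].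
have h1 := hd1 t; rewrite (gtr0_norm t0) in h1; have {}h1 := h1 t1.
have : pd v f (c *: v + x) + 2 * e * c < 0.
  rewrite se (_ : 2 * e * c = c * (2 * e)); last by ring.
  rewrite -mulrDr pmulr_rlt0//; rewrite /e in h3 *; lra.
move=> h; have : (pd v f (c *: v + x) + 2 * e * c) * t < 0 by rewrite nmulr_rlt0.
by rewrite -ke; lra.
Qed.

End SecondDerivativeTest.

(** * Concave homogeneous functions on the cone *)

Section Concavity.
Context {R : realType} {n : nat}.
Local Notation E := 'rV[R]_n.
Local Notation e_ := (@basis_vec R n).
Variables (Gam : set E) (F : E -> R).
Hypothesis adm : admissible Gam F.

(** Concavity at the midpoint of 2 lam and 2 mu, then homogeneity. *)
Lemma F_superadditive lam mu : Gam lam -> Gam mu -> F lam + F mu <= F (lam + mu).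
Proof.
move=> Gl Gm; have h2 : (0 : R) < 2 by [].
have G2l := cone_scale adm h2 Gl; have G2m := cone_scale adm h2 Gm.
have h02 : (0 : R) <= 2^-1 by [].
have h12 : (2^-1 : R) <= 1 by rewrite invf_le1// ler1n.
pose t : {i01 R} := Itv01 h02 h12.
have h : - F (2^-1 *: (2 *: lam) + (1 - 2^-1) *: (2 *: mu)) <=
    2^-1 * (- F (2 *: lam)) + (1 - 2^-1) * (- F (2 *: mu)).
  exact: (F_concave adm t (mem_set G2l) (mem_set G2m)).
move: h; rewrite !(F_homogeneous adm h2)// !scalerA.
have -> : (1 - 2^-1) * 2 = 1 :> R by field.
rewrite mulVf ?pnatr_eq0// !scale1r; lra.
Qed.

Variables (lam : E) (Gl : Gam lam).

Let sF : smooth 2 Gam F. Proof. by rewrite smoothE; exact: F_C2 adm. Qed.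
Let dF : differentiable F lam.
Proof. exact: (smooth_differentiable (cone_open adm) sF Gl). Qed.

(** Superadditivity gives F(lam + t mu) >= F lam + t F mu; divide by t and let t tend to 0. By
    homogeneity the supporting affine function of [F] is linear. *)
Lemma pd_F_ge mu : Gam mu -> F mu <= \sum_i pd (e_ i) F lam * mu 0 i.
Proof.
move=> Gm; rewrite [leRHS](_ : _ = pd mu F lam); last first.
  by rewrite (pd_basis _ dF); apply: eq_bigr => i _; rewrite mulrC.
have oG := cone_open adm.
apply/ler_addgt0Pl => e e0.
have spF : smooth 1 Gam (pd mu F) by exact: smooth_pd.
have cp : {for lam, continuous (pd mu F)} by exact: smooth_continuous spF Gl.
have [d1 d10 hd1] := near0_itv (near_line mu oG Gl).
have [d2 d20 hd2] := near0_itv (near_line_cont mu cp e0).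
pose t := Num.min d1 d2.
have t0 : 0 < t by rewrite !lt_min d10 d20.
have [t1 t2] : t <= d1 /\ t <= d2 by split; rewrite /t !ge_min lexx ?orbT.
have Ut (s : R) : 0 <= s <= t -> Gam (s *: mu + lam).
  by move=> /andP[s0 st]; apply: hd1; rewrite ger0_norm// (le_trans st).
have dt (s : R) : 0 <= s <= t -> derivable F (s *: mu + lam) mu.
  by move=> st; apply: (smooth_derivable sF); exact: Ut.
have [s /andP[s0 st] se] := line_MVT_pos t0 dt.
have := hd2 s; rewrite (gtr0_norm s0) => h; have {}h := h ltac:(lra).
move: h; rewrite ler_norml => /andP[_ h].
have := F_superadditive (cone_scale adm t0 Gm) Gl.
rewrite (F_homogeneous adm t0 Gm) => h3.
have : t * F mu <= t * pd mu F (s *: mu + lam) by lra.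
rewrite ler_pM2l//; lra.
Qed.

(** Differentiate F(lam + t lam) = (1 + t) F lam at t = 0. *)
Lemma euler_F : F lam = \sum_i pd (e_ i) F lam * lam 0 i.
Proof.
rewrite [RHS](_ : _ = pd lam F lam); last first.
  by rewrite (pd_basis _ dF); apply: eq_bigr => i _; rewrite mulrC.
have oG := cone_open adm.
have h := near_line lam oG Gl.
have e : {near (0 : R), (fun t : R => F (t *: lam + lam)) =1 (fun t : R => F lam + t * F lam)}.
  have [d d0 hd] := near0_itv h.
  apply/nbhs_ballP; exists (Num.min d 1); first by rewrite /= lt_min d0 ltr01.
  move=> t; rewrite -ball_normE /ball_ /= sub0r normrN lt_min => /andP[td t1].
  have t10 : 0 < t + 1 by move: t1; rewrite ltr_norml; lra.
  rewrite -{2}(scale1r lam) -scalerDl (F_homogeneous adm t10 Gl); ring.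
have -> : pd lam F lam = pd (1 : R) (fun t : R => F (t *: lam + lam)) 0.
  by rewrite pd_line scale0r add0r.
rewrite (pd_near _ e).
have : is_derive (0 : R) 1 (fun t : R => F lam + t * F lam) (F lam).
  apply: is_derive_eq.
  by rewrite (_ : 0 *: 0 + F lam *: 1 = 0 * 0 + F lam * 1 :> R)//; ring.
by rewrite -pdxE => -[_ ->].
Qed.

Lemma F_sym_perm (s : 'S_n) mu : Gam mu -> Gam (col_perm s mu) /\ F (col_perm s mu) = F mu.
Proof. by move=> Gm; split; [exact: cone_sym adm _ _ Gm|exact: F_sym adm _ _ Gm]. Qed.

Lemma pd_F_gt0 i : 0 < pd (e_ i) F lam.
Proof. by rewrite -pdxE; exact: F_monotone adm _ _ Gl. Qed.

End Concavity.

(** * Derivatives of the augmented Hessian and their commutation *)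

Section LocalEstimate.
Context {R : realType} {n : nat}.
Local Notation E := 'rV[R]_n.
Local Notation e_ := (@basis_vec R n).
Local Notation D := (fun i : 'I_n => pd (e_ i)).

Definition augW (G : E -> 'M[R]_n) (u : E -> R) (a K : R) (z : E) : 'M[R]_n :=
  hess G u z + a *: (dcol u z *m (dcol u z)^T) + K *: G z.

Variables (U : set E) (G : E -> 'M[R]_n) (u : E -> R) (a K : R).
Hypotheses (gG : gmetric U G) (U0 : U 0) (G0 : G 0 = 1%:M).
Hypotheses (c0 : forall i, conn G i 0 = 0) (cc : const_curv U G K) (su : smooth 4 U u).

Local Notation W := (augW G u a K).
Let oU : open U. Proof. by have [] := gG. Qed.
Let sG i j k : (k <= 3)%N -> smooth k U (fun z : E => G z i j).
Proof. by move=> k3; have [_ _ s] := gG; exact: smooth_le (s i j). Qed.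
Let sc i j k l : (l <= 2)%N -> smooth l U (fun z : E => conn G i z j k).
Proof. by move=> l2; exact: smooth_le (conn_smooth gG i j k). Qed.
Let su_ k : (k <= 4)%N -> smooth k U u.
Proof. by move=> k4; exact: smooth_le su. Qed.
Let su1 i k : (k <= 3)%N -> smooth k U (D i u).
Proof. by move=> k3; apply: smooth_pd; exact: su_. Qed.
Let su2 i j k : (k <= 2)%N -> smooth k U (D i (D j u)).
Proof. by move=> k3; apply: smooth_pd; exact: su1. Qed.

Lemma hessE z i j : hess G u z i j = D i (D j u) z - \sum_k conn G i z j k * D k u z.
Proof.
rewrite mxE /covd !mxE; congr (_ - _); last by apply: eq_bigr => k _; rewrite mxE.
by congr (pd _ _ _); apply/funext => x; rewrite mxE.
Qed.

Lemma WE z i j : W z i j =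
  D i (D j u) z - \sum_k conn G i z j k * D k u z + a * (D i u z * D j u z) + K * G z i j.
Proof. by rewrite /augW !mxE_add hessE !mxE big_ord_recl big_ord0 addr0 !mxE. Qed.

Lemma W_smooth : msmooth 2 U W.
Proof.
move=> i j; rewrite (_ : (fun z => _) = fun z : E => D i (D j u) z - \sum_k conn G i z j k * D k u z
    + a * (D i u z * D j u z) + K * G z i j); last by apply/funext => z; rewrite WE.
apply: smoothD => //; last by apply: smoothM => //; [exact: smooth_cst|exact: sG].
apply: smoothD => //; last first.
  by apply: smoothM => //; [exact: smooth_cst|apply: smoothM => //; exact: su1].
apply: smoothB => //; first exact: su2.
by apply: smooth_sum => // k; apply: smoothM => //; [exact: sc|exact: su1].
Qed.

Lemma augW_sym z : U z -> (W z)^T = W z.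
Proof.
move=> Uz; apply/matrixP => i j; rewrite mxE !WE.
have -> : pd (e_ j) (pd (e_ i) u) z = pd (e_ i) (pd (e_ j) u) z.
  by apply: (smooth_schwarz _ _ oU _ Uz); exact: su_.
have -> : \sum_k conn G j z i k * pd (e_ k) u z = \sum_k conn G i z j k * pd (e_ k) u z.
  by apply: eq_bigr => k _; rewrite (conn_sym gG _ _ _ Uz).
have [_ pG _] := gG; have [sy _] := pG z Uz; rewrite -[in G z j i]sy mxE; ring.
Qed.

Lemma dG0 i j k : D i (fun z => G z j k) 0 = 0.
Proof.
have := conn_metric gG i U0; rewrite c0 mul0mx trmx0 mulmx0 addr0 => /matrixP/(_ j k).
by rewrite !mxE.
Qed.

Lemma conn0E i j k : conn G i 0 j k = 0.
Proof. by rewrite c0 mxE. Qed.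

(** Metric compatibility differentiated once: at 0 the metric is the identity and the connection
    vanishes, so only derivatives of the connection survive. *)
Lemma d2G0 l i j k : D l (D i (fun z => G z j k)) 0 =
  D l (fun z => conn G i z j k) 0 + D l (fun z => conn G i z k j) 0.
Proof.
have e : {in U, D i (fun z => G z j k) =1
    (fun z => \sum_m conn G i z j m * G z m k + \sum_m G z j m * conn G i z k m)}.
  move=> z /[!inE] Uz; have := conn_metric gG i Uz => /matrixP/(_ j k).
  rewrite !mxE => ->; congr (_ + _); apply: eq_bigr => m _; by rewrite mxE.
rewrite (pd_eq_on _ oU e U0).
have s1 m : smooth 1 U (fun z => conn G i z j m * G z m k) by apply: smoothM => //; [exact: sc|exact: sG].
have s2 m : smooth 1 U (fun z => G z j m * conn G i z k m) by apply: smoothM => //; [exact: sG|exact: sc].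
rewrite (spdD _ U0 (smooth_sum _ oU s1) (smooth_sum _ oU s2)) (spd_sum _ U0 _ s1) (spd_sum _ U0 _ s2).
congr (_ + _).
  rewrite (bigD1 k)//= [X in _ + X]big1 ?addr0; last first.
    by move=> m mk; rewrite (spdM _ U0) ?G0 ?mxE ?(negbTE mk) ?mulr0 ?conn0E ?mul0r ?addr0//;
      [exact: sc|exact: sG].
  by rewrite (spdM _ U0) ?conn0E ?mul0r ?addr0 ?G0 ?mxE ?eqxx ?mulr1//; [exact: sc|exact: sG].
rewrite (bigD1 j)//= [X in _ + X]big1 ?addr0; last first.
  move=> m mk; rewrite (spdM _ U0) ?G0 ?mxE ?[j == m]eq_sym ?(negbTE mk) ?mulr0 ?conn0E ?mul0r
    ?mulr0 ?addr0//; [exact: sG|exact: sc].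
by rewrite (spdM _ U0) ?conn0E ?mulr0 ?add0r ?G0 ?mxE ?eqxx ?mul1r//; [exact: sG|exact: sc].
Qed.

Lemma curvE i j k l z : U z -> D i (fun z => conn G j z k l) z - D j (fun z => conn G i z k l) z
  + (\sum_m conn G j z k m * conn G i z m l - \sum_m conn G i z k m * conn G j z m l)
  = K * (G z k j * (i == l)%:R - G z k i * (j == l)%:R).
Proof.
move=> Uz; have := cc Uz i j => /matrixP/(_ k l).
rewrite /curv !(mxE_add, mxE_opp) !mxE => ->; congr (_ * _).
have e b c : \sum_m G z k m * (delta_mx b c : 'M[R]_n) m l = G z k b * (c == l)%:R.
  rewrite (bigD1 b)//= [X in _ + X]big1 ?addr0 => [|m mb].
    by rewrite mxE eqxx /= eq_sym.
  by rewrite mxE (negbTE mb) mulr0.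
by rewrite !e.
Qed.

Lemma curv0 i j k l : D i (fun z => conn G j z k l) 0 - D j (fun z => conn G i z k l) 0
  = K * ((k == j)%:R * (i == l)%:R - (k == i)%:R * (j == l)%:R).
Proof.
have := curvE i j k l U0; rewrite !G0 !mxE => <-.
rewrite !big1 ?subrr ?addr0// => m _; by rewrite !conn0E mulr0.
Qed.

(** The constant curvature tensor is parallel: the right side of the curvature identity is a
    combination of entries of [G], stationary at 0, and the terms quadratic in the connection vanish
    there to second order. *)
Lemma dcurv0 p i j k l : D p (D i (fun z => conn G j z k l)) 0 = D p (D j (fun z => conn G i z k l)) 0.
Proof.
have scc b c d e : smooth 1 U (fun z : E => \sum_m conn G b z k m * conn G c z m l).
  by apply: smooth_sum => // m; apply: smoothM => //; exact: sc.
have sd b c d e : smooth 1 U (D b (fun z => conn G c z d e)) by apply: smooth_pd; exact: sc.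
have e : {in U, (fun z => D i (fun z => conn G j z k l) z - D j (fun z => conn G i z k l) z) =1
   (fun z => K * (G z k j * (i == l)%:R - G z k i * (j == l)%:R)
    - (\sum_m conn G j z k m * conn G i z m l - \sum_m conn G i z k m * conn G j z m l))}.
  by move=> z /[!inE] Uz; rewrite -(curvE i j k l Uz) addrK.
have := pd_eq_on (e_ p) oU e U0.
have z1 b c : D p (fun z : E => \sum_m conn G b z k m * conn G c z m l) 0 = 0.
  rewrite (spd_sum _ U0) => [|m]; last by apply: smoothM => //; exact: sc.
  apply: big1 => m _; rewrite (spdM _ U0) ?conn0E ?mulr0 ?mul0r ?addr0//; exact: sc.
have sGc b c d : smooth 1 U (fun z : E => G z b c * d) by apply: smoothM => //; [exact: sG|exact: smooth_cst].
have z2 b c d : D p (fun z : E => G z b c * d) 0 = 0.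
  rewrite (spdM _ U0) ?pd_cst ?mulr0 ?addr0 ?dG0 ?mul0r//; [exact: sG|exact: smooth_cst].
rewrite (spdB _ U0)// (spdB _ U0); last 2 first.
- by apply: smoothM => //; [exact: smooth_cst|exact: smoothB].
- by apply: smoothB => //; exact: scc.
rewrite (spdMl _ U0); last exact: smoothB.
rewrite (spdB _ U0 (sGc _ _ _) (sGc _ _ _)) !z2 (spdB _ U0) ?z1; [|exact: scc|exact: scc].
by rewrite !subrr mulr0 subrr => /eqP; rewrite subr_eq0 => /eqP.
Qed.

Lemma dW i j z : U z -> D i (fun z => W z j j) z =
  D i (D j (D j u)) z - \sum_k (D i (fun z => conn G j z j k) z * D k u z + conn G j z j k * D i (D k u) z)
  + a * (2 * (D j u z * D i (D j u) z)) + K * D i (fun z => G z j j) z.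
Proof.
move=> Uz; rewrite (_ : (fun z => W z j j) = fun z : E => D j (D j u) z - \sum_k conn G j z j k * D k u z
    + a * (D j u z * D j u z) + K * G z j j); last by apply/funext => x; rewrite WE.
have s1 : smooth 1 U (D j (D j u)) by exact: su2.
have s2 k : smooth 1 U (fun z : E => conn G j z j k * D k u z).
  by apply: smoothM => //; [exact: sc|exact: su1].
have s3 : smooth 1 U (fun z : E => D j u z * D j u z) by apply: smoothM => //; exact: su1.
have s4 : smooth 1 U (fun z : E => G z j j) by exact: sG.
have cst c : smooth 1 U (fun=> c) by exact: smooth_cst.
rewrite (spdD _ Uz); [|by apply: smoothD => //; [apply: smoothB => //; exact: smooth_sum|exact:
  smoothM]|exact: smoothM].
rewrite (spdD _ Uz); [|by apply: smoothB => //; exact: smooth_sum|exact: smoothM].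
rewrite (spdB _ Uz s1 (smooth_sum _ oU s2)) (spd_sum _ Uz _ s2) !(spdMl _ Uz)//.
rewrite (spdM _ Uz); [|exact: su1|exact: su1].
congr (_ - _ + _ * _ + _); last by ring.
by apply: eq_bigr => k _; rewrite (spdM _ Uz)//; [exact: sc|exact: su1].
Qed.

Lemma d2W i j : D i (D i (fun z => W z j j)) 0 =
  D i (D i (D j (D j u))) 0 - \sum_k (D i (D i (fun z => conn G j z j k)) 0 * D k u 0
     + 2 * (D i (fun z => conn G j z j k) 0 * D i (D k u) 0))
  + a * (2 * (D i (D j u) 0 ^+ 2 + D j u 0 * D i (D i (D j u)) 0)) + K * D i (D i (fun z => G z j j)) 0.
Proof.
have e : {in U, D i (fun z => W z j j) =1 (fun z => D i (D j (D j u)) z - \sum_k (D i (fun z =>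
  conn G j z j k) z * D k u z + conn G j z j k * D i (D k u) z)
  + a * (2 * (D j u z * D i (D j u) z)) + K * D i (fun z => G z j j) z)}.
  by move=> z /[!inE]; exact: dW.
rewrite (pd_eq_on _ oU e U0).
have s1 : smooth 1 U (D i (D j (D j u))) by apply: smooth_pd; exact: su2.
have sdc k : smooth 1 U (D i (fun z => conn G j z j k)) by apply: smooth_pd; exact: sc.
have sk k : smooth 1 U (D k u) by exact: su1.
have sik k : smooth 1 U (D i (D k u)) by exact: su2.
have s21 k : smooth 1 U (fun z : E => D i (fun z => conn G j z j k) z * D k u z) by exact: smoothM.
have s22 k : smooth 1 U (fun z : E => conn G j z j k * D i (D k u) z).
  by apply: smoothM => //; exact: sc.
have s2 k : smooth 1 U (fun z : E => D i (fun z => conn G j z j k) z * D k u z + conn G j z j k * D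
  i (D k u) z) by exact: smoothD.
have s3 : smooth 1 U (fun z : E => D j u z * D i (D j u) z) by exact: smoothM.
have cst c : smooth 1 U (fun=> c) by exact: smooth_cst.
have s3' : smooth 1 U (fun z : E => 2 * (D j u z * D i (D j u) z)) by exact: smoothM.
have s4 : smooth 1 U (D i (fun z : E => G z j j)) by apply: smooth_pd; exact: sG.
rewrite (spdD _ U0); [|by apply: smoothD => //; [apply: smoothB => //; exact: smooth_sum|exact:
  smoothM]|exact: smoothM].
rewrite (spdD _ U0); [|by apply: smoothB => //; exact: smooth_sum|exact: smoothM].
rewrite (spdB _ U0 s1 (smooth_sum _ oU s2)) (spd_sum _ U0 _ s2) !(spdMl _ U0)//.
rewrite (spdM _ U0 (sk j) (sik j)).
rewrite expr2; congr (_ - _ + _ + _).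
apply: eq_bigr => k _; rewrite (spdD _ U0)// (spdM _ U0)// (spdM _ U0)//; last exact: sc.
by rewrite conn0E mul0r addr0; ring.
Qed.

Variables (lam : E) (i1 : 'I_n).
Hypothesis W0 : W 0 = diag_mx lam.

Lemma hess0 m i : pd (e_ m) (pd (e_ i) u) 0 = (lam 0 i - K) * (m == i)%:R - a * (pd (e_ m) u 0 * pd
  (e_ i) u 0).
Proof.
have := congr1 (fun A : 'M[R]_n => A m i) W0; rewrite /= WE G0 !mxE.
rewrite big1 ?subr0 => [|k _]; last by rewrite conn0E mul0r.
have -> : lam 0 m *+ (m == i) = lam 0 i * (m == i)%:R.
  by have [->|_] := eqVneq m i; rewrite ?mulr1 ?mulr0.
lra.
Qed.

Hypothesis dW1 : forall i, D i (fun z => W z i1 i1) 0 = 0.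

(** At 0 the combination D_i D_i W_jj - lam_j D_i D_i g_jj is a second covariant derivative, so the
    left side is W_11,ii - W_ii,11. Fourth derivatives of u cancel by symmetry, second derivatives
    of the connection by [dcurv0], and first ones reduce to K by [curv0]. Third derivatives are
    removed by dW_11 = 0 and by the first derivative of W_ii, which leaves the term in a. *)
Lemma commutation i :
  D i (D i (fun z => W z i1 i1)) 0 - D i1 (D i1 (fun z => W z i i)) 0
  - lam 0 i1 * D i (D i (fun z => G z i1 i1)) 0 + lam 0 i * D i1 (D i1 (fun z => G z i i)) 0
  = 2 * K * (lam 0 i1 - lam 0 i) + 2 * a * D i1 u 0 * D i1 (fun z => W z i i) 0.
Proof.
have e4 : D i (D i (D i1 (D i1 u))) 0 = D i1 (D i1 (D i (D i u))) 0.
  have sw b c d e : D b (D c (D d (D e u))) 0 = D b (D d (D c (D e u))) 0.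
    apply: pd_eq_on U0 => // z /[!inE] Uz; apply: (smooth_schwarz _ _ oU _ Uz); exact: su1.
  have sw' b c d e : D b (D c (D d (D e u))) 0 = D c (D b (D d (D e u))) 0.
    by apply: (smooth_schwarz _ _ oU _ U0); exact: su2.
  have sw2 b c d e : D b (D c (D d (D e u))) 0 = D b (D c (D e (D d u))) 0.
    apply: pd_eq_on U0 => // z /[!inE] Uz; apply: pd_eq_on Uz => // y /[!inE] Uy.
    by apply: (smooth_schwarz _ _ oU _ Uy); exact: su_.
  by rewrite (sw i i i1 i1) (sw2 i i1 i i1) (sw' i i1 i1 i) (sw i1 i i1 i).
have e3 : D i (D i (D i1 u)) 0 = D i1 (D i (D i u)) 0.
  have sw b c d : D b (D c (D d u)) 0 = D c (D b (D d u)) 0.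
    by apply: (smooth_schwarz _ _ oU _ U0); exact: su1.
  have sw2 b c d : D b (D c (D d u)) 0 = D b (D d (D c u)) 0.
    apply: pd_eq_on U0 => // z /[!inE] Uz; apply: (smooth_schwarz _ _ oU _ Uz); exact: su_.
  by rewrite sw2 sw.
have e3' : D i1 (D i1 (D i u)) 0 = D i (D i1 (D i1 u)) 0.
  have sw b c d : D b (D c (D d u)) 0 = D c (D b (D d u)) 0.
    by apply: (smooth_schwarz _ _ oU _ U0); exact: su1.
  have sw2 b c d : D b (D c (D d u)) 0 = D b (D d (D c u)) 0.
    apply: pd_eq_on U0 => // z /[!inE] Uz; apply: (smooth_schwarz _ _ oU _ Uz); exact: su_.
  by rewrite sw2 sw.
have e2 : D i (D i1 u) 0 = D i1 (D i u) 0 by apply: (smooth_schwarz _ _ oU _ U0); exact: su_.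
have c2 m : D i (D i (fun z => conn G i1 z i1 m)) 0 = D i1 (D i1 (fun z => conn G i z i m)) 0.
  rewrite dcurv0 [RHS]dcurv0.
  have s1 : D i (D i1 (fun z => conn G i z i1 m)) 0 = D i (D i1 (fun z => conn G i1 z i m)) 0.
    apply: pd_eq_on U0 => // z /[!inE] Uz; apply: pd_eq_on Uz => // y /[!inE] Uy.
    by rewrite (conn_sym gG).
  rewrite s1; apply: (smooth_schwarz _ _ oU _ U0); exact: sc.
have W1i := dW1 i; rewrite (dW i i1 U0) dG0 mulr0 addr0 in W1i.
have Wi1 := dW i1 i U0; rewrite dG0 mulr0 addr0 in Wi1.
have z1 b c : \sum_k (D b (fun z => conn G c z c k) 0 * D k u 0 + conn G c 0 c k * D b (D k u) 0)
   = \sum_k D b (fun z => conn G c z c k) 0 * D k u 0.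
  by apply: eq_bigr => k _; rewrite conn0E mul0r addr0.
rewrite z1 in W1i; rewrite z1 in Wi1.
(* By [hess0] the Hessian at 0 is diagonal minus a multiple of du du^T, so the cross terms reduce to
   one entry and a multiple of the first-order sum. *)
have z2 b c : \sum_k (D b (D b (fun z => conn G c z c k)) 0 * D k u 0
     + 2 * (D b (fun z => conn G c z c k) 0 * D b (D k u) 0))
  = \sum_k D b (D b (fun z => conn G c z c k)) 0 * D k u 0
    + 2 * ((lam 0 b - K) * D b (fun z => conn G c z c b) 0
           - a * D b u 0 * \sum_k D b (fun z => conn G c z c k) 0 * D k u 0).
  rewrite big_split /= -mulr_sumr; congr (_ + 2 * _).
  transitivity (\sum_k (D b (fun z => conn G c z c k) 0 * ((lam 0 k - K) * (b == k)%:R)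
      - D b (fun z => conn G c z c k) 0 * (a * (D b u 0 * D k u 0)))).
    by apply: eq_bigr => k _; rewrite -mulrBr; congr (_ * _); exact: hess0.
  rewrite sumrB; congr (_ - _).
    rewrite (bigD1 b)//= [X in _ + X]big1 ?addr0 => [|k kb].
      by rewrite eqxx mulr1 mulrC.
    by rewrite eq_sym (negbTE kb) !mulr0.
  by rewrite mulr_sumr; apply: eq_bigr => k _; ring.
rewrite !d2W !z2 e4 e2 e3 e3' Wi1.
have -> : \sum_k D i (D i (fun z => conn G i1 z i1 k)) 0 * D k u 0 =
    \sum_k D i1 (D i1 (fun z => conn G i z i k)) 0 * D k u 0.
  by apply: eq_bigr => k _; congr (_ * _); exact: c2.
rewrite !d2G0.
have k1 := curv0 i i1 i1 i; have k2 := curv0 i i1 i i1; rewrite !eqxx in k1 k2.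
have sy : D i (fun z => conn G i z i1 i1) 0 = D i (fun z => conn G i1 z i i1) 0.
  by apply: pd_eq_on U0 => // z /[!inE] Uz; rewrite (conn_sym gG).
have sy2 : D i1 (fun z => conn G i1 z i i) 0 = D i1 (fun z => conn G i z i1 i) 0.
  by apply: pd_eq_on U0 => // z /[!inE] Uz; rewrite (conn_sym gG).
rewrite sy sy2; rewrite (eq_sym i1 i) in k1 k2.
set S1 := \sum_k _ in W1i *; set S2 := \sum_k D i1 _ 0 * _ in Wi1 *; set S3 := \sum_k D i1 (D i1 _) 0 * _.
set c1 := D i (fun z => conn G i1 z i1 i) 0 in k1 *; set c3 := D i1 (fun z => conn G i z i1 i) 0 in k1 *.
set c4 := D i (fun z => conn G i1 z i i1) 0 in k2 *; set c5 := D i1 (fun z => conn G i z i i1) 0 in k2 *.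
(* The case i = i1, where both sides of the claim vanish, is treated together with the others
   through Kronecker symbols. *)
have dl : (i == i1)%:R * (lam 0 i1 - lam 0 i) = 0.
  by have [->|_] := eqVneq i i1; rewrite ?subrr ?mulr0 ?mul0r.
have dd : (i == i1)%:R * (i == i1)%:R = (i == i1)%:R :> R by case: (i == i1); rewrite ?mulr1 ?mulr0.
rewrite dd !mulr1 in k1 k2.
have {}k1 : c1 - c3 = K * (1 - (i == i1)%:R) := k1.
have {}k2 : c4 - c5 = K * ((i == i1)%:R - 1) := k2.
have -> : c1 = c3 + K * (1 - (i == i1)%:R) by lra.
have -> : c4 = c5 + K * ((i == i1)%:R - 1) by lra.
have S1E : S1 = D i (D i1 (D i1 u)) 0 + a * (2 * (D i1 u 0 * D i (D i1 u) 0)) by lra.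
rewrite S1E e2; set d := (i == i1)%:R in dl *.
have dl' : K * (d * lam 0 i1) = K * (d * lam 0 i).
  by congr (_ * _); move: dl; rewrite mulrBr; lra.
lra.
Qed.

End LocalEstimate.

Lemma mxE_scale (R : pzRingType) m n (c : R) (A : 'M[R]_(m, n)) i j : (c *: A) i j = c * A i j.
Proof. by rewrite mxE. Qed.

Lemma sum_norm_le (R : realType) n (f : 'I_n -> R) c :
  (forall i, `|f i| <= c) -> `|\sum_i f i| <= n%:R * c.
Proof.
move=> h; apply: le_trans (ler_norm_sum _ _ _) _.
rewrite mulr_natl; have -> : c *+ n = \sum_(i < n) c by rewrite sumr_const card_ord.
exact: ler_sum.
Qed.

(** * Maximum principle for the top eigenvalue *)

Section LocalMaximum.
Context {R : realType} {n : nat}.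
Local Notation E := 'rV[R]_n.
Local Notation e_ := (@basis_vec R n).
Local Notation D := (fun i : 'I_n => pd (e_ i)).

Variables (Gam : set E) (F : E -> R) (adm : admissible Gam F).
Variables (U : set E) (G : E -> 'M[R]_n) (u : E -> R) (a K : R).
Hypotheses (gG : gmetric U G) (U0 : U 0) (G0 : G 0 = 1%:M).
Hypotheses (c0 : forall i, conn G i 0 = 0) (cc : const_curv U G K) (su : smooth 4 U u).
Local Notation W := (augW G u a K).
Variables (lam : E) (i1 : 'I_n) (beta : E -> R).
Hypotheses (W0 : W 0 = diag_mx lam) (Gl : Gam lam) (hmax : forall j, lam 0 j <= lam 0 i1).
Hypothesis nsd : forall z, U z -> forall x, bform (W z) x x <= lam 0 i1 * bform (G z) x x.
Hypothesis sb : smooth 2 U beta.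
Hypothesis eqF : forall z, U z ->
  exists mu, [/\ is_spectrum (invmx (G z) *m W z) mu, Gam mu & F mu = beta z].

Let oU : open U. Proof. by have [] := gG. Qed.
Let sG k : (k <= 3)%N -> msmooth k U G.
Proof. by move=> k3; have [_ _ s] := gG; exact: msmooth_le s. Qed.
Let sW : msmooth 2 U W. Proof. exact: W_smooth. Qed.

Lemma max_first_second i : D i (fun z => W z i1 i1) 0 = 0 /\
  D i (D i (fun z => W z i1 i1)) 0 <= lam 0 i1 * D i (D i (fun z => G z i1 i1)) 0.
Proof.
set L := lam 0 i1; pose f (z : E) := L * G z i1 i1 - W z i1 i1.
have sg2 : smooth 2 U (fun z : E => G z i1 i1) by exact: sG.
have sg1 : smooth 1 U (fun z : E => G z i1 i1) by exact: sG.
have sw1 : smooth 1 U (fun z : E => W z i1 i1) by exact: smooth_le (sW i1 i1).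
have sLg2 : smooth 2 U (fun z : E => L * G z i1 i1) by apply: smoothM => //; exact: smooth_cst.
have sLg1 : smooth 1 U (fun z : E => L * G z i1 i1) by exact: smooth_le sLg2.
have sf : smooth 2 U f by apply: smoothB => //; exact: sW.
have f0 : f 0 = 0 by rewrite /f G0 W0 !mxE eqxx mulr1n mulr1 subrr.
have fge z : U z -> 0 <= f z.
  move=> Uz; have := nsd Uz (e_ i1); by rewrite !bform_delta /f subr_ge0.
have [|h1 h2] := min2_dir (v := e_ i) oU U0 sf f0.
  move=> e e0; have := near_line (e_ i) oU U0; apply: filterS => t /fge; apply: le_trans.
  by rewrite oppr_le0 mulr_ge0 ?sqr_ge0// ltW.
have pf : {in U, pd (e_ i) f =1 (fun z => L * D i (fun z => G z i1 i1) z - D i (fun z => W z i1 i1) z)}.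
  by move=> z /[!inE] Uz; rewrite (spdB _ Uz sLg1 sw1) (spdMl _ Uz).
have dg : D i (fun z => G z i1 i1) 0 = 0 by exact: (dG0 gG U0 c0).
split.
  by move: h1; rewrite pf ?inE// dg mulr0 sub0r => /eqP; rewrite oppr_eq0 => /eqP.
have spg : smooth 1 U (D i (fun z => G z i1 i1)) by exact: smooth_pd.
have spw : smooth 1 U (D i (fun z => W z i1 i1)) by apply: smooth_pd; exact: sW.
move: h2; rewrite (pd_eq_on _ oU pf U0) (spdB _ U0 _ spw); last first.
  by apply: smoothM => //; exact: smooth_cst.
by rewrite (spdMl _ U0)// subr_ge0.
Qed.

Let E0 (z : E) : 'M[R]_n := (3 / 2)%:M - 2^-1 *: G z.

Let E0_tr z : U z -> (E0 z)^T = E0 z.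
Proof.
move=> Uz; have [_ pG _] := gG; have [sy _] := pG z Uz.
by rewrite /E0 linearB /= tr_scalar_mx linearZ /= sy.
Qed.

Let E00 : E0 0 = 1%:M.
Proof.
by apply/matrixP => i j; rewrite /E0 G0 !mxE; case: (i == j); rewrite ?mulr1n ?mulr0n; lra.
Qed.

(* E0 approximates the inverse square root of G to second order *)
Let E0_defect z : E0 z *m G z *m E0 z - 1%:M =
  4^-1 *: ((G z - 1%:M) *m (G z - 1%:M) *m (G z - 1%:M)) - (3 / 4) *: ((G z - 1%:M) *m (G z - 1%:M)).
Proof.
pose X := G z - 1%:M; have GX : G z = X + 1%:M by rewrite subrK.
have EX : E0 z = 1%:M - 2^-1 *: X.
  apply/matrixP => i j; rewrite /E0 GX !mxE; case: (i == j); rewrite ?mulr1n ?mulr0n; lra.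
rewrite -/X EX {}GX; move: X {EX} => X.
set X2 := X *m X; set X3 := X2 *m X.
have -> : (1%:M - 2^-1 *: X) *m (X + 1%:M) = 1%:M + 2^-1 *: X - 2^-1 *: X2.
  rewrite mulmxBl mul1mx -scalemxAl mulmxDr mulmx1 -/X2.
  by apply/matrixP => i j; rewrite !mxE; lra.
rewrite mulmxBr mulmx1 -scalemxAr.
rewrite mulmxBl mulmxDl mul1mx -!scalemxAl -/X2 -/X3.
clearbody X3; clearbody X2; apply/matrixP => i j; rewrite !mxE; lra.
Qed.

(** As dG vanishes at 0 and is continuous, X = G - 1 is o(t) along the axis, and the defect is of
    order X^2. *)
Let small_along e : 0 < e -> \forall t \near (0 : R),
  forall i j, `|(E0 (t *: e_ i1 + 0) *m G (t *: e_ i1 + 0) *m E0 (t *: e_ i1 + 0) - 1%:M) i j| <= e * t ^+ 2.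
Proof.
move=> e0; pose N : R := n%:R.
have N1 : 1 <= N by rewrite /N ler1n (leq_ltn_trans _ (ltn_ord i1)).
(* With the entries of X bounded by dl |t|, those of X^2 and X^3 are at most N^2 dl t^2; dl <= 1
   serves to absorb the extra factors. *)
have [dl [dl0 dl1 dle]] : exists dl, [/\ 0 < dl, dl <= 1 & N ^+ 2 * dl <= e].
  exists (Num.min 1 (e / N ^+ 2)); split.
  - by rewrite lt_min ltr01 divr_gt0// exprn_gt0// (lt_le_trans ltr01).
  - by rewrite ge_min lexx.
  - by rewrite -ler_pdivlMl ?exprn_gt0 ?(lt_le_trans ltr01)// mulrC ge_min lexx orbT.
have cD i j : \forall t \near (0 : R), `|D i1 (fun z => G z i j) (t *: e_ i1 + 0)| <= dl.
  have spg : smooth 1 U (D i1 (fun z => G z i j)) by apply: smooth_pd; exact: sG.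
  have := near_line_cont (e_ i1) (smooth_continuous spg U0) dl0.
  apply: filterS => t; have -> : D i1 (fun z => G z i j) 0 = 0 by exact: (dG0 gG U0 c0).
  by rewrite subr0.
have cDa : \forall t \near (0 : R), forall i j, `|D i1 (fun z => G z i j) (t *: e_ i1 + 0)| <= dl.
  apply: (@filter_forall R _ (fun i t => forall j, `|D i1 (fun z => G z i j) (t *: e_ i1 + 0)| <=
    dl) _ (nbhs_filter (0 : R))) => i.
  by apply: (@filter_forall R _ (fun j t => `|D i1 (fun z => G z i j) (t *: e_ i1 + 0)| <= dl) _
    (nbhs_filter (0 : R))) => j; exact: cD.
have [d1 d10 hd1] := near0_itv cDa.
have [d2 d20 hd2] := near0_itv (near_line (e_ i1) oU U0).
apply/nbhs_ballP; exists (Num.min 1 (Num.min d1 d2)).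
  by rewrite /= !lt_min ltr01 d10 d20.
move=> t; rewrite -ball_normE /ball_ /= sub0r normrN !lt_min => /and3P[t1 td1 td2].
set z := t *: e_ i1 + 0; pose X := G z - 1%:M.
have Xb i j : `|X i j| <= dl * `|t|.
  have [s|s st se] := @line_MVT_pd _ _ (fun z : E => G z i j) 0 (e_ i1) t.
    move=> st; apply: (smooth_derivable (sG (k := 1) isT i j)); apply: hd2.
    by rewrite (le_trans st)// ltW.
  have -> : X i j = G z i j - G 0 i j by rewrite /X G0 !mxE_add !mxE_opp.
  rewrite se normrM mulrC ler_wpM2r//; apply: hd1.
  by rewrite (le_trans st)// ltW.
have t21 : `|t| ^+ 2 = t ^+ 2 by rewrite real_normK// num_real.
have X2b i j : `|(X *m X) i j| <= N * (dl * t ^+ 2).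
  rewrite mxE; apply: sum_norm_le => k; rewrite normrM (le_trans (ler_pM _ _ (Xb i k) (Xb k j)))//.
  rewrite mulrACA -expr2 -[`|t| * _]expr2 t21 ler_wpM2r ?sqr_ge0// expr2 ler_piMr// ?(ltW dl0) //.
have X3b i j : `|(X *m X *m X) i j| <= N ^+ 2 * (dl * t ^+ 2).
  rewrite mxE expr2 -mulrA; apply: sum_norm_le => k.
  rewrite normrM -[leRHS]mulr1 ler_pM//.
  by rewrite (le_trans (Xb k j))// mulr_ile1// ltW.
move=> i j; rewrite E0_defect -/X mxE_add mxE_opp !mxE_scale.
have := X2b i j; have := X3b i j; rewrite !ler_norml => /andP[a1 a2] /andP[a3 a4].
have h : N ^+ 2 * (dl * t ^+ 2) <= e * t ^+ 2 by rewrite mulrA ler_wpM2r ?sqr_ge0.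
have h2 : N * (dl * t ^+ 2) <= N ^+ 2 * (dl * t ^+ 2).
  apply: ler_wpM2r; first by rewrite mulr_ge0 ?sqr_ge0 ?(ltW dl0).
  by rewrite expr2 ler_peMl// (le_trans ler01).
apply/andP; split; lra.
Qed.

Let What (z : E) : 'M[R]_n := E0 z *m W z *m E0 z.
Let fr (i : 'I_n) : R := pd (e_ i) F lam.
Let psi (z : E) := \sum_i fr i * What z i i - beta z.

Let fr0 i : 0 < fr i. Proof. exact: (pd_F_gt0 adm Gl). Qed.

Let L0 : 0 < lam 0 i1.
Proof.
have := cone_sup_sum adm Gl; rewrite /= => h.
have : \sum_i lam 0 i <= \sum_(i < n) lam 0 i1 by apply: ler_sum.
move/(lt_le_trans h); rewrite sumr_const card_ord.
by rewrite pmulrn_lgt0// (leq_ltn_trans (leq0n _) (ltn_ord i1)).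
Qed.

(** For a frame [V] diagonalizing both [G] and W, the matrix [Q] = E0 V^-1 satisfies Q diag(dd) Q^T
    = What and Q Q^T = E0 G E0. Majorization bounds the weighted diagonal of What from below, up to
    the defect, by the sum of fr_i dd_(pi i), which is at least F dd = beta by [pd_F_ge] and the
    symmetry of [F]. *)
Let psi_low z d : U z -> (forall i j, `|(E0 z *m G z *m E0 z - 1%:M) i j| <= d) ->
  - (6 * n%:R ^+ 2 * (\sum_i fr i) * (n%:R * lam 0 i1) * d) <= psi z.
Proof.
move=> Uz hd; have [_ pG _] := gG; have pGz := pG z Uz.
have sWz : (W z)^T = W z by exact: (augW_sym a K gG su Uz).
have [V [dd [VG VW]]] := simdiag pGz sWz.
have sp := is_spectrum_frame (posdef_unit pGz) VG VW.
have [mu [smu Gmu Fmu]] := eqF Uz.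
have [s ds] := is_spectrum_uniq smu sp.
have [Gd Fd] := F_sym_perm adm s Gmu; rewrite -ds Fmu in Gd Fd.
have VGV : G z *m V^T *m V = 1%:M by apply: mulmx1C; rewrite mulmxA.
have VVG : V^T *m V *m G z = 1%:M by apply: mulmx1C; rewrite mulmxA.
pose Q := E0 z *m G z *m V^T.
have QT : Q^T = V *m G z *m E0 z.
  by rewrite /Q !trmx_mul trmxK E0_tr// mulmxA; have [-> _] := pGz.
have QQ : Q *m Q^T = E0 z *m G z *m E0 z.
  by rewrite QT /Q !mulmxA -(mulmxA (E0 z) (G z)) -(mulmxA (E0 z)) VGV mulmx1.
have QW : Q *m diag_mx dd *m Q^T = What z.
  rewrite -VW QT /Q !mulmxA -(mulmxA (E0 z) (G z)) -(mulmxA (E0 z)) VGV mulmx1.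
  by rewrite -!mulmxA (mulmxA V^T) (mulmxA (V^T *m V)) VVG mul1mx mulmxA.
have dle i : dd 0 i <= lam 0 i1.
  have := nsd Uz (row i V).
  have r (A : 'M[R]_n) : bform A (row i V) (row i V) = (V *m A *m V^T) i i.
    by rewrite rowE bform_mul bform_delta.
  by rewrite !r VG VW !mxE eqxx !mulr1n mulr1.
(* The eigenvalues are at most lam_1 and have positive sum, so each exceeds -(n - 1) lam_1. *)
have dabs i : `|dd 0 i| <= n%:R * lam 0 i1.
  have n1 : 1 <= n%:R :> R by rewrite ler1n (leq_ltn_trans _ (ltn_ord i1)).
  have h := cone_sup_sum adm Gd; rewrite /= (bigD1 i)//= in h.
  have h2 : \sum_(j < n | j != i) dd 0 j <= (n%:R - 1) * lam 0 i1.
    apply: le_trans (ler_sum _ (fun j _ => dle j)) _.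
    rewrite sumr_const cardC1 card_ord -[leLHS]mulr_natl ler_wpM2r ?(ltW L0)//.
    by rewrite -subn1 natrB// (leq_ltn_trans _ (ltn_ord i1)).
  have n2 : 0 <= (n%:R - 1) * lam 0 i1 by rewrite mulr_ge0 ?subr_ge0 ?(ltW L0).
  have := dle i; have := L0; rewrite ler_norml; move: h2 n2; rewrite mulrBl mul1r => h2 n2 l0 di.
  by apply/andP; split; lra.
have frb i : 0 <= fr i <= \sum_i fr i.
  rewrite (ltW (fr0 i)) (bigD1 i)//= lerDl; apply: sumr_ge0 => j _; exact/ltW/fr0.
have [pi hpi] := almost_schur_horn frb dabs (Q := Q) (d := d) ltac:(by rewrite QQ).
have [Gp Fp] := F_sym_perm adm pi Gd.
have := pd_F_ge adm Gl Gp; rewrite Fp Fd.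
have -> : \sum_i pd (e_ i) F lam * col_perm pi dd 0 i = \sum_i fr i * dd 0 (pi i).
  by apply: eq_bigr => i _; rewrite mxE.
rewrite QW in hpi; rewrite /psi; lra.
Qed.

Let psi0 : psi 0 = 0.
Proof.
have [mu [smu Gmu Fmu]] := eqF U0.
have sp : is_spectrum (invmx (G 0) *m W 0) lam.
  rewrite G0 W0; apply: (is_spectrum_frame (V := 1%:M)); rewrite ?unitmx1//.
    by rewrite !mul1mx trmx1.
  by rewrite mul1mx trmx1 mulmx1.
have [s ds] := is_spectrum_uniq smu sp.
have [_ Fd] := F_sym_perm adm s Gmu; rewrite -ds Fmu in Fd.
rewrite /psi -Fd (euler_F adm Gl) -sumrB big1// => i _.
by rewrite /What E00 mul1mx mulmx1 W0 mxE eqxx mulr1n subrr.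
Qed.

Let sE k : (k <= 3)%N -> msmooth k U E0.
Proof.
move=> k3; apply: msmoothB => //; first exact: msmooth_cst.
by apply: msmoothZ => //; [exact: smooth_cst|exact: sG].
Qed.

Let sWh : msmooth 2 U What.
Proof. by apply: msmoothM => //; [apply: msmoothM => //; exact: sE|exact: sE]. Qed.

Let dE z : U z -> mpd i1 E0 z = - (2^-1 *: mpd i1 G z).
Proof.
move=> Uz; rewrite (mpdB oU Uz); last 2 first.
- exact: msmooth_cst.
- by apply: msmoothZ => //; [exact: smooth_cst|exact: sG].
rewrite mpd_cst sub0r (mpdZ Uz); [|exact: smooth_cst|exact: sG].
by rewrite pd_cst scale0r add0r.
Qed.

Let dE00 : mpd i1 E0 0 = 0.
Proof.
rewrite dE// (_ : mpd i1 G 0 = 0) ?scaler0 ?oppr0//.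
by apply/matrixP => i j; rewrite !mxE (dG0 gG U0 c0).
Qed.

Let dWh z : U z -> mpd i1 What z =
  (mpd i1 E0 z *m W z + E0 z *m mpd i1 W z) *m E0 z + E0 z *m W z *m mpd i1 E0 z.
Proof.
move=> Uz; have sW1 : msmooth 1 U W by exact: msmooth_le sW.
by rewrite (mpdM Uz) ?(mpdM Uz)//; try exact: sE; apply: msmoothM => //; exact: sE.
Qed.

Let dWh0 : mpd i1 What 0 = mpd i1 W 0.
Proof. by rewrite dWh// dE00 E00 !mul0mx !mul1mx mulmx0 mulmx1 add0r addr0. Qed.

Let ddE0 : mpd i1 (mpd i1 E0) 0 = - (2^-1 *: mpd i1 (mpd i1 G) 0).
Proof.
have e : {in U, mpd i1 E0 =1 (fun z => - (2^-1 *: mpd i1 G z))} by move=> z /[!inE]; exact: dE.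
have s : msmooth 1 U (mpd i1 G) by apply: msmooth_mpd; exact: sG.
rewrite (mpd_eq_on oU U0 _ e) (mpdN U0); last by apply: msmoothZ => //; exact: smooth_cst.
by rewrite (mpdZ U0)//; [rewrite pd_cst scale0r add0r|exact: smooth_cst].
Qed.

(** At 0 one has E0 = 1, dE0 = 0, ddE0 = -ddG / 2, and W is diagonal. The two outer factors together
    give -lam_i ddG_ii, exactly the correction that makes the second derivative of W covariant. *)
Let ddWh0 i : mpd i1 (mpd i1 What) 0 i i =
  mpd i1 (mpd i1 W) 0 i i - lam 0 i * mpd i1 (mpd i1 G) 0 i i.
Proof.
have e : {in U, mpd i1 What =1 (fun z =>
  (mpd i1 E0 z *m W z + E0 z *m mpd i1 W z) *m E0 z + E0 z *m W z *m mpd i1 E0 z)}.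
  by move=> z /[!inE]; exact: dWh.
have sW1 : msmooth 1 U W by exact: msmooth_le sW.
have sdW : msmooth 1 U (mpd i1 W) by exact: msmooth_mpd.
have sE1 : msmooth 1 U E0 by exact: sE.
have sdE : msmooth 1 U (mpd i1 E0) by apply: msmooth_mpd; exact: sE.
have s1 : msmooth 1 U (fun z => mpd i1 E0 z *m W z) by exact: msmoothM.
have s2 : msmooth 1 U (fun z => E0 z *m mpd i1 W z) by exact: msmoothM.
have s3 : msmooth 1 U (fun z => mpd i1 E0 z *m W z + E0 z *m mpd i1 W z) by exact: msmoothD.
have s4 : msmooth 1 U (fun z => E0 z *m W z) by exact: msmoothM.
rewrite (mpd_eq_on oU U0 _ e) (mpdD U0); [|exact: msmoothM|exact: msmoothM].
rewrite (mpdM U0 _ s3 sE1) (mpdM U0 _ s4 sdE) (mpdD U0 _ s1 s2) (mpdM U0 _ sdE sW1) (mpdM U0 _ sE1 sdW).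
rewrite dE00 E00 !mulmx0 !mul0mx !mul1mx !mulmx1 !addr0 !add0r ddE0 W0.
rewrite mulNmx mulmxN -scalemxAl -scalemxAr !(mxE_add, mxE_opp) !mxE_scale.
have -> : (mpd i1 (mpd i1 G) 0 *m diag_mx lam) i i = mpd i1 (mpd i1 G) 0 i i * lam 0 i.
  by rewrite mul_mx_diag mxE.
have -> : (diag_mx lam *m mpd i1 (mpd i1 G) 0) i i = lam 0 i * mpd i1 (mpd i1 G) 0 i i.
  by rewrite mul_diag_mx mxE.
lra.
Qed.

Lemma equation_first_second :
  D i1 beta 0 = \sum_i fr i * D i1 (fun z => W z i i) 0 /\
  D i1 (D i1 beta) 0 <= \sum_i fr i * (D i1 (D i1 (fun z => W z i i)) 0
    - lam 0 i * D i1 (D i1 (fun z => G z i i)) 0).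
Proof.
have cst k c : smooth k U (fun=> c) by exact: smooth_cst.
have sb1 : smooth 1 U beta by exact: smooth_le sb.
have st2 i : smooth 2 U (fun z : E => fr i * What z i i) by apply: smoothM => //; exact: sWh.
have st1 i : smooth 1 U (fun z : E => fr i * What z i i) by exact: smooth_le (st2 i).
have sS k : (k <= 2)%N -> smooth k U (fun z : E => \sum_i fr i * What z i i).
  by move=> k2; apply: smooth_sum => // i; exact: smooth_le (st2 i).
have spsi : smooth 2 U psi by apply: smoothB => //; exact: sS.
have [|h1 h2] := min2_dir (v := e_ i1) oU U0 spsi psi0.
  move=> e e0; set C := 6 * n%:R ^+ 2 * (\sum_i fr i) * (n%:R * lam 0 i1).
  have C0 : 0 <= C by rewrite !mulr_ge0 ?(ltW L0)//; apply: sumr_ge0 => i _; exact/ltW/fr0.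
  (* A defect of at most e t^2 / (C + 1) makes the loss C d in [psi_low] at most e t^2, also when C
     = 0. *)
  have e'0 : 0 < e / (C + 1) by rewrite divr_gt0// ltr_wpDl.
  near=> t.
  have Ut : U (t *: e_ i1 + 0) by near: t; exact: near_line.
  apply: le_trans (psi_low Ut (d := e / (C + 1) * t ^+ 2) _).
    rewrite lerN2 -/C mulrA ler_wpM2r ?sqr_ge0// mulrA ler_pdivrMr ?ltr_wpDl//.
    by rewrite mulrC ler_wpM2l ?(ltW e0)// lerDl.
  by near: t; exact: small_along.
have pe : {in U, pd (e_ i1) psi =1 (fun z => \sum_i fr i * mpd i1 What z i i - D i1 beta z)}.
  move=> z /[!inE] Uz; rewrite (spdB _ Uz (sS 1%N isT) sb1) (spd_sum _ Uz _ st1); congr (_ - _).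
  apply: eq_bigr => i _; rewrite (spdMl _ Uz) ?mxE//; exact: smooth_le (sWh i i).
have sdb : smooth 1 U (D i1 beta) by exact: smooth_pd.
have sdw i : smooth 1 U (fun z => mpd i1 What z i i) by apply: msmooth_mpd.
have sdw' i : smooth 1 U (fun z => fr i * mpd i1 What z i i) by apply: smoothM.
split.
  move: h1; rewrite pe ?inE// dWh0 => /eqP; rewrite subr_eq0 => /eqP <-.
  by apply: eq_bigr => i _; rewrite mxE.
move: h2; rewrite (pd_eq_on _ oU pe U0) (spdB _ U0 (smooth_sum _ oU sdw') sdb).
rewrite (spd_sum _ U0 _ sdw') subr_ge0 => /le_trans; apply.
apply: ler_sum => i _; rewrite (spdMl _ U0)//.
have := ddWh0 i; rewrite [LHS]mxE => ->; rewrite !mxE.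
have r (A : E -> 'M[R]_n) : (fun z : E => mpd i1 A z i i) = D i1 (fun z => A z i i).
  by apply/funext => z; rewrite mxE.
by rewrite !r.
Unshelve. all: by end_near. Qed.

(** [commutation] is summed with the positive weights fr_i. At the maximum W_11,ii <= 0, the
    curvature term K (lam_1 - lam_i) is nonnegative, and the terms in a add up to the first
    derivative of beta. *)
Lemma max_principle_inequality : 0 <= K ->
  D i1 (D i1 beta) 0 + 2 * a * D i1 u 0 * D i1 beta 0 <= 0.
Proof.
move=> K0; have [-> h2] := equation_first_second.
have hm := max_first_second.
suff : \sum_i fr i * (D i1 (D i1 (fun z => W z i i)) 0
    - lam 0 i * D i1 (D i1 (fun z => G z i i)) 0)
    + 2 * a * D i1 u 0 * \sum_i fr i * D i1 (fun z => W z i i) 0 <= 0 by lra.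
rewrite mulr_sumr -big_split /=; rewrite -oppr_ge0 -sumrN; apply: sumr_ge0 => i _.
have [d1 d2] := hm i.
have := commutation gG U0 G0 c0 cc su W0 (fun j => (hm j).1) i.
have := hmax i; have := fr0 i; move=> f0 hl c.
have k : 0 <= K * (lam 0 i1 - lam 0 i) by rewrite mulr_ge0// subr_ge0.
rewrite mulrCA -mulrDr -mulrN mulr_ge0 ?(ltW f0)//; lra.
Qed.

End LocalMaximum.

(** * Functions of a point and of fibre variables *)

Section Blocks.
Context {R : realType} {n m : nat}.
Local Notation E := 'rV[R]_n.
Local Notation e_ := (@basis_vec R n).

(** A function of a point and of m fibre variables is encoded as a function of one row of length n +
    m, so that the chain rule for rows applies; the fibre variables are unrestricted. *)
Definition cylinder (U : set E) : set 'rV[R]_(n + m) := [set w | U (lsubmx w)].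

Lemma cylinder_open (U : set E) : open U -> open (cylinder U).
Proof.
move=> oU; apply: open_comp => // w _.
apply: continuous_rV => i; rewrite (_ : (fun y => _) = fun w : 'rV[R]_(n + m) => w 0 (lshift m i)).
  exact: coord_continuous.
by apply/funext => y; rewrite mxE.
Qed.

Lemma smooth_blocks k (U : set E) (f : 'rV[R]_(n + m) -> R) (q : E -> 'rV[R]_m) :
  open U -> (forall j, smooth k U (fun z : E => q z 0 j)) -> smooth k (cylinder U) f ->
  smooth k U (fun z : E => f (row_mx z (q z))).
Proof.
move=> oU sq sf; apply: (smooth_comp (U' := cylinder U) oU _ _ _ sf).
- exact: cylinder_open.
- by move=> z Uz; rewrite /cylinder /= row_mxKl.
move=> i; rewrite -(splitK i); case: (fintype.split i) => j /=.
  rewrite (_ : (fun y => _) = fun z : E => z 0 j); first exact: smooth_coord.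
  by apply/funext => z; rewrite row_mxEl.
rewrite (_ : (fun y => _) = fun z : E => q z 0 j) //.
by apply/funext => z; rewrite row_mxEr.
Qed.

Lemma pd_blocks (U : set E) (f : 'rV[R]_(n + m) -> R) (q : E -> 'rV[R]_m) i z :
  open U -> U z -> (forall j, smooth 1 U (fun z : E => q z 0 j)) -> smooth 1 (cylinder U) f ->
  pd (e_ i) (fun z : E => f (row_mx z (q z))) z =
  pd (basis_vec (lshift m i)) f (row_mx z (q z)) +
  \sum_j pd (e_ i) (fun z : E => q z 0 j) z * pd (basis_vec (rshift n j)) f (row_mx z (q z)).
Proof.
move=> oU Uz sq sf; pose phi (z : E) := row_mx z (q z).
have pl j : (fun y : E => phi y 0 (lshift m j)) = fun y : E => y 0 j.
  by apply/funext => y; rewrite /phi row_mxEl.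
have pr j : (fun y : E => phi y 0 (rshift n j)) = fun y : E => q y 0 j.
  by apply/funext => y; rewrite /phi row_mxEr.
rewrite (_ : (fun z : E => _) = f \o phi)// pd_chain; first last.
- apply: smooth_differentiable sf _; first exact: cylinder_open.
  by rewrite /cylinder /= /phi row_mxKl.
- move=> j; rewrite -(splitK j); case: (fintype.split j) => k /=.
    by rewrite pl; apply: (smooth_derivable (smooth_coord 1 U k)).
  by rewrite pr; apply: (smooth_derivable (sq k)).
rewrite big_split_ord /=; congr (_ + _); last first.
  by apply: eq_bigr => j _; rewrite pr.
rewrite (bigD1 i)//= big1 ?addr0 => [|j ji].
  by rewrite pl pd_coord basis_vecE eqxx mul1r.
by rewrite pl pd_coord basis_vecE (negbTE ji) mul0r.
Qed.

End Blocks.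

Section Gradient.
Context {R : realType} {n : nat}.
Local Notation E := 'rV[R]_n.
Local Notation e_ := (@basis_vec R n).

Definition grad (G : E -> 'M[R]_n) (u : E -> R) (z : E) : E := (dcol u z)^T *m invmx (G z).

Variables (U : set E) (G : E -> 'M[R]_n) (u : E -> R).
Hypotheses (gG : gmetric U G) (su : smooth 4 U u).
Let oU : open U. Proof. by have [] := gG. Qed.
Let sG k : (k <= 3)%N -> msmooth k U G.
Proof. by move=> k3; have [_ _ s] := gG; exact: msmooth_le s. Qed.
Let uG z : U z -> G z \in unitmx.
Proof. by move=> Uz; have [_ p _] := gG; exact/posdef_unit/p. Qed.
Let sVG k : (k <= 3)%N -> msmooth k U (fun z : E => invmx (G z)).
Proof. by move=> k3; apply: msmooth_inv => //; exact: sG. Qed.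
Let sdu k : (k <= 3)%N -> msmooth k U (fun z => (dcol u z)^T).
Proof. by move=> k3; apply: msmooth_tr; apply: dcol_smooth; exact: smooth_le su. Qed.

Lemma grad_smooth k : (k <= 3)%N -> msmooth k U (grad G u).
Proof. by move=> k3; apply: msmoothM => //; [exact: sdu|exact: sVG]. Qed.

Lemma mpd_invmx i z : U z ->
  mpd i (fun z : E => invmx (G z)) z = - (invmx (G z) *m mpd i G z *m invmx (G z)).
Proof.
move=> Uz; have e : {in U, (fun z : E => G z *m invmx (G z)) =1 fun=> 1%:M}.
  by move=> y /[!inE] Uy; rewrite mulmxV// uG.
have := mpd_eq_on oU Uz i e; rewrite mpd_cst (mpdM Uz); [|exact: sG|exact: sVG].
move/(congr1 (mulmx (invmx (G z)))); rewrite mulmx0 mulmxDr !mulmxA mulVmx ?uG// mul1mx.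
by move/eqP; rewrite addrC addr_eq0 => /eqP.
Qed.

(** The left side is the covariant derivative of a vector field in components. Raising an index
    commutes with it because the metric is parallel. *)
Lemma mpd_grad i z : U z ->
  mpd i (grad G u) z + grad G u z *m conn G i z = (covd G i (dcol u) z)^T *m invmx (G z).
Proof.
move=> Uz; rewrite (mpdM Uz); [|exact: sdu|exact: sVG].
rewrite mpd_invmx// (conn_metric gG)// mulmxDr mulmxDl !mulmxA mulVmx ?uG// mul1mx.
rewrite -(mulmxA _ (G z)) mulmxV ?uG// mulmx1 mulmxN mulmxDr !mulmxA -/(grad G u z).
rewrite /covd linearB /= trmx_mul mulmxBl mpd_tr opprD.
by rewrite addrA addrAC subrK.
Qed.

Lemma covd_row i z : (covd G i (dcol u) z)^T = row i (hess G u z).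
Proof. by apply/rowP => j; rewrite !mxE. Qed.

End Gradient.

(** * Derivatives of h along the gradient *)

Section Speed.
Context {R : realType} {n : nat}.
Local Notation E := 'rV[R]_n.
Local Notation e_ := (@basis_vec R n).
Local Notation D := (fun i : 'I_n => pd (e_ i)).
Variables (U : set E) (G : E -> 'M[R]_n) (u : E -> R) (a K : R).
Hypotheses (gG : gmetric U G) (U0 : U 0) (G0 : G 0 = 1%:M).
Hypotheses (c0 : forall i, conn G i 0 = 0) (cc : const_curv U G K) (su : smooth 4 U u).
Local Notation W := (augW G u a K).
Variable i1 : 'I_n.
Hypothesis (dW1 : forall i, D i (fun z => W z i1 i1) 0 = 0).

Variable H : 'rV[R]_(n + n) -> R.
Hypothesis sH : smooth 2 (cylinder U) H.
Hypothesis parH : forall z p i, U z -> pd (basis_vec (lshift n i)) H (row_mx z p) =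
  \sum_k (p *m conn G i z) 0 k * pd (basis_vec (rshift n k)) H (row_mx z p).

Let oU : open U. Proof. by have [] := gG. Qed.
Let P := grad G u.
Let Hp k (z : E) := pd (basis_vec (rshift n k)) H (row_mx z (P z)).
Let eta (z : E) := H (row_mx z (P z)).
Let Q i (z : E) : E := row i (hess G u z) *m invmx (G z).
Let sP k j : (k <= 3)%N -> smooth k U (fun z : E => P z 0 j).
Proof. by move=> k3; exact: (grad_smooth gG su k3 0 j). Qed.
Let sH1 : smooth 1 (cylinder U) H. Proof. exact: smooth_le sH. Qed.
Let suk k : (k <= 4)%N -> smooth k U u. Proof. by move=> k4; exact: smooth_le su. Qed.

Lemma speed_smooth : smooth 2 U eta.
Proof. by apply: smooth_blocks => // j; exact: sP. Qed.

(** The hypothesis [parH] says that H is invariant under parallel transport of p; its horizontal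
    derivative thus completes the derivative of the gradient to a covariant one. *)
Lemma speed_first i z : U z -> pd (e_ i) eta z = \sum_k Q i z 0 k * Hp k z.
Proof.
move=> Uz; rewrite (pd_blocks _ oU Uz) => //; last by move=> j; exact: sP.
rewrite parH// -big_split /=; apply: eq_bigr => k _; rewrite -mulrDl; congr (_ * _).
rewrite /Q -covd_row -(mpd_grad gG su i Uz) -/P mxE_add addrC; congr (_ + _).
by rewrite mxE.
Qed.

Lemma Q0 i k : Q i 0 0 k = D i (D k u) 0.
Proof.
rewrite /Q G0 invmx1 mulmx1 mxE hessE big1 ?subr0// => j _.
by rewrite c0 mxE mul0r.
Qed.

Let sc i j k : smooth 2 U (fun z : E => conn G i z j k).
Proof. exact: conn_smooth gG i j k. Qed.

Lemma dhess0 l i k : D l (fun z => hess G u z i k) 0 =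
  D l (D i (D k u)) 0 - \sum_m D l (fun z => conn G i z k m) 0 * D m u 0.
Proof.
rewrite (_ : (fun z => _) = fun z : E => D i (D k u) z - \sum_m conn G i z k m * D m u z); last first.
  by apply/funext => z; rewrite hessE.
have s m : smooth 1 U (fun z : E => conn G i z k m * D m u z).
  apply: smoothM => //; [exact: smooth_le (sc _ _ _)|apply: smooth_pd; exact: suk].
rewrite (spdB _ U0 _ (smooth_sum _ oU s)); last by do 2 apply: smooth_pd; exact: suk.
rewrite (spd_sum _ U0 _ s); congr (_ - _); apply: eq_bigr => m _.
rewrite (spdM _ U0); [|exact: smooth_le (sc _ _ _)|by apply: smooth_pd; exact: suk].
by rewrite c0 mxE mul0r addr0.
Qed.

(** Commuting covariant derivatives turns u_1k1 into u_11k plus a curvature term, and D_k W_11 = 0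
    rewrites u_11k as -2 a u_1 u_1k. No third derivative of u is left. *)
Lemma dQ0 k : D i1 (fun z => Q i1 z 0 k) 0 =
  K * (D k u 0 - (k == i1)%:R * D i1 u 0) - 2 * a * D i1 u 0 * D i1 (D k u) 0.
Proof.
have sh : msmooth 2 U (hess G u).
  move=> i j; rewrite (_ : (fun z => _) = fun z : E => D i (D j u) z - \sum_m conn G i z j m * D m
    u z); last first.
    by apply/funext => z; rewrite hessE.
  apply: smoothB => //; first by do 2 apply: smooth_pd; exact: suk.
  by apply: smooth_sum => // m; apply: smoothM => //; apply: smooth_pd; exact: suk.
have sG : msmooth 3 U G by have [] := gG.
have sVG : msmooth 1 U (fun z : E => invmx (G z)).
  apply: msmooth_inv => //; last exact: msmooth_le sG.
  by move=> z Uz; have [_ p _] := gG; exact/posdef_unit/p.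
have sr : msmooth 1 U (fun z : E => row i1 (hess G u z)).
  move=> i j; rewrite (_ : (fun z => _) = fun z : E => hess G u z i1 j).
    exact: smooth_le (sh _ _).
  by apply/funext => z; rewrite mxE.
have dG : mpd i1 G 0 = 0 by apply/matrixP => i j; rewrite !mxE (dG0 gG U0 c0).
have -> : D i1 (fun z => Q i1 z 0 k) 0 = D i1 (fun z => hess G u z i1 k) 0.
  have := congr1 (fun A : E => A 0 k) (mpdM U0 i1 sr sVG); rewrite [X in X = _ -> _]mxE => ->.
  rewrite (mpd_invmx gG)// dG mulmx0 mul0mx oppr0 mulmx0 addr0 G0 invmx1 mulmx1 mxE.
  by congr (pd _ _ _); apply/funext => z; rewrite mxE.
have dWk := dW1 k; rewrite (dW a K gG su k i1 U0) (dG0 gG U0 c0) mulr0 addr0 in dWk.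
have cz : \sum_m (D k (fun z => conn G i1 z i1 m) 0 * D m u 0 + conn G i1 0 i1 m * D k (D m u) 0)
   = \sum_m D k (fun z => conn G i1 z i1 m) 0 * D m u 0.
  by apply: eq_bigr => m _; rewrite c0 mxE mul0r addr0.
rewrite cz in dWk.
have sy : \sum_m D i1 (fun z => conn G i1 z k m) 0 * D m u 0 =
    \sum_m D k (fun z => conn G i1 z i1 m) 0 * D m u 0 - K * (D k u 0 - (k == i1)%:R * D i1 u 0).
  transitivity (\sum_m (D k (fun z => conn G i1 z i1 m) 0 * D m u 0 +
      K * ((i1 == k)%:R * ((i1 == m)%:R * D m u 0) - (k == m)%:R * D m u 0))).
    apply: eq_bigr => m _.
    have e : D i1 (fun z => conn G i1 z k m) 0 = D i1 (fun z => conn G k z i1 m) 0.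
      by apply: pd_eq_on U0 => // z /[!inE] Uz; rewrite (conn_sym gG).
    have := curv0 U0 G0 c0 cc i1 k i1 m; rewrite eqxx => c.
    have {}c : D i1 (fun z => conn G k z i1 m) 0 =
       D k (fun z => conn G i1 z i1 m) 0 + K * ((i1 == k)%:R * (i1 == m)%:R - 1 * (k == m)%:R).
      by apply/eqP; rewrite addrC -subr_eq c; apply/eqP; congr (_ * (_ - _)).
    rewrite e c; ring.
  rewrite big_split /= -mulr_sumr sumrB -mulr_sumr.
  have dl (j : 'I_n) : \sum_m (j == m)%:R * D m u 0 = D j u 0.
    rewrite (bigD1 j)//= eqxx mul1r big1 ?addr0// => m mj.
    by rewrite eq_sym (negbTE mj) mul0r.
  rewrite !dl (eq_sym i1 k); ring.
rewrite dhess0 sy.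
have e3 : D i1 (D i1 (D k u)) 0 = D k (D i1 (D i1 u)) 0.
  have s1 : D i1 (D i1 (D k u)) 0 = D i1 (D k (D i1 u)) 0.
    apply: pd_eq_on U0 => // z /[!inE] Uz; apply: (smooth_schwarz _ _ oU _ Uz); exact: suk.
  by rewrite s1; apply: (smooth_schwarz _ _ oU _ U0); apply: smooth_pd; exact: suk.
have e2 : D k (D i1 u) 0 = D i1 (D k u) 0 by apply: (smooth_schwarz _ _ oU _ U0); exact: suk.
rewrite e3; rewrite e2 in dWk; lra.
Qed.

Lemma speed_second : D i1 (D i1 eta) 0 =
  \sum_k (K * (D k u 0 - (k == i1)%:R * D i1 u 0) - 2 * a * D i1 u 0 * D i1 (D k u) 0) * Hp k 0
  + \sum_k \sum_m D i1 (D k u) 0 * D i1 (D m u) 0 *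
     pd (basis_vec (rshift n m)) (pd (basis_vec (rshift n k)) H) (row_mx 0 (P 0)).
Proof.
have e : {in U, D i1 eta =1 (fun z => \sum_k Q i1 z 0 k * Hp k z)}.
  by move=> z /[!inE]; exact: speed_first.
have sHp k : smooth 1 U (Hp k).
  by apply: smooth_blocks => //; [move=> j; exact: sP|exact: smooth_pd].
have sQ k : smooth 1 U (fun z => Q i1 z 0 k).
  have sG : msmooth 3 U G by have [] := gG.
  have sVG : msmooth 1 U (fun z : E => invmx (G z)).
    apply: msmooth_inv => //; last exact: msmooth_le sG.
    by move=> z Uz; have [_ p _] := gG; exact/posdef_unit/p.
  have sr : msmooth 1 U (fun z : E => row i1 (hess G u z)).
    move=> i j; rewrite (_ : (fun z => _) = fun z : E => D i1 (D j u) z - \sum_m conn G i1 z j m *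
      D m u z); last first.
      by apply/funext => z; rewrite mxE hessE.
    apply: smoothB => //; first by do 2 apply: smooth_pd; exact: suk.
    apply: smooth_sum => // m; apply: smoothM => //; first exact: smooth_le (sc _ _ _).
    by apply: smooth_pd; exact: suk.
  exact: (msmoothM oU sr sVG 0 k).
rewrite (pd_eq_on _ oU e U0) (spd_sum _ U0); last by move=> k; apply: smoothM.
rewrite -big_split /=; apply: eq_bigr => k _.
rewrite (spdM _ U0)//; congr (_ + _); first by congr (_ * _); exact: dQ0.
rewrite Q0; under [RHS]eq_bigr do rewrite -mulrA.
rewrite -mulr_sumr; congr (_ * _).
rewrite (pd_blocks _ oU U0) => //; [|by move=> j; exact: sP|exact: smooth_pd].
rewrite (smooth_schwarz _ _ (cylinder_open oU) sH); last by rewrite /cylinder /= row_mxKl.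
(* The mixed derivative vanishes: over the centre the connection is 0, so by [parH] the horizontal
   derivative is 0 at every p, and so is its derivative in p. *)
rewrite [X in X + _](_ : _ = 0) ?add0r; last first.
  rewrite -[row_mx _ _]add0r -[0 + row_mx _ _](_ : 0 *: basis_vec (rshift n k) + row_mx 0 (P 0) =
    _); last by rewrite scale0r.
  rewrite -pd_line (_ : (fun t : R => _) = fun=> 0) ?pd_cst//; apply/funext => t.
  rewrite (_ : _ + _ = row_mx 0 (t *: e_ k + P 0)).
    by rewrite parH// c0 mulmx0 big1// => m _; rewrite mxE mul0r.
  apply/rowP => j; rewrite -(splitK j); case: (fintype.split j) => l /=; rewrite mxE_add mxE_scale basis_vecE.
    by rewrite !row_mxEl eq_lrshift mulr0 add0r.
  by rewrite !row_mxEr mxE_add mxE_scale basis_vecE (inj_eq (@rshift_inj _ _)).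
apply: eq_bigr => m _; congr (_ * _); rewrite -Q0 /Q -covd_row -(mpd_grad gG su i1 U0).
by rewrite c0 mulmx0 addr0 mxE.
Qed.

End Speed.

(** * Bound on the top eigenvalue *)

Section TopEigenvalue.
Context {R : realType}.

(** A bound for lam_1 = u_11 + K + a u_1^2, where x = u_11 satisfies c_inf eps x^2 <= p + q |x| and
    [A] bounds the gradient. The four terms of p come in order from curvature, from the second
    derivative of f(x, u), from the product of first derivatives f_1 h_1, and from 2 a u_1 f_1 h;
    those of q from f_z u_11 and from f_1 h_1. *)
Definition top_bound (n : nat) (a K eps e_sup c_sup c_inf A : R) : R :=
  K + `|a| * A ^+ 2 + 1 + (c_sup * e_sup * (2 * n%:R * K * A + (1 + A) ^+ 2 +
    2 * (1 + A) * (n%:R * (`|a| * A ^+ 2)) + 2 * `|a| * A * (1 + A))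
    + c_sup * e_sup * (1 + 2 * (1 + A))) / (c_inf * eps).

Lemma quadratic_bound (d x p q : R) : 0 < d -> 0 <= p -> 0 <= q ->
  d * x ^+ 2 <= p + q * `|x| -> `|x| <= 1 + (p + q) / d.
Proof.
move=> d0 p0 q0 h; have [x1|x1] := leP `|x| 1.
  by apply: (le_trans x1); rewrite lerDl divr_ge0 ?addr_ge0// ltW.
have x0 : 0 < `|x| by exact: lt_trans x1.
suff : `|x| <= (p + q) / d by move=> k; apply: (le_trans k); rewrite lerDr.
rewrite ler_pdivlMr// -(ler_pM2r x0) mulrDl mulrAC -expr2 real_normK ?num_real// mulrC.
apply: le_trans h _; by rewrite lerD2r ler_peMr// ltW.
Qed.

Lemma norm_mulr_le (x y b c : R) : `|x| <= b -> `|y| <= c -> `|x * y| <= b * c.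
Proof. by move=> xb yc; rewrite normrM ler_pM. Qed.

Context {n : nat}.
Local Notation E := 'rV[R]_n.
Local Notation e_ := (@basis_vec R n).
Local Notation D := (fun i : 'I_n => pd (e_ i)).
Variables (Gam : set E) (F : E -> R) (adm : admissible Gam F).
Variables (U : set E) (G : E -> 'M[R]_n) (u : E -> R) (a K : R).
Hypotheses (gG : gmetric U G) (U0 : U 0) (G0 : G 0 = 1%:M).
Hypotheses (c0 : forall i, conn G i 0 = 0) (cc : const_curv U G K) (su : smooth 4 U u).
Hypothesis K0 : 0 <= K.
Local Notation W := (augW G u a K).
Variables (lam : E) (i1 : 'I_n).
Hypotheses (W0 : W 0 = diag_mx lam) (Gl : Gam lam) (hmax : forall j, lam 0 j <= lam 0 i1).
Hypothesis nsd : forall z, U z -> forall x, bform (W z) x x <= lam 0 i1 * bform (G z) x x.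
Variables (H : 'rV[R]_(n + n) -> R) (Ft : 'rV[R]_(n + 1) -> R).
Hypotheses (sH : smooth 2 (cylinder U) H) (sF : smooth 2 (cylinder U) Ft).
Hypothesis parH : forall z p i, U z -> pd (basis_vec (lshift n i)) H (row_mx z p) =
  \sum_k (p *m conn G i z) 0 k * pd (basis_vec (rshift n k)) H (row_mx z p).
Let eta (z : E) := H (row_mx z (grad G u z)).
Let theta (z : E) := Ft (row_mx z (const_mx (u z))).
Hypothesis eqF : forall z, U z ->
  exists mu, [/\ is_spectrum (invmx (G z) *m W z) mu, Gam mu & F mu = theta z * eta z].

Variables (eps es cs ci A : R).
Hypotheses (eps0 : 0 < eps) (ci0 : 0 < ci).
Hypothesis uA : forall k, `|D k u 0| <= A.
Let w0 : 'rV[R]_(n + n) := row_mx 0 (grad G u 0).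
Let y0 : 'rV[R]_(n + 1) := row_mx 0 (const_mx (u 0)).
Local Notation l_ := (basis_vec (lshift 1 i1)).
Local Notation r_ := (basis_vec (rshift n ord0)).
Hypotheses (H0 : 0 < H w0 <= es)
  (H1 : forall k, `|pd (basis_vec (rshift n k)) H w0| <= es)
  (H2 : forall v : E, eps * sqn v <= \sum_k \sum_m v 0 k * v 0 m *
     pd (basis_vec (rshift n m)) (pd (basis_vec (rshift n k)) H) w0).
Hypotheses (F0 : ci <= Ft y0 <= cs) (Fx : `|pd l_ Ft y0| <= cs) (Fz : `|pd r_ Ft y0| <= cs)
  (Fxx : `|pd l_ (pd l_ Ft) y0| <= cs) (Fxz : `|pd r_ (pd l_ Ft) y0| <= cs)
  (Fzz : `|pd r_ (pd r_ Ft) y0| <= cs).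

Let oU : open U. Proof. by have [] := gG. Qed.
Let suk k : (k <= 4)%N -> smooth k U u. Proof. by move=> k4; exact: smooth_le su. Qed.
Let su1 k j : (k <= 4)%N -> smooth k U (fun z => (const_mx (u z) : 'rV[R]_1) 0 j).
Proof.
move=> k4; rewrite (_ : (fun z => _) = u); first exact: suk.
by apply/funext => z; rewrite mxE.
Qed.
Let stheta : smooth 2 U theta.
Proof. by apply: smooth_blocks => // j; exact: su1. Qed.

Let pd_theta (f : 'rV[R]_(n + 1) -> R) z : U z -> smooth 1 (cylinder U) f ->
  D i1 (fun z : E => f (row_mx z (const_mx (u z)))) z =
  pd l_ f (row_mx z (const_mx (u z))) + D i1 u z * pd r_ f (row_mx z (const_mx (u z))).
Proof.
move=> Uz sf; rewrite [LHS](pd_blocks (q := fun z : E => const_mx (u z)) i1 oU Uz (su1 (k := 1) ^~ isT) sf).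
rewrite big_ord1; congr (_ + _ * _); congr (pd _ _ _).
by apply/funext => x; rewrite mxE.
Qed.

Let theta2 : D i1 (D i1 theta) 0 =
  pd l_ (pd l_ Ft) y0 + 2 * (D i1 u 0 * pd r_ (pd l_ Ft) y0)
  + D i1 u 0 ^+ 2 * pd r_ (pd r_ Ft) y0 + D i1 (D i1 u) 0 * pd r_ Ft y0.
Proof.
have sF1 : smooth 1 (cylinder U) Ft by exact: smooth_le sF.
have e : {in U, D i1 theta =1 (fun z => pd l_ Ft (row_mx z (const_mx (u z)))
   + D i1 u z * pd r_ Ft (row_mx z (const_mx (u z))))}.
  by move=> z /[!inE] Uz; exact: pd_theta.
have sl : smooth 1 (cylinder U) (pd l_ Ft) by exact: smooth_pd.
have sr : smooth 1 (cylinder U) (pd r_ Ft) by exact: smooth_pd.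
have s (f : 'rV[R]_(n + 1) -> R) : smooth 1 (cylinder U) f ->
    smooth 1 U (fun z : E => f (row_mx z (const_mx (u z)))).
  by move=> sf; apply: smooth_blocks => // j; exact: su1.
have su' : smooth 1 U (D i1 u) by apply: smooth_pd; exact: suk.
rewrite (pd_eq_on _ oU e U0) (spdD _ U0 (s _ sl)); last by apply: smoothM => //; exact: s.
rewrite (spdM _ U0 su' (s _ sr)) (pd_theta U0 sl) (pd_theta U0 sr).
rewrite (smooth_schwarz l_ r_ (cylinder_open oU) sF); last by rewrite /cylinder /= row_mxKl.
rewrite -/y0; ring.
Qed.

Lemma top_eigenvalue_le : lam 0 i1 <= top_bound n a K eps es cs ci A.
Proof.
have seta : smooth 2 U eta by exact: speed_smooth.
have cs0 : 0 < cs by move: F0 => /andP[f1 f2]; exact: lt_le_trans (le_trans f1 f2).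
have es0 : 0 < es by move: H0 => /andP[f1 f2]; exact: lt_le_trans f2.
have A0 : 0 <= A by apply: le_trans (uA i1); exact: normr_ge0.
have sb : smooth 2 U (fun z => theta z * eta z) by exact: smoothM.
have main := max_principle_inequality adm gG U0 G0 c0 cc su W0 Gl hmax nsd sb eqF K0.
have dW1 i : D i (fun z => W z i1 i1) 0 = 0.
  by have [] := max_first_second gG U0 G0 c0 su W0 nsd i.
have st1 : smooth 1 U theta by exact: smooth_le stheta.
have se1 : smooth 1 U eta by exact: smooth_le seta.
have std : smooth 1 U (D i1 theta) by exact: smooth_pd.
have sed : smooth 1 U (D i1 eta) by exact: smooth_pd.
have e : {in U, D i1 (fun z => theta z * eta z) =1
    (fun z => D i1 theta z * eta z + theta z * D i1 eta z)}.
  by move=> z /[!inE] Uz; rewrite (spdM _ Uz st1 se1).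
rewrite (pd_eq_on _ oU e U0) (spdD _ U0 (smoothM oU std se1) (smoothM oU st1 sed)) in main.
rewrite (spdM _ U0 std se1) (spdM _ U0 st1 sed) (spdM _ U0 st1 se1) in main.
have t1 : D i1 theta 0 = pd l_ Ft y0 + D i1 u 0 * pd r_ Ft y0.
  by apply: pd_theta => //; exact: smooth_le sF.
have e2 := speed_second gG U0 G0 c0 cc su dW1 sH parH.
have e1 := speed_first gG su sH parH i1 U0.
rewrite -/eta in e1 e2.
set x := D i1 (D i1 u) 0.
have xE : x = lam 0 i1 - K - a * D i1 u 0 ^+ 2.
  by rewrite /x (hess0 G0 c0 W0) eqxx mulr1.
(* Off the diagonal the first row of the Hessian is -a u_1 u_k, so u_11 is the only entry without an
   a priori bound. *)
have vb k : `|D i1 (D k u) 0| <= (k == i1)%:R * `|x| + `|a| * A ^+ 2.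
  have [->|ki] := eqVneq k i1.
    by rewrite mul1r lerDl mulr_ge0 ?sqr_ge0.
  rewrite (hess0 G0 c0 W0) eq_sym (negbTE ki) mulr0 sub0r normrN mul0r add0r.
  by rewrite normrM ler_wpM2l// expr2; exact: norm_mulr_le.
pose Hk k := pd (basis_vec (rshift n k)) H w0.
pose S := \sum_k (D k u 0 - (k == i1)%:R * D i1 u 0) * Hk k.
pose T := \sum_k \sum_m D i1 (D k u) 0 * D i1 (D m u) 0 *
     pd (basis_vec (rshift n m)) (pd (basis_vec (rshift n k)) H) w0.
pose eta1 := \sum_k D i1 (D k u) 0 * Hk k.
have {}e1 : D i1 eta 0 = eta1.
  rewrite e1; apply: eq_bigr => k _; congr (_ * _).
  exact: Q0.
have {}e2 : D i1 (D i1 eta) 0 = K * S - 2 * a * D i1 u 0 * eta1 + T.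
  rewrite e2; congr (_ + _); rewrite /S /eta1 !mulr_sumr -sumrB; apply: eq_bigr => k _.
  rewrite -/(Hk k); ring.
(* Convexity bounds the quadratic term below by eps times the squared first row of the Hessian, of
   which u_11^2 is one summand. *)
have Tge : eps * x ^+ 2 <= T.
  apply: le_trans (_ : eps * sqn (\row_k D i1 (D k u) 0) <= _).
    rewrite ler_pM2l//; have := sqr_coord_le (\row_k D i1 (D k u) 0) i1.
    by rewrite mxE.
  apply: le_trans (H2 _) _; rewrite le_eqVlt; apply/orP; left; apply/eqP.
  by apply: eq_bigr => k _; apply: eq_bigr => m _; rewrite !mxE.
have eta1b : `|eta1| <= es * `|x| + n%:R * (`|a| * A ^+ 2) * es.
  apply: le_trans (ler_norm_sum _ _ _) _.
  have -> : es * `|x| + n%:R * (`|a| * A ^+ 2) * es =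
      \sum_k ((k == i1)%:R * `|x| + `|a| * A ^+ 2) * es.
    rewrite -mulr_suml big_split /= -mulr_suml.
    have -> : \sum_k (k == i1)%:R = 1 :> R.
      rewrite (bigD1 i1)//= eqxx big1 ?addr0// => k ki; by rewrite (negbTE ki).
    rewrite sumr_const card_ord -[_ *+ n]mulr_natl; ring.
  by apply: ler_sum => k _; exact: (norm_mulr_le (vb k) (H1 k)).
have Sb : `|S| <= n%:R * (2 * A * es).
  apply: sum_norm_le => k; apply: norm_mulr_le (H1 k).
  apply: le_trans (ler_normB _ _) _.
  have h : `|(k == i1)%:R * D i1 u 0| <= A.
    by case: (k == i1); rewrite ?mul1r ?mul0r ?normr0.
  by have := uA k; lra.
have t1b : `|D i1 theta 0| <= cs * (1 + A).
  rewrite t1; apply: le_trans (ler_normD _ _) _.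
  have : `|D i1 u 0 * pd r_ Ft y0| <= A * cs by exact: norm_mulr_le.
  by rewrite mulrDr mulr1 (mulrC cs); move: Fx => h1 h2; exact: lerD.
have t2b : `|D i1 (D i1 theta) 0| <= cs * ((1 + A) ^+ 2 + `|x|).
  rewrite theta2 -/x.
  have b1 : `|D i1 u 0 * pd r_ (pd l_ Ft) y0| <= A * cs by exact: norm_mulr_le.
  have b2 : `|D i1 u 0 ^+ 2 * pd r_ (pd r_ Ft) y0| <= A * A * cs.
    by apply: norm_mulr_le => //; rewrite expr2; exact: norm_mulr_le.
  have b3 : `|x * pd r_ Ft y0| <= `|x| * cs by exact: norm_mulr_le.
  apply: le_trans (ler_normD _ _) _; rewrite sqrrD.
  apply: le_trans (lerD (ler_normD _ _) b3) _.
  apply: le_trans (lerD (lerD (ler_normD _ _) b2) (lexx _)) _.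
  rewrite normrM (@ger0_norm _ 2)//.
  move: b1 Fxx; rewrite expr2; nra.
have eb : `|eta 0| <= es by move: H0 => /andP[h1 h2]; rewrite gtr0_norm.
have thb : 0 < theta 0 <= cs.
  by move: F0 => /andP[h1 h2]; rewrite h2 (lt_le_trans ci0).
have thb' : `|theta 0| <= cs by move: thb => /andP[h1 h2]; rewrite gtr0_norm.
rewrite e1 e2 in main.
have r1 : `|D i1 (D i1 theta) 0 * eta 0| <= cs * ((1 + A) ^+ 2 + `|x|) * es by exact: norm_mulr_le.
have r2 : `|D i1 theta 0 * eta1| <= cs * (1 + A) * (es * `|x| + n%:R * (`|a| * A ^+ 2) * es).
  exact: norm_mulr_le.
have r3 : `|a * D i1 u 0 * (D i1 theta 0 * eta 0)| <= `|a| * A * (cs * (1 + A) * es).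
  by apply: norm_mulr_le; exact: norm_mulr_le.
have r4 : `|theta 0 * (K * S)| <= cs * (K * (n%:R * (2 * A * es))).
  by apply: norm_mulr_le => //; apply: norm_mulr_le => //; rewrite ger0_norm.
have r5 : ci * eps * x ^+ 2 <= theta 0 * T.
  rewrite -mulrA; apply: ler_pM => //; [exact: ltW|by rewrite mulr_ge0 ?sqr_ge0// ltW|].
  by case/andP: F0.
pose p := cs * es * (2 * n%:R * K * A + (1 + A) ^+ 2 + 2 * (1 + A) * (n%:R * (`|a| * A ^+ 2))
   + 2 * `|a| * A * (1 + A)).
pose q := cs * es * (1 + 2 * (1 + A)).
have aA : 0 <= `|a| * A ^+ 2 by rewrite mulr_ge0 ?sqr_ge0.
have p0 : 0 <= p.
  rewrite /p mulr_ge0 ?mulr_ge0 ?(ltW cs0) ?(ltW es0)// !addr_ge0//.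
  - by rewrite !mulr_ge0.
  - exact: sqr_ge0.
  - by rewrite !mulr_ge0 ?addr_ge0 ?sqr_ge0.
  - by rewrite !mulr_ge0 ?addr_ge0.
have q0 : 0 <= q.
  by rewrite /q mulr_ge0 ?mulr_ge0 ?(ltW cs0) ?(ltW es0)// addr_ge0 ?mulr_ge0 ?addr_ge0.
(* In [main] the term -2 a u_1 theta eta_1 coming from the second derivative of eta cancels the term
   2 a u_1 theta eta_1 of the first derivative of the product. *)
have key : ci * eps * x ^+ 2 <= p + q * `|x|.
  apply: le_trans r5 _.
  move: r1 r2 r3 r4; rewrite !ler_norml => /andP[r1 _] /andP[r2 _] /andP[r3 _] /andP[r4 _].
  rewrite /p /q; lra.
have := quadratic_bound (mulr_gt0 ci0 eps0) p0 q0 key.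
rewrite /top_bound -/p -/q => h.
have h2 : a * D i1 u 0 ^+ 2 <= `|a| * A ^+ 2.
  apply: le_trans (ler_norm _) _; apply: norm_mulr_le => //.
  by rewrite !expr2; exact: norm_mulr_le.
have := ler_norm x; rewrite {1}xE; lra.
Qed.

End TopEigenvalue.

(** * Charts *)

Section Norms.
Context {R : realType} {n : nat}.
Implicit Types (g J B : 'M[R]_n) (w : 'rV[R]_n).

Lemma invmx_congr g J : J \in unitmx -> g \in unitmx ->
  invmx (J *m g *m J^T) = invmx J^T *m invmx g *m invmx J.
Proof.
move=> uJ ug; have uJT : J^T \in unitmx by rewrite unitmx_tr.
have h : invmx J^T *m invmx g *m invmx J *m (J *m g *m J^T) = 1%:M.
  rewrite !mulmxA mulmxKV// -(mulmxA (invmx J^T)) mulVmx// mulmx1 mulVmx//.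
have u : J *m g *m J^T \in unitmx by rewrite !unitmx_mul uJ ug.
by rewrite -[RHS](mulmxK u) h mul1mx.
Qed.

Lemma covec_norm_congr g J w : J \in unitmx -> g \in unitmx ->
  covec_norm (J *m g *m J^T) (w *m J^T) = covec_norm g w.
Proof.
move=> uJ ug; have uJT : J^T \in unitmx by rewrite unitmx_tr.
rewrite /covec_norm invmx_congr// trmx_mul trmxK !mulmxA mulmxK//.
by rewrite mulmxKV.
Qed.

Lemma tensor_norm_congr g J B : J \in unitmx -> g \in unitmx ->
  tensor_norm (J *m g *m J^T) (J *m B *m J^T) = tensor_norm g B.
Proof.
move=> uJ ug; have uJT : J^T \in unitmx by rewrite unitmx_tr.
rewrite /tensor_norm invmx_congr// !trmx_mul trmxK !mulmxA.
by rewrite mulmxKV// (mulmxK uJT) mulmxKV// mxtrace_mulC !mulmxA mulmxV// mul1mx.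
Qed.

Lemma covec_norm1 w : covec_norm 1%:M w = Num.sqrt (sqn w).
Proof. by rewrite /covec_norm invmx1 mulmx1 -bform1 /bform mulmx1. Qed.

Lemma coord_le_covec_norm w i : `|w 0 i| <= covec_norm 1%:M w.
Proof. by rewrite covec_norm1 -sqrtr_sqr ler_sqrt ?sqn_ge0// sqr_coord_le. Qed.

Lemma tensor_norm1 B : tensor_norm 1%:M B = Num.sqrt (\sum_i \sum_j B i j ^+ 2).
Proof.
rewrite /tensor_norm invmx1 mulmx1 mul1mx /mxtrace; congr Num.sqrt.
by apply: eq_bigr => i _; rewrite mxE; apply: eq_bigr => j _; rewrite mxE expr2.
Qed.

Lemma entry_le_tensor_norm B i j : `|B i j| <= tensor_norm 1%:M B.
Proof.
have h (k : 'I_n) : 0 <= \sum_j B k j ^+ 2 by apply: sumr_ge0 => l _; exact: sqr_ge0.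
rewrite tensor_norm1 -sqrtr_sqr ler_sqrt; last by apply: sumr_ge0.
rewrite (bigD1 i)//= (bigD1 j)//= -addrA lerDl addr_ge0//.
  by apply: sumr_ge0 => l _; exact: sqr_ge0.
by apply: sumr_ge0.
Qed.

Lemma tensor_norm1_le B b : 0 <= b -> (forall i j, `|B i j| <= b) -> tensor_norm 1%:M B <= n%:R * b.
Proof.
move=> b0 hb; rewrite tensor_norm1.
have nb : 0 <= n%:R * b by rewrite mulr_ge0.
rewrite -[leRHS]ger0_norm// -sqrtr_sqr ler_sqrt ?sqr_ge0//.
have -> : (n%:R * b) ^+ 2 = n%:R * (n%:R * b ^+ 2) by ring.
have h (k : 'I_n) : `|\sum_j B k j ^+ 2| <= n%:R * b ^+ 2.
  apply: sum_norm_le => j; rewrite normrX !expr2; exact: ler_pM.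
by apply: le_trans (ler_norm _) _; apply: sum_norm_le => i; exact: h.
Qed.

(* |x_i x_j| <= (x_i^2 + x_j^2) / 2 *)
Lemma bform_norm_le B w (e : R) : (forall i j, `|B i j| <= e) -> `|bform B w w| <= n%:R * e * sqn w.
Proof.
move=> hB; have [->|w0] := eqVneq w 0.
  by rewrite bform0 normr0 /sqn big1 ?mulr0// => i _; rewrite mxE expr0n.
have h i j : `|w 0 i * B i j * w 0 j| <= e * ((w 0 i ^+ 2 + w 0 j ^+ 2) / 2).
  rewrite mulrAC normrM mulrC; apply: ler_pM => //.
  rewrite normrM -(real_normK (num_real (w 0 i))) -(real_normK (num_real (w 0 j))).
  have := sqr_ge0 (`|w 0 i| - `|w 0 j|); rewrite sqrrB; lra.
rewrite bformE; apply: le_trans (ler_norm_sum _ _ _) _.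
apply: le_trans (ler_sum _ (fun i _ => ler_norm_sum _ _ _)) _.
apply: le_trans (ler_sum _ (fun i _ => ler_sum _ (fun j _ => h i j))) _.
rewrite le_eqVlt; apply/orP; left; apply/eqP.
under eq_bigr do rewrite -mulr_sumr -mulr_suml big_split /= sumr_const card_ord.
rewrite -mulr_sumr -mulr_suml big_split /= sumr_const card_ord sumrMnl /sqn.
set s := \sum_i _; have -> : s *+ n = n%:R * s by rewrite mulr_natl.
by field.
Qed.

End Norms.

Section LinearPullback.
Context {R : realType} {n : nat}.
Local Notation E := 'rV[R]_n.
Local Notation e_ := (@basis_vec R n).

Lemma partialsE (f : E -> R) y i : partials f y 0 i = pd (e_ i) f y.
Proof. by rewrite mxE pdxE. Qed.

Lemma partials2E (f : E -> R) y i j : partials2 f y i j = pd (e_ i) (pd (e_ j) f) y.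
Proof. by rewrite mxE pdxE pdE. Qed.

Lemma pd_mulmx (q : E -> R) (J : 'M[R]_n) v p :
  pd v (fun p : E => q (p *m J)) p = pd (v *m J) q (p *m J).
Proof.
rewrite (_ : (fun p : E => q (p *m J)) = q \o (mulmxr J))//.
by rewrite (@pd_affine _ _ _ _ (mulmxr J) (mulmxr J))// => h x y /=; rewrite mulmxDl -scalemxAl.
Qed.

Lemma partials_mulmx (q : E -> R) (J : 'M[R]_n) p : smooth 2 setT q ->
  partials (fun p : E => q (p *m J)) p = partials q (p *m J) *m J^T.
Proof.
move=> sq; apply/rowP => i; rewrite partialsE pd_mulmx pd_basis; last first.
  exact: smooth_differentiable openT sq _.
by rewrite mxE; apply: eq_bigr => k _; rewrite partialsE mulrC -rowE !mxE.
Qed.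

Lemma partials2_mulmx (q : E -> R) (J : 'M[R]_n) p : smooth 2 setT q ->
  partials2 (fun p : E => q (p *m J)) p = J *m partials2 q (p *m J) *m J^T.
Proof.
move=> sq; apply/matrixP => i j; rewrite partials2E.
have -> : pd (e_ j) (fun p : E => q (p *m J)) = fun p : E => pd (e_ j *m J) q (p *m J).
  by apply/funext => x; rewrite pd_mulmx.
rewrite pd_mulmx pd_basis; last first.
  exact: smooth_differentiable openT (smooth_pd _ sq) _.
have ej m l : (e_ m *m J) 0 l = J m l by rewrite mxE; exact: sum_basis.
rewrite -mulmxA [RHS]mxE; apply: eq_bigr => k _; congr (_ * _); first exact: ej.
rewrite (_ : pd (e_ j *m J) q = fun x : E => \sum_m J j m * pd (e_ m) q x); last first.
  apply/funext => x; rewrite pd_basis; last exact: smooth_differentiable openT sq _.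
  by apply: eq_bigr => m _; rewrite ej.
have s m : smooth 1 setT (pd (e_ m) q) by exact: smooth_pd.
rewrite (spd_sum (U := setT) _ I _ (fun m => smoothM openT (smooth_cst 1 setT (J j m)) (s m))).
by rewrite mxE; apply: eq_bigr => m _; rewrite (spdMl (U := setT) _ I)// partials2E mxE mulrC.
Qed.

End LinearPullback.

Section VectorValued.
Context {R : realType} {n : nat} {V : normedModType R}.

Lemma differentiable_components (phi : V -> 'rV[R]_n) x :
  (forall i, differentiable (fun y => phi y 0 i) x) -> differentiable phi x.
Proof.
move=> h; have -> : phi = \sum_(i < n) (fun y => phi y 0 i *: @basis_vec R n i).
  apply/funext => y; rewrite fct_sumE; exact: row_basis.
by apply: differentiable_sum => i; exact: differentiableZl.
Qed.

End VectorValued.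

(** Both matrices act on rows from the right, so no transposition intervenes. *)
Lemma jacobian_jac (R : realType) n (U : set 'rV[R]_n) (phi : 'rV[R]_n -> 'rV[R]_n) y :
  open U -> U y -> (forall i, smooth 1 U (fun x => phi x 0 i)) -> 'J phi y = jac phi y.
Proof.
move=> oU Uy sp; have dp : differentiable phi y.
  by apply: differentiable_components => i; exact: smooth_differentiable oU (sp i) Uy.
apply/matrixP => a i; rewrite [RHS]mxE -(sum_basis (fun k => 'J phi y k i)).
have := deriveEjacobian (basis_vec a) dp => /(congr1 (fun w : 'rV[R]_n => w 0 i)).
rewrite [RHS]mxE => <-.
have [|_ ->] := @derive_rV _ _ _ phi y (basis_vec a); last by rewrite mxE pdxE.
  by move=> k; exact: smooth_derivable (sp k) Uy.
Qed.

Section Charts.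
Context {R : realType} {n : nat} (M : riemannianManifold R n).
Implicit Types (c : chart M) (x : M) (A : set M).
Local Notation E := 'rV[R]_n.
Local Notation e_ := (@basis_vec R n).

Definition img c A : set E := local_coord c @` (dom c `&` A).

Lemma img_point c A x : dom c x -> A x -> img c A (local_coord c x).
Proof. by move=> dx Ax; exists x. Qed.

Lemma cinv_cts c y : (local_coord c @` dom c) y -> {for y, continuous (cinv c)}.
Proof.
move=> h; have := @cinv_continuous _ _ M c.
rewrite (continuous_open_subspace _ (@image_open _ _ M c)) => /(_ y); apply; exact/mem_set.
Qed.

Lemma img_open c A : open A -> open (img c A).
Proof.
move=> oA; rewrite openE => y iy; have [x [dx Ax] xy] := iy.
have Vy : (local_coord c @` dom c) y by exists x.
have hV : nbhs y (local_coord c @` dom c) by apply: open_nbhs_nbhs; split => //; exact: image_open.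
have hA : nbhs y (cinv c @^-1` A).
  apply: cinv_cts => //; apply: open_nbhs_nbhs; split => //.
  by rewrite -xy local_coordK.
rewrite /interior; apply: filterS2 hV hA => z [w dw <-] /= Aw.
by exists w => //; split=> //; rewrite local_coordK// in Aw.
Qed.

Lemma img_sub c A : img c A `<=` local_coord c @` dom c.
Proof. by move=> y [x [dx _] <-]; exists x. Qed.

Lemma metric_gm c : gmetric (local_coord c @` dom c) (metric c).
Proof.
split; first exact: image_open.
  move=> y [x dx <-]; split; first exact: metric_symmetric.
  by move=> v v0; exact: metric_pos.
by move=> i j; rewrite smoothE; exact: metric_smooth.
Qed.

Lemma christoffel_conn c y k i j : (local_coord c @` dom c) y ->
  christoffel c y k i j = conn (metric c) i y j k.
Proof.
move=> Vy; have [_ pG _] := metric_gm c; have [sG _] := pG _ Vy.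
rewrite unlock /christoffel !mxE mulr_sumr; apply: eq_bigr => l _; rewrite !mxE !pdxE.
have -> : invmx (metric c y) l k = invmx (metric c y) k l.
  by rewrite -[in LHS]sG -trmx_inv mxE.
by rewrite mulrA mulrAC.
Qed.

Lemma riemann_curv c y l k i j : (local_coord c @` dom c) y ->
  riemann c y l k i j = curv (metric c) i j y k l.
Proof.
move=> Vy; have oV := @image_open _ _ M c.
rewrite /riemann /curv !(mxE_add, mxE_opp) !pdxE; congr (_ - _ + _).
- rewrite mxE; apply: pd_eq_on oV _ Vy => z /[!inE] Vz; exact: christoffel_conn.
- rewrite mxE; apply: pd_eq_on oV _ Vy => z /[!inE] Vz; exact: christoffel_conn.
rewrite !mxE -sumrB; apply: eq_bigr => m _; rewrite !christoffel_conn//.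
Qed.

(** For independent vectors the Gram determinant is nonzero, so the denominator of the sectional
    curvature can be cleared. *)
Lemma const_curv_chart K c : constant_sectional_curvature M K ->
  const_curv (local_coord c @` dom c) (metric c) K.
Proof.
move=> hK; apply: const_curv_of_sectional (metric_gm c) _ => y p v Vy rf.
have [x dx xy] := Vy; have [_ pG _] := metric_gm c.
have := hK c x p v dx rf; rewrite xy /sectional_curvature => <-.
rewrite -!/(bform _ _ _) divfK; last first.
  by apply/eqP => h; move: rf; apply/negP; exact: cauchy_strict (pG _ Vy) h.
rewrite /curv_tensor; apply: eq_bigr => i _; apply: eq_bigr => j _.
rewrite bformE mulr_sumr; apply: eq_bigr => k _; rewrite mulr_sumr.
rewrite exchange_big /=; apply: eq_bigr => m _; rewrite mxE mulr_sumr mulr_suml mulr_sumr.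
apply: eq_bigr => l _; rewrite -riemann_curv//; ring.
Qed.

Lemma gmetric_sub (U U' : set E) (G : E -> 'M[R]_n) : open U' -> U' `<=` U ->
  gmetric U G -> gmetric U' G.
Proof.
move=> oU' UU' [oU pG sG]; split=> //; first by move=> y /UU'; exact: pG.
exact: msmooth_sub UU' sG.
Qed.

Lemma conn_congr (U : set E) (G G' : E -> 'M[R]_n) i y : open U -> U y -> {in U, G =1 G'} ->
  conn G i y = conn G' i y.
Proof.
move=> oU Uy e; rewrite unlock e ?inE//; congr (_ *m _).
have h a j k : pd (e_ a) (fun z : E => G z j k) y = pd (e_ a) (fun z : E => G' z j k) y.
  by apply: pd_eq_on oU _ Uy => z zU; rewrite e.
by apply/matrixP => j l; rewrite !mxE !h.
Qed.

Lemma hess_congr (U : set E) (G G' : E -> 'M[R]_n) (u u' : E -> R) y : open U -> U y ->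
  {in U, G =1 G'} -> {in U, u =1 u'} -> hess G u y = hess G' u' y.
Proof.
move=> oU Uy eG eu; apply/matrixP => i j; rewrite !hessE.
have h k z : U z -> pd (e_ k) u z = pd (e_ k) u' z by move=> Uz; exact: pd_eq_on oU eu Uz.
rewrite (conn_congr i oU Uy eG); congr (_ - _).
  by apply: pd_eq_on oU _ Uy => z /[!inE] Uz; exact: h.
by apply: eq_bigr => k _; rewrite h.
Qed.

Lemma partials_dcol (v : E -> R) y : partials v y = (dcol v y)^T.
Proof. by apply/rowP => i; rewrite partialsE !mxE. Qed.

Lemma cov_hessian_hess c y (v : E -> R) : (local_coord c @` dom c) y ->
  cov_hessian c y (partials v y) (partials2 v y) = hess (metric c) v y.
Proof.
move=> Vy; apply/matrixP => i j; rewrite hessE /cov_hessian mxE_add mxE_opp partials2E; congr (_ - _).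
by rewrite summxE; apply: eq_bigr => k _; rewrite mxE_scale partialsE christoffel_conn// mulrC.
Qed.

Section Transition.
Variables c c' : chart M.

Definition transition (y : E) : E := local_coord c' (cinv c y).
Local Notation tr := transition.

Lemma transition_pt x : dom c x -> tr (local_coord c x) = local_coord c' x.
Proof. by move=> dx; rewrite /tr local_coordK. Qed.

Lemma smooth_transition k A i : smooth k (img c (dom c' `&` A)) (fun y => tr y 0 i).
Proof.
have : smooth k (img c (dom c')) (fun y => tr y 0 i).
  by rewrite smoothE; exact: transition_smooth.
by apply: smooth_sub => y [x [dx [dx' _]] <-]; exists x.
Qed.

Lemma transition_img A y : img c (dom c' `&` A) y -> img c' A (tr y).
Proof. by move=> [x [dx [dx' Ax]] <-]; rewrite transition_pt//; exists x. Qed.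

Lemma jacobian_transition A y : open A -> img c (dom c' `&` A) y ->
  'J (local_coord c' \o cinv c) y = jac tr y.
Proof.
move=> oA iy; apply: (jacobian_jac (U := img c (dom c' `&` A))) => //.
  by apply: img_open; apply: openI => //; exact: dom_open.
by move=> i; exact: smooth_transition.
Qed.

(** It exhibits the metric of one chart as the pullback of that of another, so that the
    transformation laws for pullbacks yield independence of the chart. *)
Lemma metric_transition y : img c (dom c') y ->
  metric c y = jac tr y *m metric c' (tr y) *m (jac tr y)^T.
Proof.
move=> iy; have [x [dx dx'] xy] := iy.
have := metric_change dx dx'; rewrite /= xy -(jacobian_transition openT); last by rewrite setIT.
by have -> : tr y = local_coord c' x by rewrite -xy transition_pt.
Qed.

Lemma transition_unit y : img c (dom c') y -> jac tr y \in unitmx.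
Proof.
move=> iy; have [_ pG _] := metric_gm c.
have /posdef_unit : posdef (metric c y) by apply: pG; exact: img_sub iy.
by rewrite (metric_transition iy) !unitmx_mul => /andP[/andP[]].
Qed.

Variables (A : set M) (v : M -> R).
Hypothesis oA : open A.
Let U := img c (dom c' `&` A).
Let oU : open U.
Proof. by apply: img_open; apply: openI => //; exact: dom_open. Qed.
Let Udom y : U y -> img c (dom c') y.
Proof. by move=> [x [dx [dx' _]] <-]; exists x. Qed.

Let vE : {in U, v \o cinv c =1 (fun y => (v \o cinv c') (tr y))}.
Proof.
move=> y; rewrite inE => -[x [dx [dx' Ax]] <-] /=.
by rewrite transition_pt// !local_coordK.
Qed.

Let gA : gmetric (img c' A) (metric c').
Proof. by apply: gmetric_sub (metric_gm c'); [exact: img_open|exact: img_sub]. Qed.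

Lemma partials_transition y : U y -> smooth 1 (img c' A) (v \o cinv c') ->
  partials (v \o cinv c) y = partials (v \o cinv c') (tr y) *m (jac tr y)^T.
Proof.
move=> Uy sv; rewrite !partials_dcol -trmx_mul; congr trmx.
have -> : dcol (v \o cinv c) y = dcol (fun y => (v \o cinv c') (tr y)) y.
  by apply/matrixP => i j; rewrite !mxE; exact: pd_eq_on oU vE Uy.
apply: (dcol_pullback gA oU (@transition_img A) _ Uy sv).
exact: smooth_transition.
Qed.

Lemma cov_hessian_transition y : U y -> smooth 2 (img c' A) (v \o cinv c') ->
  cov_hessian c y (partials (v \o cinv c) y) (partials2 (v \o cinv c) y) =
  jac tr y *m cov_hessian c' (tr y) (partials (v \o cinv c') (tr y)) (partials2 (v \o cinv c') (tr y))
    *m (jac tr y)^T.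
Proof.
move=> Uy sv; have UV y' : U y' -> (local_coord c @` dom c) y' by exact: img_sub.
have V'y : (local_coord c' @` dom c') (tr y) by have /transition_img/img_sub := Uy.
rewrite !cov_hessian_hess//; last exact: UV.
have mE : {in U, metric c =1 (fun y => jac tr y *m metric c' (tr y) *m (jac tr y)^T)}.
  by move=> z /[!inE] Uz; apply: metric_transition; exact: Udom.
rewrite (hess_congr oU Uy mE vE).
apply: (hess_pullback gA oU (@transition_img A) _ _ Uy sv).
  exact: smooth_transition.
by move=> z Uz; apply: transition_unit; exact: Udom.
Qed.

End Transition.

End Charts.

Lemma continuous_pair (T U V : topologicalType) (f : T -> U) (g : T -> V) :
  continuous f -> continuous g -> continuous (fun x => (f x, g x)).
Proof. by move=> cf cg x; exact: cvg_pair (cf x) (cg x). Qed.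

Section Slices.
Context {R : realType} {n m : nat}.
Local Notation E := 'rV[R]_n.

Lemma row_mx_line_l i (t : R) (y : E) (s : 'rV[R]_m) :
  t *: basis_vec (lshift m i) + row_mx y s = row_mx (t *: basis_vec i + y) s.
Proof.
apply/rowP => j; rewrite -(splitK j); case: (fintype.split j) => l /=; rewrite mxE_add mxE_scale basis_vecE.
  by rewrite !row_mxEl mxE_add mxE_scale basis_vecE (inj_eq (@lshift_inj _ _)).
by rewrite !row_mxEr eq_rlshift mulr0 add0r.
Qed.

Lemma row_mx_line_r k (t : R) (y : E) (s : 'rV[R]_m) :
  t *: basis_vec (rshift n k) + row_mx y s = row_mx y (t *: basis_vec k + s).
Proof.
apply/rowP => j; rewrite -(splitK j); case: (fintype.split j) => l /=; rewrite mxE_add mxE_scale basis_vecE.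
  by rewrite !row_mxEl eq_lrshift mulr0 add0r.
by rewrite !row_mxEr mxE_add mxE_scale basis_vecE (inj_eq (@rshift_inj _ _)).
Qed.

Lemma pd_slice_l i (g : 'rV[R]_(n + m) -> R) (y : E) (s : 'rV[R]_m) :
  pd (basis_vec (lshift m i)) g (row_mx y s) = pd (basis_vec i) (fun y : E => g (row_mx y s)) y.
Proof.
rewrite -[row_mx y s]add0r -{1}(scale0r (basis_vec (lshift m i))) -pd_line.
rewrite -[in RHS](add0r y) -{1}(scale0r (basis_vec i)) -pd_line.
by congr (pd _ _ _); apply/funext => t; rewrite row_mx_line_l.
Qed.

Lemma pd_slice_r k (g : 'rV[R]_(n + m) -> R) (y : E) (s : 'rV[R]_m) :
  pd (basis_vec (rshift n k)) g (row_mx y s) = pd (basis_vec k) (fun s : 'rV[R]_m => g (row_mx y s)) s.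
Proof.
rewrite -[row_mx y s]add0r -{1}(scale0r (basis_vec (rshift n k))) -pd_line.
rewrite -[in RHS](add0r s) -{1}(scale0r (basis_vec k)) -pd_line.
by congr (pd _ _ _); apply/funext => t; rewrite row_mx_line_r.
Qed.

Lemma smooth_slice_l k (U : set E) (f : 'rV[R]_(n + m) -> R) s : open U ->
  smooth k (cylinder U) f -> smooth k U (fun y : E => f (row_mx y s)).
Proof. by move=> oU sf; apply: (smooth_blocks (q := fun=> s)) => // j; exact: smooth_cst. Qed.

Lemma smooth_slice_r k (U : set E) (f : 'rV[R]_(n + m) -> R) y : open U -> U y ->
  smooth k (cylinder U) f -> smooth k setT (fun s : 'rV[R]_m => f (row_mx y s)).
Proof.
move=> oU Uy sf; apply: (smooth_comp (U' := cylinder U) openT _ _ _ sf).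
- exact: cylinder_open.
- by move=> s _; rewrite /cylinder /= row_mxKl.
move=> i; rewrite -(splitK i); case: (fintype.split i) => j /=.
  rewrite (_ : (fun=> _) = fun=> y 0 j); first exact: smooth_cst.
  by apply/funext => z; rewrite row_mxEl.
rewrite (_ : (fun=> _) = fun z : 'rV[R]_m => z 0 j); first exact: smooth_coord.
by apply/funext => z; rewrite row_mxEr.
Qed.

Lemma continuous_lsubmx : continuous (@lsubmx R 1 n m).
Proof.
move=> w; apply: continuous_rV => i.
rewrite (_ : (fun y => _) = fun w : 'rV[R]_(n + m) => w 0 (lshift m i)).
  exact: coord_continuous.
by apply/funext => y; rewrite mxE.
Qed.

Lemma continuous_rsubmx : continuous (@rsubmx R 1 n m).
Proof.
move=> w; apply: continuous_rV => i.
rewrite (_ : (fun y => _) = fun w : 'rV[R]_(n + m) => w 0 (rshift n i)).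
  exact: coord_continuous.
by apply/funext => y; rewrite mxE.
Qed.

End Slices.

(** * The data f and h in charts *)

Section PointValue.
Context {R : realType} {n : nat} (M : riemannianManifold R n).
Implicit Types (c : chart M) (x : M).
Local Notation E := 'rV[R]_n.
Local Notation e_ := (@basis_vec R n).
Variable f : M -> R -> R.
Hypothesis sf : C2_point_value f.

Definition fhat c (w : 'rV[R]_(n + 1)) : R := f (cinv c (lsubmx w)) (rsubmx w 0 0).

Lemma fhatE c y z : fhat c (row_mx y (const_mx z)) = f (cinv c y) z.
Proof. by rewrite /fhat row_mxKl row_mxKr mxE. Qed.

Lemma smooth_fhat c : smooth 2 (cylinder (local_coord c @` dom c)) (fhat c).
Proof.
pose L (w : 'rV[R]_(n + 1)) : E * R := (lsubmx w, rsubmx w 0 0).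
have cL : continuous L.
  apply: continuous_pair; first exact: continuous_lsubmx.
  move=> w; apply: (@continuous_comp _ _ _ rsubmx (fun s : 'rV[R]_1 => s 0 0)).
    exact: continuous_rsubmx.
  exact: coord_continuous.
have aL (t : R) (v w : 'rV[R]_(n + 1)) : L (t *: v + w) = t *: L v + L w.
  by rewrite /L; congr (_, _); rewrite !linearD !linearZ //= !mxE.
have := sf c; rewrite -smoothE => /(smooth_comp_affine cL aL); exact.
Qed.

Local Notation r_ := (basis_vec (rshift n (ord0 : 'I_1))).
Local Notation l_ i := (basis_vec (lshift 1 i)).

Lemma pd_const_row (g : R -> R) z :
  pd (basis_vec (ord0 : 'I_1)) (fun s : 'rV[R]_1 => g (s 0 0)) (const_mx z) = derive1 g z.
Proof.
rewrite derive1E pdxE (_ : (fun s : 'rV[R]_1 => _) = g \o (fun s : 'rV[R]_1 => s 0 0))//.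
rewrite (@pd_affine _ _ _ _ (fun s : 'rV[R]_1 => s 0 0) (fun s : 'rV[R]_1 => s 0 0)).
  by rewrite basis_vecE eqxx mxE.
by move=> h v x; rewrite mxE_add mxE_scale.
Qed.

Lemma fhat_l c y z i :
  pd (l_ i) (fhat c) (row_mx y (const_mx z)) = pd (e_ i) (fun y => f (cinv c y) z) y.
Proof.
by rewrite pd_slice_l; congr (pd _ _ _); apply/funext => x; rewrite fhatE.
Qed.

Lemma fhat_r c y z : pd r_ (fhat c) (row_mx y (const_mx z)) = derive1 (f (cinv c y)) z.
Proof.
rewrite pd_slice_r -pd_const_row; congr (pd _ _ _); apply/funext => s.
by rewrite /fhat row_mxKl row_mxKr.
Qed.

Lemma fhat_ll c y z i j : pd (l_ i) (pd (l_ j) (fhat c)) (row_mx y (const_mx z)) =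
  pd (e_ i) (pd (e_ j) (fun y => f (cinv c y) z)) y.
Proof.
by rewrite pd_slice_l; congr (pd _ _ _); apply/funext => x; rewrite fhat_l.
Qed.

Lemma fhat_lr c y z i : pd (l_ i) (pd r_ (fhat c)) (row_mx y (const_mx z)) =
  pd (e_ i) (fun y => derive1 (f (cinv c y)) z) y.
Proof.
by rewrite pd_slice_l; congr (pd _ _ _); apply/funext => x; rewrite fhat_r.
Qed.

Lemma row1_const (s : 'rV[R]_1) : s = const_mx (s 0 0).
Proof. by apply/rowP => i; rewrite mxE ord1. Qed.

Lemma fhat_rr c y z : pd r_ (pd r_ (fhat c)) (row_mx y (const_mx z)) = derive1n 2 (f (cinv c y)) z.
Proof.
rewrite pd_slice_r derive1nS -pd_const_row; congr (pd _ _ _); apply/funext => s.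
by rewrite [s in LHS]row1_const fhat_r.
Qed.

Let V c := local_coord c @` dom c.

Lemma smooth_f_slice c z : smooth 2 (V c) (fun y => f (cinv c y) z).
Proof.
rewrite (_ : (fun y => _) = fun y : E => fhat c (row_mx y (const_mx z))).
  by apply: smooth_slice_l; [exact: image_open|exact: smooth_fhat].
by apply/funext => y; rewrite fhatE.
Qed.

Lemma smooth_df_slice c z : smooth 1 (V c) (fun y => derive1 (f (cinv c y)) z).
Proof.
rewrite (_ : (fun y => _) = fun y : E => pd r_ (fhat c) (row_mx y (const_mx z))).
  apply: smooth_slice_l; [exact: image_open|apply: smooth_pd; exact: smooth_fhat].
by apply/funext => y; rewrite fhat_r.
Qed.

Lemma img_setT c : img c [set: M] = V c.
Proof. by rewrite /img setIT. Qed.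

(** The suprema run over all pairs of a point and a chart around it. Independence of the chart is
    what allows a bound in one chart near each point to control them. *)
Lemma f_jet_norm_indep c c' x z : dom c x -> dom c' x -> f_jet_norm f c x z = f_jet_norm f c' x z.
Proof.
move=> dx dx'; rewrite /f_jet_norm.
have iy : img c (dom c' `&` setT) (local_coord c x) by rewrite setIT; exact: img_point.
have iy' : img c (dom c') (local_coord c x) by exact: img_point.
have tE := transition_pt c' dx.
have s1 : smooth 2 (img c' setT) ((f^~ z) \o cinv c') by rewrite img_setT; exact: smooth_f_slice.
have s2 : smooth 1 (img c' setT) ((fun x => derive1 (f x) z) \o cinv c').
  by rewrite img_setT; exact: smooth_df_slice.
have p1 := partials_transition openT iy (smooth_le (isT : (1 <= 2)%N) s1).
have p2 := partials_transition openT iy s2.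
have p3 := cov_hessian_transition openT iy s1.
have uJ := transition_unit iy'.
have ug : metric c' (local_coord c' x) \in unitmx.
  by have [_ pG _] := metric_gm c'; apply/posdef_unit/pG; exists x.
have mE := metric_transition iy'.
rewrite tE in p1 p2 p3 mE.
rewrite [cov_hessian c _ _ _]p3 [partials (fun y' => f (cinv c y') z) _]p1.
rewrite [partials (fun y' => derive1 (f (cinv c y')) z) _]p2 mE.
by rewrite !(covec_norm_congr _ uJ ug) (tensor_norm_congr _ uJ ug).
Qed.

End PointValue.

Section TangentFunction.
Context {R : realType} {n : nat} (M : riemannianManifold R n).
Implicit Types (c : chart M) (x : M).
Local Notation E := 'rV[R]_n.
Local Notation e_ := (@basis_vec R n).
Variable h : chart M -> 'rV[R]_n -> 'rV[R]_n -> R.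
Hypotheses (th : tangent_function h) (sh : C2_tangent h).

Definition hhat c (w : 'rV[R]_(n + n)) : R := h c (lsubmx w) (rsubmx w).

Lemma hhatE c y p : hhat c (row_mx y p) = h c y p.
Proof. by rewrite /hhat row_mxKl row_mxKr. Qed.

Lemma smooth_hhat c : smooth 2 (cylinder (local_coord c @` dom c)) (hhat c).
Proof.
pose L (w : 'rV[R]_(n + n)) : E * E := (lsubmx w, rsubmx w).
have cL : continuous L.
  by apply: continuous_pair; [exact: continuous_lsubmx|exact: continuous_rsubmx].
have aL (t : R) (v w : 'rV[R]_(n + n)) : L (t *: v + w) = t *: L v + L w.
  by rewrite /L; congr (_, _); rewrite !linearD !linearZ.
have := sh c; rewrite -smoothE => /(smooth_comp_affine cL aL); exact.
Qed.

Lemma hhat_r c y p k : pd (basis_vec (rshift n k)) (hhat c) (row_mx y p) = pd (e_ k) (h c y) p.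
Proof.
by rewrite pd_slice_r; congr (pd _ _ _); apply/funext => s; rewrite hhatE.
Qed.

Lemma hhat_rr c y p k l : pd (basis_vec (rshift n k)) (pd (basis_vec (rshift n l)) (hhat c)) (row_mx y p)
  = pd (e_ k) (pd (e_ l) (h c y)) p.
Proof.
by rewrite pd_slice_r; congr (pd _ _ _); apply/funext => s; rewrite hhat_r.
Qed.

Lemma hhat_l c y p k : pd (basis_vec (lshift n k)) (hhat c) (row_mx y p) =
  pd (e_ k) (fun y => h c y p) y.
Proof.
by rewrite pd_slice_l; congr (pd _ _ _); apply/funext => s; rewrite hhatE.
Qed.

Lemma smooth_h_slice c x : dom c x -> smooth 2 setT (h c (local_coord c x)).
Proof.
move=> dx; rewrite (_ : h c _ = fun p : E => hhat c (row_mx (local_coord c x) p)).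
  apply: (smooth_slice_r (U := local_coord c @` dom c)); [exact: image_open|by exists x|].
  exact: smooth_hhat.
by apply/funext => p; rewrite hhatE.
Qed.

Lemma h_transition c c' x : dom c x -> dom c' x ->
  h c (local_coord c x) =
  fun p => h c' (local_coord c' x) (p *m jac (transition c c') (local_coord c x)).
Proof.
move=> dx dx'; apply/funext => p; rewrite (th _ dx dx').
by rewrite (jacobian_transition openT)// setIT; exact: img_point.
Qed.

(** The fibre coordinate p transforms linearly, so the derivatives in p form a covector and a
    bilinear form without any connection term. *)
Lemma h_jet_norm_indep c c' x p : dom c x -> dom c' x ->
  h_jet_norm h c x p = h_jet_norm h c' x (p *m jac (transition c c') (local_coord c x)).
Proof.
move=> dx dx'; rewrite /h_jet_norm (h_transition dx dx').
have iy' : img c (dom c') (local_coord c x) by exact: img_point.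
have uJ := transition_unit iy'.
have ug : metric c' (local_coord c' x) \in unitmx.
  by have [_ pG _] := metric_gm c'; apply/posdef_unit/pG; exists x.
have mE := metric_transition iy'; rewrite (transition_pt c' dx) in mE.
have s := smooth_h_slice dx'.
rewrite (partials_mulmx _ _ s) (partials2_mulmx _ _ s) mE (covec_norm_congr _ uJ ug).
by rewrite (tensor_norm_congr _ uJ ug).
Qed.

End TangentFunction.

Lemma smooth_lsubmx (R : realType) n m k (U : set 'rV[R]_n) (q : 'rV[R]_n -> R) : smooth k U q ->
  smooth k (cylinder U) (fun w : 'rV[R]_(n + m) => q (lsubmx w)).
Proof.
move=> sq; apply: (smooth_comp_affine (@continuous_lsubmx R n m) (l := lsubmx)) sq.
by move=> t b b'; rewrite linearD linearZ.
Qed.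

Lemma summand_le (R : realType) (r b c d e s : R) :
  0 <= r -> 0 <= b -> 0 <= c -> 0 <= d -> 0 <= e -> 0 <= s ->
  [/\ r <= r + b + c + d + e + s, b <= r + b + c + d + e + s, c <= r + b + c + d + e + s &
    [/\ d <= r + b + c + d + e + s, e <= r + b + c + d + e + s & s <= r + b + c + d + e + s]].
Proof. by move=> *; split; last split; lra. Qed.

(** * Passage to normal coordinates at the maximum point *)

Section Pullbacks.
Context {R : realType} {n : nat}.
Local Notation E := 'rV[R]_n.
Local Notation e_ := (@basis_vec R n).
Variables (U U' : set E) (G : E -> 'M[R]_n) (phi : E -> E).
Hypotheses (gG : gmetric U' G) (oU : open U) (UU' : forall z, U z -> U' (phi z)).
Hypothesis sp : forall i, smooth 4 U (fun x : E => phi x 0 i).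
Hypothesis uJ : forall z, U z -> jac phi z \in unitmx.
Local Notation G' := (fun z : E => jac phi z *m G (phi z) *m (jac phi z)^T).
Let uG y : U' y -> G y \in unitmx.
Proof. by move=> Uy; have [_ p _] := gG; exact/posdef_unit/p. Qed.
Let oU' : open U'. Proof. by have [] := gG. Qed.

Lemma augW_pullback u a K z : U z -> smooth 2 U' u ->
  augW G' (fun x : E => u (phi x)) a K z = jac phi z *m augW G u a K (phi z) *m (jac phi z)^T.
Proof.
move=> Uz su; rewrite /augW (hess_pullback gG oU UU' sp uJ Uz su).
rewrite (dcol_pullback gG oU UU' sp Uz) ?trmx_mul; last exact: smooth_le su.
by rewrite !mulmxDr !mulmxDl -!scalemxAr -!scalemxAl !mulmxA.
Qed.

Lemma grad_pullback u z : U z -> smooth 1 U' u ->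
  grad G' (fun x : E => u (phi x)) z *m jac phi z = grad G u (phi z).
Proof.
move=> Uz su; have uJz := uJ Uz; have uJT : (jac phi z)^T \in unitmx by rewrite unitmx_tr.
rewrite /grad (dcol_pullback gG oU UU' sp Uz su) trmx_mul invmx_congr ?uG//; last exact: UU'.
by rewrite !mulmxA mulmxKV// mulmxK.
Qed.

Lemma spectrum_pullback (B : 'M[R]_n) mu z : U z -> is_spectrum (invmx (G (phi z)) *m B) mu ->
  is_spectrum (invmx (G' z) *m (jac phi z *m B *m (jac phi z)^T)) mu.
Proof.
move=> Uz; have uJz := uJ Uz; have uJT : (jac phi z)^T \in unitmx by rewrite unitmx_tr.
rewrite /is_spectrum => <-; rewrite invmx_congr ?uG//; last exact: UU'.
rewrite !mulmxA mulmxKV// -[RHS](@char_poly_similar _ _ _ (invmx (jac phi z)^T)) ?unitmx_inv//.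
by rewrite invmxK !mulmxA.
Qed.

Variable y0 : E.
Hypotheses (U0 : U 0) (phi0 : phi 0 = y0) (G0 : G' 0 = 1%:M) (c0 : forall i, conn G' i 0 = 0).

(** Where the metric is the identity, a partial derivative is a component in an orthonormal frame,
    hence at most the invariant norm. *)
Lemma normal_first w i : smooth 1 U' w ->
  `|pd (e_ i) (fun x : E => w (phi x)) 0| <= covec_norm (G y0) (partials w y0).
Proof.
move=> sw; have /matrixP/(_ i 0) := dcol_pullback gG oU UU' sp U0 sw; rewrite mxE => ->.
rewrite -phi0 -(covec_norm_congr _ (uJ U0) (uG (UU' U0))) G0 partials_dcol -trmx_mul.
have := coord_le_covec_norm (jac phi 0 *m dcol w (phi 0))^T i.
by rewrite mxE.
Qed.

(** The connection vanishes at 0, so second partial derivatives are entries of the covariant Hessian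
    in an orthonormal frame. *)
Lemma normal_second w i j : smooth 2 U' w ->
  `|pd (e_ i) (pd (e_ j) (fun x : E => w (phi x))) 0| <= tensor_norm (G y0) (hess G w y0).
Proof.
move=> sw; have /matrixP/(_ i j) := hess_pullback gG oU UU' sp uJ U0 sw.
rewrite hessE big1 ?subr0 => [->|k _]; last by rewrite c0 mxE mul0r.
rewrite -phi0 -(tensor_norm_congr _ (uJ U0) (uG (UU' U0))).
by rewrite G0; exact: entry_le_tensor_norm.
Qed.

End Pullbacks.

Section InteriorMaximum.
Context {R : realType} {n : nat} (M : riemannianManifold R n).
Local Notation E := 'rV[R]_n.
Local Notation e_ := (@basis_vec R n).
Variables (K : R) (Gam : set E) (F : E -> R) (a eps : R).
Variables (f : M -> R -> R) (h : chart M -> E -> E -> R).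
Hypotheses (K0 : 0 <= K) (hK : constant_sectional_curvature M K) (adm : admissible Gam F).
Hypotheses (sf : C2_point_value f) (f0 : forall x z, 0 < f x z).
Hypotheses (sh : C2_tangent h) (xh : x_independent h).
Hypotheses (h0 : forall c x p, dom c x -> 0 < h c (local_coord c x) p).
Hypotheses (eps0 : 0 < eps) (ch : uniformly_convex_in_p h eps).
Variables (Omega : set M) (u : M -> R) (c : chart M).
Hypotheses (oO : open Omega) (su : smooth 4 (img c Omega) (u \o cinv c)).
Local Notation v := (u \o cinv c).
Local Notation g := (metric c).
Local Notation W := (augW g v a K).
Local Notation U' := (img c Omega).
Hypothesis eqW : forall y, U' y -> exists lam,
  [/\ is_spectrum (invmx (g y) *m W y) lam, Gam lam &
      F lam = f (cinv c y) (v y) * h c y (grad g v y)].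
Variable L : R.
Hypothesis maxW : forall y, U' y -> forall x, bform (W y) x x <= L * bform (g y) x x.

Let gU' : gmetric U' g.
Proof. by apply: gmetric_sub (metric_gm c); [exact: img_open|exact: img_sub]. Qed.
Let V := local_coord c @` dom c.
Let oV : open V. Proof. exact: image_open. Qed.

Lemma hhat_parallel y p i : V y -> pd (basis_vec (lshift n i)) (hhat h c) (row_mx y p) =
  \sum_k (p *m conn g i y) 0 k * pd (basis_vec (rshift n k)) (hhat h c) (row_mx y p).
Proof.
move=> Vy; have [x dx xy] := Vy.
have := xh p i dx; rewrite /= xy => /eqP; rewrite subr_eq0 pdxE hhat_l => /eqP ->.
apply: eq_bigr => k _; rewrite -mulr_suml hhat_r pdxE; congr (_ * _); rewrite mxE.
by apply: eq_bigr => j _; rewrite christoffel_conn// mulrC.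
Qed.

Section NormalChart.
Variables (U : set E) (phi : E -> E).
Hypotheses (oU : open U) (U0 : U 0) (UU' : forall z, U z -> U' (phi z)).
Hypothesis sp : forall i k, smooth k U (fun x : E => phi x 0 i).
Hypothesis uJ : forall z, U z -> jac phi z \in unitmx.
Local Notation G' := (fun z : E => jac phi z *m g (phi z) *m (jac phi z)^T).
Let UV z : U z -> V (phi z). Proof. by move=> Uz; exact: img_sub (UU' Uz). Qed.

(** The right block holds vector components in the new coordinates; the Jacobian pushes them forward
    to the chart. *)
Definition pull_h (w : 'rV[R]_(n + n)) : R :=
  hhat h c (row_mx (phi (lsubmx w)) (rsubmx w *m jac phi (lsubmx w))).

Definition pull_f (w : 'rV[R]_(n + 1)) : R := fhat f c (row_mx (phi (lsubmx w)) (rsubmx w)).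

Let smooth_row (m m' : nat) k (q : 'rV[R]_(n + m) -> 'rV[R]_m') i :
  (forall j, smooth k (cylinder U) (fun w : 'rV[R]_(n + m) => q w 0 j)) ->
  smooth k (cylinder U) (fun w : 'rV[R]_(n + m) => row_mx (phi (lsubmx w)) (q w) 0 i).
Proof.
move=> sq; rewrite -(splitK i); case: (fintype.split i) => j /=.
  rewrite (_ : (fun w => _) = fun w : 'rV[R]_(n + m) => phi (lsubmx w) 0 j).
    exact: (smooth_lsubmx m (sp j k)).
  by apply/funext => w; rewrite row_mxEl.
rewrite (_ : (fun w => _) = fun w : 'rV[R]_(n + m) => q w 0 j)//.
by apply/funext => w; rewrite row_mxEr.
Qed.

Lemma smooth_pull_h : smooth 2 (cylinder U) pull_h.
Proof.
apply: (smooth_comp (U' := cylinder V) (cylinder_open oU) (cylinder_open oV) _ _ (smooth_hhat sh c)).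
  by move=> w Uw; rewrite /cylinder /= row_mxKl; exact: UV.
move=> i; apply: smooth_row => j.
rewrite (_ : (fun w => _) = fun w : 'rV[R]_(n + n) => \sum_k w 0 (rshift n k) * jac phi (lsubmx w) k j).
  apply: smooth_sum => [|k]; first exact: cylinder_open.
  apply: smoothM; [exact: cylinder_open|exact: smooth_coord|].
  by apply: (smooth_lsubmx n (q := fun z : E => jac phi z k j)); apply: jac_smooth => l; exact: sp.
by apply/funext => w; rewrite mxE; apply: eq_bigr => k _; rewrite mxE.
Qed.

Lemma smooth_pull_f : smooth 2 (cylinder U) pull_f.
Proof.
apply: (smooth_comp (U' := cylinder V) (cylinder_open oU) (cylinder_open oV) _ _ (smooth_fhat sf c)).
  by move=> w Uw; rewrite /cylinder /= row_mxKl; exact: UV.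
move=> i; apply: smooth_row => j.
rewrite (_ : (fun w => _) = fun w : 'rV[R]_(n + 1) => w 0 (rshift n j)); first exact: smooth_coord.
by apply/funext => w; rewrite mxE.
Qed.

Lemma pull_hE z p : pull_h (row_mx z p) = h c (phi z) (p *m jac phi z).
Proof. by rewrite /pull_h row_mxKl row_mxKr hhatE. Qed.

Lemma pull_fE z s : pull_f (row_mx z (const_mx s)) = f (cinv c (phi z)) s.
Proof. by rewrite /pull_f row_mxKl row_mxKr fhatE. Qed.

Let sh_ z : U z -> smooth 2 setT (h c (phi z)).
Proof. by move=> Uz; have [x dx <-] := UV Uz; exact: smooth_h_slice. Qed.

Lemma pull_h_r z p m : U z -> pd (basis_vec (rshift n m)) pull_h (row_mx z p) =
  \sum_k jac phi z m k * pd (e_ k) (h c (phi z)) (p *m jac phi z).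
Proof.
move=> Uz; rewrite pd_slice_r.
rewrite (_ : (fun s => _) = fun p : E => h c (phi z) (p *m jac phi z)); last first.
  by apply/funext => q; rewrite pull_hE.
rewrite pd_mulmx pd_basis; last exact: smooth_differentiable openT (sh_ Uz) _.
by apply: eq_bigr => k _; congr (_ * _); rewrite mxE; exact: sum_basis.
Qed.

(** Through the parallel condition in the chart, the derivative of [phi] contributes p J Abar; the
    derivative of the pushed forward vector contributes p dJ. By the gauge law their sum is p conn'
    J, with conn' the connection of the pulled back metric. *)
Lemma pull_h_parallel z p i : U z -> pd (basis_vec (lshift n i)) pull_h (row_mx z p) =
  \sum_k (p *m conn G' i z) 0 k * pd (basis_vec (rshift n k)) pull_h (row_mx z p).
Proof.
move=> Uz; rewrite pd_slice_l.
pose Phi (z : E) : 'rV[R]_(n + n) := row_mx (phi z) (p *m jac phi z).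
rewrite (_ : (fun y => _) = hhat h c \o Phi); last first.
  by apply/funext => y; rewrite pull_hE /= hhatE.
have sJ : msmooth 1 U (jac phi) by apply: jac_smooth => l; exact: sp.
have sPhi j : smooth 1 U (fun y : E => (p *m jac phi y) 0 j).
  have -> : (fun y : E => (p *m jac phi y) 0 j) = fun y : E => \sum_k p 0 k * jac phi y k j.
    by apply/funext => y; rewrite mxE.
  by apply: smooth_sum => // k; apply: smoothM => //; exact: smooth_cst.
have el j : (fun y : E => Phi y 0 (lshift n j)) = fun y : E => phi y 0 j.
  by apply/funext => y; rewrite /Phi row_mxEl.
have er j : (fun y : E => Phi y 0 (rshift n j)) = fun y : E => (p *m jac phi y) 0 j.
  by apply/funext => y; rewrite /Phi row_mxEr.
rewrite pd_chain; first last.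
- apply: smooth_differentiable (smooth_hhat sh c) _; first exact: cylinder_open.
  by rewrite /cylinder /= row_mxKl; exact: UV.
- move=> j; rewrite -(splitK j); case: (fintype.split j) => k /=.
    by rewrite el; exact: smooth_derivable (sp k 1) Uz.
  by rewrite er; exact: smooth_derivable (sPhi k) Uz.
rewrite big_split_ord /=.
set q := p *m jac phi z; pose hp k := pd (e_ k) (h c (phi z)) q.
have e1 : \sum_j pd (e_ i) (fun y : E => Phi y 0 (lshift n j)) z *
    pd (basis_vec (lshift n j)) (hhat h c) (Phi z) =
    \sum_k (q *m \sum_j jac phi z i j *: conn g j (phi z)) 0 k * hp k.
  have PhiE : Phi z = row_mx (phi z) q by [].
  under eq_bigr => j _ do rewrite el PhiE (hhat_parallel _ _ (UV Uz)).
  under [RHS]eq_bigr => k _ do rewrite mulmx_sumr summxE mulr_suml.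
  rewrite exchange_big /=; apply: eq_bigr => j _; rewrite mulr_sumr; apply: eq_bigr => k _.
  rewrite -scalemxAr mxE_scale hhat_r -/q -/(hp k) mulrA; congr (_ * _ * _).
  by rewrite mxE.
have e2 : \sum_j pd (e_ i) (fun y : E => Phi y 0 (rshift n j)) z *
    pd (basis_vec (rshift n j)) (hhat h c) (Phi z) =
    \sum_k (p *m mpd i (jac phi) z) 0 k * hp k.
  apply: eq_bigr => k _; rewrite er hhat_r -/q -/(hp k); congr (_ * _).
  have := congr1 (fun A : E => A 0 k) (mpdM Uz i (msmooth_cst U 1 p) sJ).
  by rewrite mpd_cst mul0mx add0r [LHS]mxE.
rewrite [X in X + _]e1 [X in _ + X]e2 -big_split /=.
have /= cp := conn_pullback gU' oU UU' (sp ^~ 4) uJ i Uz.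
pose Q := p *m conn G' i z.
transitivity (\sum_k (Q *m jac phi z) 0 k * hp k).
  apply: eq_bigr => k _; rewrite -mulrDl; congr (_ * _).
  have -> : Q *m jac phi z = p *m (mpd i (jac phi) z + jac phi z *m \sum_j jac phi z i j *: conn g j (phi z)).
    by rewrite /Q -mulmxA cp.
  by rewrite mulmxDr mulmxA mxE_add addrC.
transitivity (\sum_k \sum_m Q 0 m * (jac phi z m k * hp k)).
  apply: eq_bigr => k _; rewrite mxE mulr_suml; apply: eq_bigr => m _; exact: esym (mulrA _ _ _).
rewrite exchange_big /=; apply: eq_bigr => m _; rewrite -mulr_sumr -/(Q 0 m); congr (_ * _).
by rewrite pull_h_r.
Qed.

End NormalChart.

(** The normal coordinates start from the frame [V0] that diagonalizes the metric and W together at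
    the point. The invariant bounds on u, f and h then become bounds on partial derivatives at 0. *)
Lemma interior_top_le x0 (es cs ci A : R) : dom c x0 -> Omega x0 ->
  (exists2 xi, xi != 0 &
    L * bform (g (local_coord c x0)) xi xi <= bform (W (local_coord c x0)) xi xi) ->
  covec_norm (g (local_coord c x0)) (partials v (local_coord c x0)) <= A ->
  h_jet_norm h c x0 (grad g v (local_coord c x0)) <= es ->
  f_jet_norm f c x0 (u x0) <= cs -> 0 < ci -> ci <= f x0 (u x0) ->
  L <= top_bound n a K eps es cs ci A.
Proof.
move=> dx0 Ox0; set y0 := local_coord c x0 => -[xi xi0 hxi] hA hes hcs ci0 hci.
have Uy0 : U' y0 by exact: img_point.
have Vy0 : V y0 by exact: img_sub Uy0.
have cy0 : cinv c y0 = x0 by rewrite local_coordK.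
have oU' : open U' by exact: img_open.
have [_ pG _] := gU'; have pg := pG _ Uy0.
have [V0 [lam [VG VW]]] := simdiag pg (augW_sym a K gU' su Uy0).
have uV0 : V0 \in unitmx.
  by have := @unitmx1 R n; rewrite -VG !unitmx_mul => /andP[/andP[]].
have [U [phi [[oU U0] [phi0 UU'] sp [J0 uJ] c0]]] := normal_coordinates gU' Uy0 VG.
pose G' z := jac phi z *m g (phi z) *m (jac phi z)^T.
have sp4 i : smooth 4 U (fun x : E => phi x 0 i) by [].
have gG' : gmetric U G' := pullback_metric gU' oU UU' sp4 uJ.
have G0 : G' 0 = 1%:M by rewrite /G' J0 phi0.
have hcc : const_curv V g K := @const_curv_chart _ _ _ K c hK.
have cc : const_curv U G' K.
  apply: (const_curv_pullback gU' oU UU' sp4 uJ) => y Uy.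
  exact: (hcc y (img_sub Uy)).
pose v' (z : E) := v (phi z).
have sv' : smooth 4 U v' by apply: (smooth_comp oU oU' UU' _ su).
have su2 : smooth 2 U' v by exact: smooth_le su.
have WE' z : U z -> augW G' v' a K z = jac phi z *m W (phi z) *m (jac phi z)^T.
  move=> Uz; exact: (augW_pullback gU' oU UU' sp4 uJ a K Uz su2).
have W0 : augW G' v' a K 0 = diag_mx lam by rewrite WE'// J0 phi0.
have Gl : Gam lam.
  have [mu [smu Gmu _]] := eqW Uy0.
  have [s ->] := is_spectrum_uniq smu (is_spectrum_frame (posdef_unit pg) VG VW).
  by have [] := F_sym_perm adm s Gmu.
have bf (B : 'M[R]_n) (x : E) : bform B x x = bform (V0 *m B *m V0^T) (x *m invmx V0) (x *m invmx V0).
  by rewrite -bform_mul mulmxKV.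
set xi' := xi *m invmx V0 in bf.
have xi'0 : xi' != 0.
  by apply/eqP => e; move/eqP: xi0; apply; rewrite -[xi](mulmxKV uV0) -/xi' e mul0mx.
have dg : bform (diag_mx lam) xi' xi' = \sum_i lam 0 i * xi' 0 i ^+ 2.
  rewrite bformE; apply: eq_bigr => i _; rewrite (bigD1 i)//= big1 ?addr0 => [|j ji].
    have -> : diag_mx lam i i = lam 0 i by rewrite mxE eqxx.
    ring.
  have -> : diag_mx lam i j = 0 by rewrite mxE eq_sym (negbTE ji).
  by rewrite mulr0 mul0r.
have n0 : (0 < n)%N.
  by case: (n) xi xi0 {hxi bf xi' xi'0 dg} => // x; rewrite [x]thinmx0 eqxx.
have [i1 hi1] : exists i1, forall j, lam 0 j <= lam 0 i1.
  have [s hs] := sort_perm (lam 0).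
  have hn : (n.-1 < n)%N by rewrite prednK.
  exists (s (Ordinal hn)) => j; rewrite -{1}(permKV s j); apply: hs => /=.
  by rewrite -ltnS prednK.
(* The vector xi gives L <= lam_1 and [maxW] gives the converse. So L is the top eigenvalue at the
   point, and [maxW] is the comparison with lam_1 g required at all points of the coordinate
   neighbourhood. *)
have Lle : L <= lam 0 i1.
  move: hxi; rewrite (bf (g y0)) (bf (W y0)) VG VW bform1 dg => hxi.
  rewrite -(ler_pM2r (sqn_gt0 xi'0)); apply: le_trans hxi _.
  by rewrite /sqn mulr_sumr; apply: ler_sum => i _; rewrite ler_wpM2r ?sqr_ge0.
have gL : lam 0 i1 <= L.
  have := maxW Uy0 (row i1 V0).
  have r (A' : 'M[R]_n) : bform A' (row i1 V0) (row i1 V0) = (V0 *m A' *m V0^T) i1 i1.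
    by rewrite rowE bform_mul bform_delta.
  by rewrite !r VG VW !mxE eqxx !mulr1n mulr1.
have LE : L = lam 0 i1 by apply/eqP; rewrite eq_le Lle.
have nsd z : U z -> forall x, bform (augW G' v' a K z) x x <= lam 0 i1 * bform (G' z) x x.
  by move=> Uz x; rewrite WE'// /G' -!bform_mul -LE; apply: maxW; exact: UU'.
have sH := smooth_pull_h oU UU' sp.
have sF := smooth_pull_f oU UU' sp.
have parH z p i : U z -> _ := @pull_h_parallel U phi oU UU' sp uJ z p i.
have grE z : U z -> grad G' v' z *m jac phi z = grad g v (phi z).
  move=> Uz; apply: (grad_pullback gU' oU UU' sp4 uJ Uz); exact: smooth_le su.
have eqF z : U z -> exists mu, [/\ is_spectrum (invmx (G' z) *m augW G' v' a K z) mu, Gam mu &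
    F mu = pull_f phi (row_mx z (const_mx (v' z))) * pull_h phi (row_mx z (grad G' v' z))].
  move=> Uz; have [mu [smu Gmu Fmu]] := eqW (UU' _ Uz); exists mu; split=> //.
    by rewrite WE'//; exact: (spectrum_pullback gU' UU' uJ Uz smu).
  by rewrite pull_fE pull_hE grE.
have v'0 : v' 0 = u x0 by rewrite /v' phi0 /= cy0.
have gr0 : grad G' v' 0 *m V0 = grad g v y0 by rewrite -J0 grE// phi0.
have ug0 : g y0 \in unitmx by exact: posdef_unit.
have cv (w : E) : covec_norm (g y0) w = covec_norm 1%:M (w *m V0^T).
  by rewrite -VG covec_norm_congr.
have cvn0 (G1 : 'M[R]_n) (w : E) : 0 <= covec_norm G1 w by exact: sqrtr_ge0.
have tn0 (G1 B : 'M[R]_n) : 0 <= tensor_norm G1 B by exact: sqrtr_ge0.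
set p0 := grad g v y0 in hes gr0.
have shp : smooth 2 setT (h c y0) by exact: smooth_h_slice.
have Hr k : pd (basis_vec (rshift n k)) (pull_h phi) (row_mx 0 (grad G' v' 0)) =
    partials (fun p : E => h c y0 (p *m V0)) (grad G' v' 0) 0 k.
  rewrite partialsE pd_slice_r; congr (pd _ _ _); apply/funext => s.
  by rewrite pull_hE phi0 J0.
have Hrr k m : pd (basis_vec (rshift n m)) (pd (basis_vec (rshift n k)) (pull_h phi))
    (row_mx 0 (grad G' v' 0)) = partials2 (fun p : E => h c y0 (p *m V0)) (grad G' v' 0) m k.
  rewrite partials2E pd_slice_r; congr (pd _ _ _); apply/funext => s.
  rewrite pd_slice_r; congr (pd _ _ _); apply/funext => s'.
  by rewrite pull_hE phi0 J0.
have pfr z s : pd (basis_vec (rshift n ord0)) (pull_f phi) (row_mx z (const_mx s)) =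
    derive1 (f (cinv c (phi z))) s.
  rewrite pd_slice_r -pd_const_row; congr (pd _ _ _); apply/funext => s'.
  by rewrite [s' in LHS]row1_const pull_fE.
have pfrr z s : pd (basis_vec (rshift n ord0)) (pd (basis_vec (rshift n ord0)) (pull_f phi))
    (row_mx z (const_mx s)) = derive1n 2 (f (cinv c (phi z))) s.
  rewrite pd_slice_r derive1nS -pd_const_row; congr (pd _ _ _); apply/funext => s'.
  by rewrite [s' in LHS]row1_const pfr.
have sfz s : smooth 2 U' (fun y => f (cinv c y) s).
  by apply: smooth_sub (smooth_f_slice sf c s); exact: img_sub.
have sdf s : smooth 1 U' (fun y => derive1 (f (cinv c y)) s).
  by apply: smooth_sub (smooth_df_slice sf c s); exact: img_sub.
have pl k z s : pd (basis_vec (lshift 1 k)) (pull_f phi) (row_mx z (const_mx s)) =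
    pd (e_ k) (fun z : E => f (cinv c (phi z)) s) z.
  by rewrite pd_slice_l; congr (pd _ _ _); apply/funext => z'; rewrite pull_fE.
have fpos := f0 x0 (u x0).
have [jF jx jz [jxx jxz jzz]] := summand_le (ltW fpos)
  (cvn0 (g y0) (partials (fun y => f (cinv c y) (u x0)) y0)) (normr_ge0 (derive1 (f x0) (u x0)))
  (tn0 (g y0) (cov_hessian c y0 (partials (fun y => f (cinv c y) (u x0)) y0)
     (partials2 (fun y => f (cinv c y) (u x0)) y0)))
  (cvn0 (g y0) (partials (fun y => derive1 (f (cinv c y)) (u x0)) y0))
  (normr_ge0 (derive1n 2 (f x0) (u x0))).
have hpos : 0 < h c y0 p0 by exact: h0.
rewrite LE; apply: (top_eigenvalue_le adm gG' U0 G0 c0 cc sv' K0 W0 Gl hi1 nsd sH sF parH eqF) => //.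
- move=> k; apply: le_trans _ hA.
  apply: (normal_first gU' oU UU' sp4 uJ U0 phi0 G0); exact: smooth_le su.
- rewrite pull_hE phi0 J0 gr0 hpos /=; apply: le_trans hes.
  by rewrite /h_jet_norm -addrA lerDl addr_ge0.
- move=> k; rewrite Hr partials_mulmx// gr0.
  apply: le_trans (coord_le_covec_norm _ k) _; rewrite -cv; apply: le_trans hes.
  by rewrite /h_jet_norm -/y0 [_ + covec_norm _ _]addrC -addrA lerDl addr_ge0// ltW.
- move=> w; have := ch p0 (w *m V0) dx0; rewrite -/y0 /inner -!/(bform _ _ _) !bform_mul VG bform1.
  move=> hw; apply: (le_trans hw); rewrite -gr0 -partials2_mulmx// bformE exchange_big /=.
  rewrite le_eqVlt; apply/orP; left; apply/eqP.
  apply: eq_bigr => k _; apply: eq_bigr => m _; rewrite Hrr; ring.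
- by rewrite pull_fE v'0 phi0 cy0 hci /=; exact: le_trans hcs.
- rewrite v'0 pl; apply: le_trans (le_trans jx hcs).
  apply: (normal_first gU' oU UU' sp4 uJ U0 phi0 G0 (w := fun y => f (cinv c y) (u x0))).
  exact: smooth_le (sfz (u x0)).
- by rewrite v'0 pfr phi0 cy0; exact: le_trans hcs.
- rewrite v'0 pd_slice_l; under [X in pd _ X]eq_fun do rewrite pl.
  apply: le_trans (normal_second gU' oU UU' sp4 uJ U0 phi0 G0 c0 i1 i1 (sfz (u x0))) _.
  by rewrite -(cov_hessian_hess _ Vy0); exact: le_trans jxx hcs.
- rewrite v'0 (smooth_schwarz _ _ (cylinder_open oU) sF); last by rewrite /cylinder /= row_mxKl.
  rewrite pd_slice_l; under [X in pd _ X]eq_fun do rewrite pfr.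
  apply: le_trans (le_trans jxz hcs).
  exact: (normal_first gU' oU UU' sp4 uJ U0 phi0 G0 i1 (sdf (u x0))).
- by rewrite v'0 pfrr phi0 cy0; exact: le_trans hcs.
Qed.

End InteriorMaximum.

(** Common source of the finiteness of the suprema, of the positivity of c_inf and of the uniform
    gap in the attainment of the maximum; m is a bound or, through an inverse, a margin. *)
Lemma compact_bound (T : topologicalType) (A : set T) (P : T -> nat -> Prop) : compact A ->
  (forall x m k, P x m -> (m <= k)%N -> P x k) ->
  (forall x, A x -> exists m, \forall x' \near x, A x' -> P x' m) ->
  exists m, forall x, A x -> P x m.
Proof.
move=> /compact_near_coveringP cA mono loc.
have := cA nat \oo (fun i x => A x -> P x i) _.
case=> [x Ax|N _ hN]; last by exists N => x Ax; exact: (hN N (leqnn N) x Ax Ax).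
have [m hm] := loc x Ax.
exists ([set x' | A x' -> P x' m], [set k | (m <= k)%N]) => /=.
  by split=> //; exists m.
by move=> [x' k] /= [h1 h2] Ax'; exact: mono (h1 Ax') h2.
Qed.

(** * Continuity up to the boundary *)

Section Tends.
Context {R : realType} {T : topologicalType}.
Variables (A : set T) (x : T).
Implicit Types p q : T -> R.

(** Continuity at x relative to A, suited to functions that are arbitrary elsewhere, such as [du]
    and [d2u] outside the closure. *)
Definition tends q : Prop := q x' @[x' --> within A (nbhs x)] --> q x.

Lemma tends_cst (c : R) : tends (fun=> c).
Proof. exact: cvg_cst. Qed.

Lemma tendsD p q : tends p -> tends q -> tends (fun y => p y + q y).
Proof. by move=> hp hq; exact: cvgD hp hq. Qed.

Lemma tendsN p : tends p -> tends (fun y => - p y).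
Proof. by move=> hp; exact: cvgN hp. Qed.

Lemma tendsB p q : tends p -> tends q -> tends (fun y => p y - q y).
Proof. by move=> hp hq; exact: cvgB hp hq. Qed.

Lemma tendsM p q : tends p -> tends q -> tends (fun y => p y * q y).
Proof. by move=> hp hq; exact: cvgM hp hq. Qed.

Lemma tends_sum (I : Type) (r : seq I) (q : I -> T -> R) :
  (forall i, tends (q i)) -> tends (fun y => \sum_(i <- r) q i y).
Proof. by move=> h; exact: cvg_sumr. Qed.

Lemma tends_comp (V : topologicalType) (phi : T -> V) (f : V -> R) :
  phi y @[y --> within A (nbhs x)] --> phi x -> {for phi x, continuous f} ->
  tends (fun y => f (phi y)).
Proof. by move=> hphi cf; exact: cvg_comp hphi cf. Qed.

Lemma tends_norm q : tends q -> tends (fun y => `|q y|).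
Proof. by move=> hq; apply: (tends_comp (f := @Num.norm R R) hq); exact: norm_continuous. Qed.

Lemma tends_sqrt q : tends q -> tends (fun y => Num.sqrt (q y)).
Proof. by move=> hq; apply: (tends_comp (f := Num.sqrt) hq); exact: sqrt_continuous. Qed.

Lemma cvg_tends_row m (phi : T -> 'rV[R]_m) : (forall i, tends (fun y => phi y 0 i)) ->
  phi y @[y --> within A (nbhs x)] --> phi x.
Proof.
move=> h; apply/cvgrPdist_le => /= e e0.
have hc : \forall y \near within A (nbhs x), forall i, `|phi x 0 i - phi y 0 i| <= e.
  apply: (@filter_forall T _ (fun i y => `|phi x 0 i - phi y 0 i| <= e)) => i.
  by move/cvgrPdist_le : (h i); exact.
apply: filterS hc => y hy; apply: row_norm_le (ltW e0) _ => i.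
by rewrite !mxE.
Qed.

Lemma tends_cvg_row m (phi : T -> 'rV[R]_m) i :
  phi y @[y --> within A (nbhs x)] --> phi x -> tends (fun y => phi y 0 i).
Proof. by move=> h; apply: (tends_comp (f := fun v : 'rV[R]_m => v 0 i) h); exact: coord_continuous. Qed.

Definition mtends a b (B : T -> 'M[R]_(a, b)) : Prop := forall i j, tends (fun y => B y i j).

Lemma mtendsD a b (B C : T -> 'M[R]_(a, b)) : mtends B -> mtends C -> mtends (fun y => B y + C y).
Proof.
move=> hB hC i j; rewrite /tends; under eq_fun do rewrite mxE_add.
by rewrite mxE_add; exact: tendsD (hB i j) (hC i j).
Qed.

Lemma mtendsN a b (B : T -> 'M[R]_(a, b)) : mtends B -> mtends (fun y => - B y).
Proof.
move=> hB i j; rewrite /tends; under eq_fun do rewrite mxE_opp.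
by rewrite mxE_opp; exact: tendsN (hB i j).
Qed.

Lemma mtendsZ a b (f : T -> R) (B : T -> 'M[R]_(a, b)) : tends f -> mtends B ->
  mtends (fun y => f y *: B y).
Proof.
move=> hf hB i j; rewrite /tends; under eq_fun do rewrite mxE_scale.
by rewrite mxE_scale; exact: tendsM hf (hB i j).
Qed.

Lemma mtendsM a b d (B : T -> 'M[R]_(a, b)) (C : T -> 'M[R]_(b, d)) : mtends B -> mtends C ->
  mtends (fun y => B y *m C y).
Proof.
move=> hB hC i j; rewrite /tends; under eq_fun do rewrite mxE.
by rewrite mxE; apply: tends_sum => k; exact: tendsM (hB i k) (hC k j).
Qed.

Lemma mtends_tr a b (B : T -> 'M[R]_(a, b)) : mtends B -> mtends (fun y => (B y)^T).
Proof.
by move=> hB i j; rewrite /tends; under eq_fun do rewrite mxE; rewrite mxE; exact: hB.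
Qed.

Lemma mtends_sum a b (I : Type) (r : seq I) (B : I -> T -> 'M[R]_(a, b)) :
  (forall i, mtends (B i)) -> mtends (fun y => \sum_(i <- r) B i y).
Proof.
move=> hB i j; rewrite /tends; under eq_fun do rewrite summxE.
by rewrite summxE; apply: tends_sum => k; exact: hB.
Qed.

Lemma tends_near q (e : R) : tends q -> 0 < e ->
  \forall y \near x, A y -> `|q y - q x| <= e.
Proof.
move=> hq e0; move/cvgrPdist_le/(_ _ e0) : hq; rewrite near_withinE => h.
by apply: filterS h => y hy Ay; rewrite distrC; exact: (hy Ay).
Qed.

Lemma tends_bound q : tends q -> exists m : nat, \forall y \near x, A y -> q y <= m%:R.
Proof.
move=> hq; have h := tends_near hq ltr01.
exists (Num.truncn (`|q x| + 1)).+1; apply: filterS h => y hy Ay.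
have := hy Ay; rewrite ler_norml => /andP[_ h2].
have : `|q x| + 1 < (Num.truncn (`|q x| + 1)).+1%:R by rewrite truncnS_gt.
have := ler_norm (q x); lra.
Qed.

End Tends.

Section Density.
Context {R : realType} {T : topologicalType}.
Variables (Omega : set T) (x : T).
Hypothesis cx : closure Omega x.

(** A negative value at x would persist at nearby points of Omega, which exist since x is in its
    closure. In use D is a chart domain or the intersection of two. *)
Lemma tends_ge0 (D : set T) (q : T -> R) : nbhs x D -> tends (closure Omega) x q ->
  (forall y, Omega y -> D y -> 0 <= q y) -> 0 <= q x.
Proof.
move=> nD tq h; rewrite leNgt; apply/negP => neg.
have e0 : 0 < - q x / 2 by lra.
have [y [Oy [Dy hy]]] := cx (filterI nD (tends_near tq e0)).
have := hy (subset_closure Oy); rewrite ler_norml => /andP[_].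
have := h y Oy Dy; lra.
Qed.

Lemma tends_eq (D : set T) (p q : T -> R) : nbhs x D ->
  tends (closure Omega) x p -> tends (closure Omega) x q ->
  (forall y, Omega y -> D y -> p y = q y) -> p x = q x.
Proof.
move=> nD tp tq h; apply/eqP; rewrite eq_le; apply/andP; split; rewrite -subr_ge0.
  by apply: (tends_ge0 nD (q := fun y => q y - p y)) => [|y Oy Dy]; [exact: tendsB|rewrite h// subrr].
by apply: (tends_ge0 nD (q := fun y => p y - q y)) => [|y Oy Dy]; [exact: tendsB|rewrite h// subrr].
Qed.

End Density.

Section ClosureCalculus.
Context {R : realType} {n : nat} (M : riemannianManifold R n).
Implicit Types (c : chart M) (x : M).
Local Notation E := 'rV[R]_n.
Local Notation e_ := (@basis_vec R n).

Section Coordinates.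
Variables (A : set M) (c : chart M) (x : M).
Hypothesis dx : dom c x.
Local Notation V := (local_coord c @` dom c).

Lemma nbhs_dom : nbhs x (dom c).
Proof. by apply: open_nbhs_nbhs; split => //; exact: dom_open. Qed.

Lemma tends_congr (p q : M -> R) : (forall y, dom c y -> p y = q y) ->
  tends A x p -> tends A x q.
Proof.
move=> pq tp; rewrite /tends -(pq x dx); apply: cvg_trans tp.
apply: near_eq_cvg; rewrite near_withinE.
by apply: filterS nbhs_dom => y dy _; exact: pq.
Qed.

Lemma cvg_local_coord : local_coord c y @[y --> within A (nbhs x)] --> local_coord c x.
Proof.
have := @local_coord_continuous _ _ M c.
rewrite (continuous_open_subspace _ (@dom_open _ _ M c)) => /(_ x (mem_set dx)) h.
exact: cvg_within_filter h.
Qed.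

Lemma tends_smooth k (U : set E) (q : E -> R) : smooth k U q -> U (local_coord c x) ->
  tends A x (fun y => q (local_coord c y)).
Proof.
by move=> sq Ux; apply: tends_comp cvg_local_coord _; exact: smooth_continuous sq Ux.
Qed.

Lemma mtends_smooth a b k (U : set E) (B : E -> 'M[R]_(a, b)) : msmooth k U B ->
  U (local_coord c x) -> mtends A x (fun y => B (local_coord c y)).
Proof. by move=> sB Ux i j; exact: tends_smooth (sB i j) Ux. Qed.

Lemma tends_blocks m k (q : M -> 'rV[R]_m) (f : 'rV[R]_(n + m) -> R) :
  smooth k (cylinder V) f -> mtends A x q ->
  tends A x (fun y => f (row_mx (local_coord c y) (q y))).
Proof.
move=> sf tq; apply: (tends_comp (phi := fun y => row_mx (local_coord c y) (q y))); last first.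
  by apply: smooth_continuous sf _; rewrite /cylinder /= row_mxKl; exists x.
apply: cvg_tends_row => i; rewrite -(splitK i); case: (fintype.split i) => j /=.
  rewrite /tends; under eq_fun do rewrite row_mxEl.
  by rewrite row_mxEl; exact: tends_cvg_row cvg_local_coord.
by rewrite /tends; under eq_fun do rewrite row_mxEr; rewrite row_mxEr; exact: tq.
Qed.

Let Vx : V (local_coord c x). Proof. by exists x. Qed.

Lemma mtends_metric : mtends A x (fun y => metric c (local_coord c y)).
Proof. by have [_ _ sg] := metric_gm c; exact: mtends_smooth sg Vx. Qed.

Lemma mtends_invmetric : mtends A x (fun y => invmx (metric c (local_coord c y))).
Proof.
have [oV pg sg] := metric_gm c.
have s : msmooth 3 V (fun z : E => invmx (metric c z)).
  by apply: msmooth_inv => // z Vz; exact/posdef_unit/pg.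
exact: (mtends_smooth s Vx).
Qed.

Lemma tends_covec_norm (w : M -> E) : mtends A x w ->
  tends A x (fun y => covec_norm (metric c (local_coord c y)) (w y)).
Proof.
move=> tw; apply: tends_sqrt.
exact: (mtendsM (mtendsM tw mtends_invmetric) (mtends_tr tw)).
Qed.

Lemma tends_tensor_norm (B : M -> 'M[R]_n) : mtends A x B ->
  tends A x (fun y => tensor_norm (metric c (local_coord c y)) (B y)).
Proof.
move=> tB; apply: tends_sqrt; apply: tends_sum => i.
exact: (mtendsM (mtendsM (mtendsM mtends_invmetric tB) mtends_invmetric) (mtends_tr tB)).
Qed.

Lemma mtends_cov_hessian (w : M -> E) (H : M -> 'M[R]_n) : mtends A x w -> mtends A x H ->
  mtends A x (fun y => cov_hessian c (local_coord c y) (w y) (H y)).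
Proof.
move=> tw tH; apply: mtendsD => //; apply: mtendsN; apply: mtends_sum => k.
apply: mtendsZ; first exact: tw.
move=> i j; apply: (@tends_congr (fun y => conn (metric c) i (local_coord c y) j k)).
  by move=> y dy; rewrite christoffel_conn//; exists y.
exact: tends_smooth (conn_smooth (metric_gm c) i j k) Vx.
Qed.

End Coordinates.

Lemma nbhs_domI c c' x : dom c x -> dom c' x -> nbhs x (dom c `&` dom c').
Proof. by move=> dx dx'; apply: filterI; exact: nbhs_dom. Qed.

Lemma mtends_jac A c c' x : dom c x -> dom c' x ->
  mtends A x (fun y => jac (transition c c') (local_coord c y)).
Proof.
move=> dx dx'; have s : msmooth 0 (img c (dom c' `&` setT)) (jac (transition c c')).
  by apply: jac_smooth => i; exact: smooth_transition.
by apply: (mtends_smooth A dx s); rewrite setIT; exact: img_point.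
Qed.

Variables (Omega : set M) (u : M -> R).
Variables (du : chart M -> M -> E) (d2u : chart M -> M -> 'M[R]_n).
Hypotheses (oO : open Omega) (su : C_on 4 Omega u) (clu : C2_closure Omega u du d2u).
Local Notation cl := (closure Omega).

Lemma smooth_u c k : (k <= 4)%N -> smooth k (img c Omega) (u \o cinv c).
Proof. by move=> k4; apply: smooth_le k4 _; rewrite smoothE; exact: su. Qed.

Lemma within_dom (W : topologicalType) (q : M -> W) c x : cl x -> dom c x ->
  {within cl `&` dom c, continuous q} -> q y @[y --> within cl (nbhs x)] --> q x.
Proof.
move=> cx dx /subspace_continuousP/(_ x (conj cx dx)) h; apply: cvg_trans h => P.
rewrite /= !near_simpl !near_withinE => h.
by apply: filterS2 h (nbhs_dom dx) => y hy dy cy; apply: hy.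
Qed.

Lemma tends_u x : cl x -> tends cl x u.
Proof. by move=> cx; have /subspace_continuousP := C2_closure_u clu; exact. Qed.

Lemma mtends_du c x : cl x -> dom c x -> mtends cl x (du c).
Proof.
move=> cx dx i j; rewrite ord1; apply: tends_cvg_row.
by apply: (within_dom cx dx); exact: C2_closure_du clu c.
Qed.

Lemma mtends_d2u c x : cl x -> dom c x -> mtends cl x (d2u c).
Proof.
move=> cx dx i j; apply: (tends_comp (f := fun B : 'M[R]_n => B i j)); last exact: coord_continuous.
by apply: (within_dom cx dx); exact: C2_closure_d2u clu c.
Qed.

Lemma mtends_hessian c x : cl x -> dom c x -> mtends cl x (hessian du d2u c).
Proof.
move=> cx dx; apply: (mtends_cov_hessian dx); [exact: mtends_du|exact: mtends_d2u].
Qed.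

(** On the frontier [du] is only a continuous extension, chart by chart. The transformation law is
    known at interior points and reaches the closure by density. *)
Lemma du_transition c c' x : cl x -> dom c x -> dom c' x ->
  du c x = du c' x *m (jac (transition c c') (local_coord c x))^T.
Proof.
move=> cx dx dx'; apply/rowP => i; have := nbhs_domI dx dx'.
move=> /(tends_eq cx (p := fun y => du c y 0 i)
  (q := fun y => (du c' y *m (jac (transition c c') (local_coord c y))^T) 0 i)); apply.
- exact: mtends_du.
- by apply: mtendsM; [exact: mtends_du|apply: mtends_tr; exact: mtends_jac].
move=> y Oy [dy dy']; rewrite !(C2_closure_duE clu)// (partials_transition oO (c' := c')).
- by rewrite transition_pt.
- by exists y.
exact: smooth_u.
Qed.

Lemma hessianE c x : Omega x -> dom c x -> hessian du d2u c x = hess (metric c) (u \o cinv c)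
  (local_coord c x).
Proof.
move=> Ox dx; by rewrite /hessian (C2_closure_duE clu)// (C2_closure_d2uE clu)// cov_hessian_hess//; exists x.
Qed.

Lemma hessian_transition c c' x : cl x -> dom c x -> dom c' x ->
  let J := jac (transition c c') (local_coord c x) in
  hessian du d2u c x = J *m hessian du d2u c' x *m J^T.
Proof.
move=> cx dx dx' /=; apply/matrixP => i j; have := nbhs_domI dx dx'.
move=> /(tends_eq cx (p := fun y => hessian du d2u c y i j)
  (q := fun y => (jac (transition c c') (local_coord c y) *m hessian du d2u c' y *m
     (jac (transition c c') (local_coord c y))^T) i j)); apply.
- exact: mtends_hessian.
- by apply: mtendsM; [apply: mtendsM; [exact: mtends_jac|exact: mtends_hessian]|
    apply: mtends_tr; exact: mtends_jac].
move=> y Oy [dy dy']; rewrite /hessian !(C2_closure_duE clu)// !(C2_closure_d2uE clu)//.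
rewrite (cov_hessian_transition oO (c' := c')) ?transition_pt//; first by exists y.
exact: smooth_u.
Qed.

End ClosureCalculus.

(** * Suprema and the global maximum *)

Section PositiveForms.
Context {R : realType} {n : nat}.
Implicit Types (B : 'M[R]_n) (x : 'rV[R]_n).

Definition pos_form B := forall x, x != 0 -> 0 < bform B x x.

Lemma pos_form_lower B : (0 < n)%N -> pos_form B ->
  exists2 d : R, 0 < d & forall x, d * sqn x <= bform B x x.
Proof.
move=> n0 pB; have [x sx hx] := sphere_max (- B) n0.
have x0 : x != 0.
  apply/eqP => x0; move: sx; rewrite x0 /sqn big1 => [/eqP|i _]; last by rewrite mxE expr0n.
  by rewrite eq_sym oner_eq0.
exists (bform B x x); first exact: pB.
by move=> y; have := hx y; rewrite !bformN mulNr lerN2.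
Qed.

Lemma bform_upper B : exists2 C : R, 0 < C & forall x, `|bform B x x| <= C * sqn x.
Proof.
pose e := \sum_i \sum_j `|B i j|.
have he i j : `|B i j| <= e.
  rewrite /e (bigD1 i)//= (bigD1 j)//= -addrA lerDl addr_ge0//; first exact: sumr_ge0.
  by apply: sumr_ge0 => k _; exact: sumr_ge0.
have e0 : 0 <= e by apply: sumr_ge0 => i _; exact: sumr_ge0.
exists (n%:R * e + 1); first by rewrite ltr_wpDl// mulr_ge0.
move=> x; apply: le_trans (bform_norm_le x he) _.
by rewrite ler_wpM2r ?sqn_ge0// lerDl.
Qed.

(** A change of the entries by at most d / n alters the form by at most d |xi|^2, the margin left by
    positivity on the compact sphere. *)
Lemma pos_form_stable (T : topologicalType) (A : set T) (x : T) (B : T -> 'M[R]_n) :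
  (0 < n)%N -> mtends A x B -> pos_form (B x) ->
  \forall y \near x, A y -> forall xi, 0 <= bform (B y) xi xi.
Proof.
move=> n0 tB pB; have [d d0 hd] := pos_form_lower n0 pB.
have N0 : (0 : R) < n%:R by rewrite ltr0n.
have e0 : 0 < d / n%:R by rewrite divr_gt0.
have hn : \forall y \near x, forall i j, A y -> `|B y i j - B x i j| <= d / n%:R.
  apply: (@filter_forall T _ (fun i y => forall j, A y -> `|B y i j - B x i j| <= d / n%:R) _
    (nbhs_filter x)) => i.
  apply: (@filter_forall T _ (fun j y => A y -> `|B y i j - B x i j| <= d / n%:R) _ (nbhs_filter x)) => j.
  exact: tends_near (tB i j) e0.
apply: filterS hn => y hy Ay xi.
have h i j : `|(B y - B x) i j| <= d / n%:R.
  by rewrite mxE_add mxE_opp; exact: hy.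
have := bform_norm_le xi h; rewrite mulrCA mulfV ?gt_eqF// mulr1 ler_norml => /andP[h1 _].
have := hd xi; have -> : bform (B y) xi xi = bform (B y - B x) xi xi + bform (B x) xi xi.
  by rewrite bformD bformN subrK.
lra.
Qed.

Lemma trace_frame (G B V : 'M[R]_n) d : G \in unitmx -> V *m G *m V^T = 1%:M ->
  V *m B *m V^T = diag_mx d -> \tr (invmx G *m B) = \sum_i d 0 i.
Proof.
move=> uG VG VB; have h : G *m (V^T *m V) = 1%:M by rewrite mulmxA; apply: mulmx1C; rewrite mulmxA.
have -> : invmx G = V^T *m V by rewrite -[LHS]mulmx1 -h mulKmx.
by rewrite -mulmxA mxtrace_mulC VB mxtrace_diag.
Qed.

End PositiveForms.

Section Suprema.
Context {R : realType} {n : nat} (M : riemannianManifold R n).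
Implicit Types (c : chart M) (x : M) (B : set M).
Local Notation E := 'rV[R]_n.
Variables (Omega : set M) (cO : compact (closure Omega)).
Local Notation cl := (closure Omega).

(** [sup] dominates only sets that are bounded above. Continuity bounds the quantity near each point
    in one chart, independence of the chart extends this to all charts, and compactness makes the
    bound uniform. *)
Lemma sup_on_ub B (q : chart M -> M -> R) : B `<=` cl ->
  (forall c c' x, cl x -> dom c x -> dom c' x -> q c x = q c' x) ->
  (forall c x, cl x -> dom c x -> tends cl x (q c)) ->
  forall c x, B x -> dom c x -> q c x <= sup_on B q.
Proof.
move=> Bcl ind tq.
have [|x cx|m hm] := compact_bound (P := fun x m => forall c, dom c x -> q c x <= m%:R) cO.
- by move=> x m k h mk c dx; apply: le_trans (h c dx) _; rewrite ler_nat.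
- have [c dx] := dom_cover x; have [m hm] := tends_bound (tq c x cx dx).
  exists m; apply: filterS2 hm (nbhs_dom dx) => y hy dy cy c' dy'.
  by rewrite (ind c' c)//; exact: hy.
move=> c x Bx dx; apply: ub_le_sup; last by exists c, x.
by exists m%:R => _ [c' [x' [Bx' dx' ->]]]; exact: hm (Bcl _ Bx') _ dx'.
Qed.

(** The reciprocal is bounded on the compact closure. Positivity is needed because c_inf is a
    divisor in the final constant. *)
Lemma inf_on_gt0 (q : M -> R) : Omega !=set0 ->
  (forall x, cl x -> 0 < q x) -> (forall x, cl x -> tends cl x q) ->
  0 < inf_on Omega (fun _ => q) /\ forall x, Omega x -> inf_on Omega (fun _ => q) <= q x.
Proof.
move=> [x0 Ox0] q0 tq.
have [|x cx|m hm] := compact_bound (P := fun x m => (q x)^-1 <= m%:R) cO.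
- by move=> x m k h mk; apply: le_trans h _; rewrite ler_nat.
- apply: tends_bound; apply: (tends_comp (f := fun r : R => r^-1) (tq x cx)).
  by apply: inv_continuous; rewrite gt_eqF// q0.
have m0 : (0 : R) < m%:R.
  have cx0 := subset_closure Ox0; apply: lt_le_trans (hm x0 cx0).
  by rewrite invr_gt0 q0.
have lb x : Omega x -> m%:R^-1 <= q x.
  move=> /subset_closure cx; rewrite -[leRHS]invrK lef_pV2 ?posrE ?invr_gt0 ?q0//.
  exact: hm.
have hlb : lbound [set r | exists c x, [/\ Omega x, dom c x & r = q x]] m%:R^-1.
  by move=> _ [c [x [Ox _ ->]]]; exact: lb.
split.
  apply: lt_le_trans (_ : m%:R^-1 <= _); first by rewrite invr_gt0.
  apply: lb_le_inf => //; have [c dx] := dom_cover x0; exists (q x0), c, x0; split=> //.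
move=> x Ox; apply: ge_inf; first by exists m%:R^-1.
by have [c dx] := dom_cover x; exists c, x.
Qed.

End Suprema.

Section ClosureNorms.
Context {R : realType} {n : nat} (M : riemannianManifold R n).
Implicit Types (c : chart M) (x : M).
Local Notation E := 'rV[R]_n.
Variables (Omega : set M) (u : M -> R).
Variables (du : chart M -> M -> E) (d2u : chart M -> M -> 'M[R]_n).
Hypotheses (oO : open Omega) (su : C_on 4 Omega u) (clu : C2_closure Omega u du d2u).
Local Notation cl := (closure Omega).

Let ug c x : dom c x -> metric c (local_coord c x) \in unitmx.
Proof. by move=> dx; have [_ pG _] := metric_gm c; apply/posdef_unit/pG; exists x. Qed.

Let metricT c c' x : dom c x -> dom c' x ->
  let J := jac (transition c c') (local_coord c x) in
  J \in unitmx /\ metric c (local_coord c x) = J *m metric c' (local_coord c' x) *m J^T.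
Proof.
move=> dx dx' /=; have iy : img c (dom c') (local_coord c x) by exact: img_point.
split; first exact: transition_unit.
by rewrite (metric_transition iy) transition_pt.
Qed.

Lemma gradient_norm_indep c c' x : cl x -> dom c x -> dom c' x ->
  gradient_norm du c x = gradient_norm du c' x.
Proof.
move=> cx dx dx'; have [uJ mE] := metricT dx dx'.
rewrite /gradient_norm (du_transition oO su clu cx dx dx') mE.
exact: covec_norm_congr uJ (ug dx').
Qed.

Lemma hessian_norm_indep c c' x : cl x -> dom c x -> dom c' x ->
  hessian_norm du d2u c x = hessian_norm du d2u c' x.
Proof.
move=> cx dx dx'; have [uJ mE] := metricT dx dx'.
rewrite /hessian_norm (hessian_transition oO su clu cx dx dx') mE.
exact: tensor_norm_congr uJ (ug dx').
Qed.

Lemma gradient_transition c c' x : cl x -> dom c x -> dom c' x ->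
  gradient du c x *m jac (transition c c') (local_coord c x) = gradient du c' x.
Proof.
move=> cx dx dx'; have [uJ mE] := metricT dx dx'.
have uJT : (jac (transition c c') (local_coord c x))^T \in unitmx by rewrite unitmx_tr.
rewrite /gradient (du_transition oO su clu cx dx dx') mE (invmx_congr uJ (ug dx')).
by rewrite !mulmxA (mulmxK uJT) (mulmxKV uJ).
Qed.

Lemma tends_gradient_norm c x : cl x -> dom c x -> tends cl x (gradient_norm du c).
Proof. by move=> cx dx; apply: (tends_covec_norm dx); exact: (mtends_du clu cx dx). Qed.

Lemma tends_hessian_norm c x : cl x -> dom c x -> tends cl x (hessian_norm du d2u c).
Proof. by move=> cx dx; apply: (tends_tensor_norm dx); exact: (mtends_hessian clu cx dx). Qed.

Lemma mtends_gradient c x : cl x -> dom c x -> mtends cl x (gradient du c).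
Proof.
move=> cx dx; apply: mtendsM; [exact: (mtends_du clu cx dx)|exact: mtends_invmetric].
Qed.

Section PointValueJets.
Variable f : M -> R -> R.
Hypothesis sf : C2_point_value f.

Lemma tends_f_blocks c x k (H : 'rV[R]_(n + 1) -> R) : cl x -> dom c x ->
  smooth k (cylinder (local_coord c @` dom c)) H ->
  tends cl x (fun y => H (row_mx (local_coord c y) (const_mx (u y)))).
Proof.
move=> cx dx sH; apply: (tends_blocks dx sH) => i j.
by rewrite /tends; under eq_fun do rewrite mxE; rewrite mxE; exact: (tends_u clu cx).
Qed.

Lemma tends_f c x : cl x -> dom c x -> tends cl x (fun y => f y (u y)).
Proof.
move=> cx dx; apply: (tends_congr (q := fun y => f y (u y)) dx (p := fun y => fhat f c (row_mx
  (local_coord c y) (const_mx (u y))))).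
  by move=> y dy; rewrite fhatE local_coordK.
exact: tends_f_blocks (smooth_fhat sf c).
Qed.

(** Each term is built from partial derivatives of [fhat] of order at most two, evaluated at (x,
    u(x)), and u is continuous up to the boundary. *)
Lemma tends_f_jet_norm c x : cl x -> dom c x -> tends cl x (fun y => f_jet_norm f c y (u y)).
Proof.
move=> cx dx; have s0 := smooth_fhat sf c.
have s1 v : smooth 1 (cylinder (local_coord c @` dom c)) (pd v (fhat f c)) by exact: smooth_pd.
have s2 v w : smooth 0 (cylinder (local_coord c @` dom c)) (pd w (pd v (fhat f c))).
  exact: smooth_pd.
have tw : mtends cl x (fun y => partials (fun y' => f (cinv c y') (u y)) (local_coord c y)).
  move=> i j; rewrite /tends; rewrite ord1; under eq_fun do rewrite partialsE -fhat_l.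
  by rewrite partialsE -fhat_l; exact: tends_f_blocks (s1 _).
have tH : mtends cl x (fun y => partials2 (fun y' => f (cinv c y') (u y)) (local_coord c y)).
  move=> i j; rewrite /tends; under eq_fun do rewrite partials2E -fhat_ll.
  by rewrite partials2E -fhat_ll; exact: tends_f_blocks (s2 _ _).
have td : mtends cl x (fun y => partials (fun y' => derive1 (f (cinv c y')) (u y)) (local_coord c y)).
  move=> i j; rewrite /tends; rewrite ord1; under eq_fun do rewrite partialsE -fhat_lr.
  by rewrite partialsE -fhat_lr; exact: tends_f_blocks (s2 _ _).
have tz : tends cl x (fun y => derive1 (f y) (u y)).
  apply: (tends_congr dx (p := fun y => derive1 (f (cinv c (local_coord c y))) (u y))).
    by move=> y dy; rewrite local_coordK.
  rewrite /tends; under eq_fun do rewrite -fhat_r.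
  by rewrite -fhat_r; exact: tends_f_blocks (s1 _).
have tzz : tends cl x (fun y => derive1n 2 (f y) (u y)).
  apply: (tends_congr dx (p := fun y => derive1n 2 (f (cinv c (local_coord c y))) (u y))).
    by move=> y dy; rewrite local_coordK.
  rewrite /tends; under eq_fun do rewrite -fhat_rr.
  by rewrite -fhat_rr; exact: tends_f_blocks (s2 _ _).
have h1 := tends_covec_norm dx tw.
have h2 := tends_tensor_norm dx (mtends_cov_hessian dx tw tH).
have h3 := tends_covec_norm dx td.
exact: (tendsD (tendsD (tendsD (tendsD (tendsD (tends_f cx dx) h1) (tends_norm tz)) h2) h3) (tends_norm tzz)).
Qed.

End PointValueJets.

Section TangentJets.
Variable h : chart M -> E -> E -> R.
Hypotheses (th : tangent_function h) (sh : C2_tangent h).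

Lemma h_jet_norm_gradient_indep c c' x : cl x -> dom c x -> dom c' x ->
  h_jet_norm h c x (gradient du c x) = h_jet_norm h c' x (gradient du c' x).
Proof.
move=> cx dx dx'; rewrite (h_jet_norm_indep th sh _ dx dx').
by rewrite (gradient_transition cx dx dx').
Qed.

Lemma tends_h_jet_norm c x : cl x -> dom c x ->
  tends cl x (fun y => h_jet_norm h c y (gradient du c y)).
Proof.
move=> cx dx; have s0 := smooth_hhat sh c.
have s1 v : smooth 1 (cylinder (local_coord c @` dom c)) (pd v (hhat h c)) by exact: smooth_pd.
have s2 v w : smooth 0 (cylinder (local_coord c @` dom c)) (pd w (pd v (hhat h c))).
  exact: smooth_pd.
have tb k (H : 'rV[R]_(n + n) -> R) : smooth k (cylinder (local_coord c @` dom c)) H ->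
    tends cl x (fun y => H (row_mx (local_coord c y) (gradient du c y))).
  by move=> sH; apply: (tends_blocks dx sH); exact: mtends_gradient.
have t0 : tends cl x (fun y => h c (local_coord c y) (gradient du c y)).
  rewrite /tends; under eq_fun do rewrite -hhatE.
  by rewrite -hhatE; exact: tb s0.
have tw : mtends cl x (fun y => partials (h c (local_coord c y)) (gradient du c y)).
  move=> i j; rewrite /tends; rewrite ord1; under eq_fun do rewrite partialsE -hhat_r.
  by rewrite partialsE -hhat_r; exact: tb (s1 _).
have tH : mtends cl x (fun y => partials2 (h c (local_coord c y)) (gradient du c y)).
  move=> i j; rewrite /tends; under eq_fun do rewrite partials2E -hhat_rr.
  by rewrite partials2E -hhat_rr; exact: tb (s2 _ _).
have h1 := tends_covec_norm dx tw; have h2 := tends_tensor_norm dx tH.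
exact: (tendsD (tendsD t0 h1) h2).
Qed.

End TangentJets.

Variables (a K : R).

(** The (0,2) tensor before an index is raised: it is symmetric and transforms as a bilinear
    form. *)
Definition aug c x : 'M[R]_n :=
  hessian du d2u c x + a *: ((du c x)^T *m du c x) + K *: metric c (local_coord c x).

Lemma aug_augW c x : Omega x -> dom c x ->
  aug c x = augW (metric c) (u \o cinv c) a K (local_coord c x).
Proof.
move=> Ox dx; rewrite /aug (hessianE clu Ox dx) /augW (C2_closure_duE clu)// partials_dcol.
by rewrite trmxK.
Qed.

Lemma mtends_aug c x : cl x -> dom c x -> mtends cl x (aug c).
Proof.
move=> cx dx; have td := mtends_du clu cx dx.
apply: mtendsD; first (apply: mtendsD; first exact: (mtends_hessian clu cx dx)).
  by apply: mtendsZ; [exact: tends_cst|apply: mtendsM => //; exact: mtends_tr].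
by apply: mtendsZ; [exact: tends_cst|exact: mtends_metric].
Qed.

Lemma aug_sym c x : cl x -> dom c x -> (aug c x)^T = aug c x.
Proof.
move=> cx dx; apply/matrixP => i j.
apply: (tends_eq cx (nbhs_dom dx) (p := fun y => (aug c y)^T i j) (q := fun y => aug c y i j)).
- by apply: mtends_tr; exact: mtends_aug.
- exact: mtends_aug.
move=> y Oy dy; rewrite aug_augW// (augW_sym (U := img c Omega))//.
- by apply: gmetric_sub (metric_gm c); [exact: img_open|exact: img_sub].
- exact: (smooth_u su c (isT : (4 <= 4)%N)).
- exact: img_point.
Qed.

Lemma aug_transition c c' x : cl x -> dom c x -> dom c' x ->
  let J := jac (transition c c') (local_coord c x) in aug c x = J *m aug c' x *m J^T.
Proof.
move=> cx dx dx' J; have [uJ mE] := metricT dx dx'.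
rewrite /aug (hessian_transition oO su clu cx dx dx') mE (du_transition oO su clu cx dx dx') -/J.
by rewrite trmx_mul trmxK !mulmxDr !mulmxDl -!scalemxAr -!scalemxAl !mulmxA.
Qed.

(** Quantified over all charts so as to be a property of the point alone; one chart suffices to
    check it, by [below_chart]. *)
Definition below (L : R) x := forall c, dom c x -> forall xi,
  bform (aug c x) xi xi <= L * bform (metric c (local_coord c x)) xi xi.

Lemma below_chart L c x : cl x -> dom c x ->
  (forall xi, bform (aug c x) xi xi <= L * bform (metric c (local_coord c x)) xi xi) -> below L x.
Proof.
move=> cx dx h c' dx' xi; have [uJ mE] := metricT dx dx'.
set J := jac _ _ in uJ mE.
have := h (xi *m invmx J); rewrite (aug_transition cx dx dx') -/J mE -!bform_mul.
by rewrite mulmxKV.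
Qed.

Lemma bform_metric_gt0 c x xi : dom c x -> xi != 0 -> 0 < bform (metric c (local_coord c x)) xi xi.
Proof. by move=> dx; exact: metric_pos. Qed.

Lemma bform_metric_ge0 c x xi : dom c x -> 0 <= bform (metric c (local_coord c x)) xi xi.
Proof.
move=> dx; have [->|x0] := eqVneq xi 0; first by rewrite bform0.
exact/ltW/bform_metric_gt0.
Qed.

Lemma below_le L L' x : L <= L' -> below L x -> below L' x.
Proof.
move=> LL h c dx xi; apply: le_trans (h c dx xi) _.
by rewrite ler_wpM2r// bform_metric_ge0.
Qed.

Lemma below_near L c x : (0 < n)%N -> cl x -> dom c x ->
  pos_form (L *: metric c (local_coord c x) - aug c x) -> \forall y \near x, cl y -> below L y.
Proof.
move=> n0 cx dx pB.
have tB : mtends cl x (fun y => L *: metric c (local_coord c y) - aug c y).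
  apply: mtendsD; last by apply: mtendsN; exact: mtends_aug.
  by apply: mtendsZ; [exact: tends_cst|exact: mtends_metric].
have hn := pos_form_stable n0 tB pB.
apply: filterS2 hn (nbhs_dom dx) => y hy dy cy.
apply: (below_chart cy dy) => xi; have := hy cy xi.
by rewrite bformD bformN bformZ subr_ge0.
Qed.

Hypothesis cO : compact cl.

(* L is the maximum over the closure of the largest eigenvalue of the augmented
   Hessian, with respect to the metric. *)
Lemma top_attained : (0 < n)%N -> Omega !=set0 ->
  exists L, (forall x, cl x -> below L x) /\
    exists c x xi, [/\ cl x, dom c x, xi != 0 &
      L * bform (metric c (local_coord c x)) xi xi <= bform (aug c x) xi xi].
Proof.
(* The witness is the infimum of [B], which is nonempty by compactness and bounded below by the
   quotient of the two forms at one point. *)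
move=> n0 [x0 Ox0]; pose B := [set L | forall x, cl x -> below L x].
have B0 : B !=set0.
  have [|x cx|m hm] := compact_bound (P := fun x m => below m%:R x) cO; last by exists m%:R.
    by move=> x m k h mk; apply: below_le h; rewrite ler_nat.
  have [c dx] := dom_cover x.
  have pg : pos_form (metric c (local_coord c x)) by move=> xi; exact: bform_metric_gt0.
  have [d d0 hd] := pos_form_lower n0 pg; have [C C0 hC] := bform_upper (aug c x).
  (* As m > C / d, m times the lower bound d of the metric exceeds the upper bound C of the
     augmented Hessian. *)
  pose m := (Num.truncn (C / d)).+1; exists m; apply: below_near n0 cx dx _ => xi xi0.
  have s0 := sqn_gt0 xi0; rewrite bformD bformN bformZ subr_gt0.
  have h1 := hC xi; rewrite ler_norml in h1; have {h1} /andP[_ h1] := h1.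
  apply: (le_lt_trans h1); apply: lt_le_trans (_ : m%:R * (d * sqn xi) <= _); last first.
    by rewrite ler_wpM2l.
  by rewrite mulrA ltr_pM2r// -ltr_pdivrMr// /m truncnS_gt.
have [c0 dx0] := dom_cover x0; have cx0 := subset_closure Ox0.
pose xi0 : E := const_mx 1.
have xi00 : xi0 != 0.
  apply/eqP => /rowP/(_ (Ordinal n0)); rewrite !mxE => /eqP; by rewrite oner_eq0.
have g0 := bform_metric_gt0 dx0 xi00.
have lbB : has_lbound B.
  exists (bform (aug c0 x0) xi0 xi0 / bform (metric c0 (local_coord c0 x0)) xi0 xi0) => L hL.
  by rewrite ler_pdivrMr//; exact: hL.
have hinf x : cl x -> below (inf B) x.
  move=> cx c dx xi; have [->|xi1] := eqVneq xi 0; first by rewrite !bform0 mulr0.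
  have g1 := bform_metric_gt0 dx xi1; rewrite -ler_pdivrMr//.
  by apply: lb_le_inf => // L hL; rewrite ler_pdivrMr//; exact: hL.
exists (inf B); split=> //; apply: contrapT => no.
have strict c x xi : cl x -> dom c x -> xi != 0 ->
    bform (aug c x) xi xi < inf B * bform (metric c (local_coord c x)) xi xi.
  move=> cx dx xi1; rewrite ltNge; apply/negP => hle; apply: no.
  by exists c, x, xi.
(* Without attainment the bound [inf B] is strict everywhere, hence holds with a margin 1 / (m + 1)
   near each point and by compactness with a single margin, against the choice of the infimum. *)
have [|x cx|m hm] := compact_bound (P := fun x m => below (inf B - m.+1%:R^-1) x) cO.
- move=> x m k h mk; apply: below_le h; rewrite lerD2l lerN2.
  by rewrite lef_pV2 ?posrE ?ltr0n// ler_nat.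
- have [c dx] := dom_cover x.
  have pB : pos_form (inf B *: metric c (local_coord c x) - aug c x).
    by move=> xi xi1; rewrite bformD bformN bformZ subr_gt0; exact: strict.
  have [d d0 hd] := pos_form_lower n0 pB.
  have [C C0 hC] := bform_upper (metric c (local_coord c x)).
  pose m := Num.truncn (C / d); exists m; apply: below_near n0 cx dx _ => xi xi1.
  have s0 := sqn_gt0 xi1; have := hd xi; rewrite !bformD !bformN !bformZ.
  have h1 := hC xi; rewrite ler_norml in h1; have {h1} /andP[_ h1] := h1.
  have m1 : (0 : R) < m.+1%:R by [].
  have h2 : m.+1%:R^-1 * bform (metric c (local_coord c x)) xi xi < d * sqn xi.
    rewrite mulrC ltr_pdivrMr//; apply: (le_lt_trans h1).
    by rewrite mulrAC ltr_pM2r// mulrC -ltr_pdivrMr// /m truncnS_gt.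
  move=> h3; rewrite mulrBl; move: h2 h3.
  by move: (_^-1 * _) (inf B * _) (bform (aug c x) _ _) (d * _) => q r s t; lra.
have : inf B <= inf B - m.+1%:R^-1 by apply: ge_inf.
by rewrite lerBrDr gerDl leNgt invr_gt0 ltr0n.
Qed.

End ClosureNorms.

(** * Boundary case and final estimate *)

Section Assembly.
Context {R : realType} {n : nat} (M : riemannianManifold R n).
Implicit Types (c : chart M) (x : M).
Local Notation E := 'rV[R]_n.
Variables (K : R) (Gam : set E) (F : E -> R) (a eps : R).
Variables (f : M -> R -> R) (h : chart M -> E -> E -> R).
Hypotheses (n0 : (0 < n)%N) (K0 : 0 <= K) (hK : constant_sectional_curvature M K).
Hypotheses (adm : admissible Gam F).
Hypotheses (sf : C2_point_value f) (f0 : forall x z, 0 < f x z).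
Hypotheses (th : tangent_function h) (sh : C2_tangent h) (xh : x_independent h).
Hypotheses (h0 : forall c x p, dom c x -> 0 < h c (local_coord c x) p).
Hypotheses (eps0 : 0 < eps) (ch : uniformly_convex_in_p h eps).
Variables (Omega : set M) (u : M -> R).
Variables (du : chart M -> M -> E) (d2u : chart M -> M -> 'M[R]_n).
Hypotheses (bO : bounded_domain Omega) (su : C_on 4 Omega u) (clu : C2_closure Omega u du d2u).
Hypothesis eqn : forall c x, Omega x -> dom c x -> exists lam : E,
  [/\ is_spectrum (augmented_hessian du d2u a K c x) lam, Gam lam &
      F lam = f x (u x) * h c (local_coord c x) (gradient du c x)].
Local Notation cl := (closure Omega).
Local Notation W := (aug du d2u a K).
Let oO : open Omega. Proof. by case: bO. Qed.
Let neO : Omega !=set0. Proof. by case: bO. Qed.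
Let cO : compact cl. Proof. by case: bO. Qed.
Let es := sup_on Omega (fun c x => h_jet_norm h c x (gradient du c x)).
Let cs := sup_on Omega (fun c x => f_jet_norm f c x (u x)).
Let ci := inf_on Omega (fun _ x => f x (u x)).
Let A := C1_norm u du cl.
Let Bd := sup_on (frontier Omega) (hessian_norm du d2u).
Let bd := Bd + `|a| * A ^+ 2 + K.

Lemma gradient_norm_le c x : cl x -> dom c x -> gradient_norm du c x <= A.
Proof.
move=> cx dx; have h1 : gradient_norm du c x <= sup_on cl (gradient_norm du).
  apply: (sup_on_ub cO (fun _ => id)) cx dx => [c1 c2 y|c1 y].
    exact: (gradient_norm_indep oO su clu).
  exact: (tends_gradient_norm clu).
have h2 : `|u x| <= sup_on cl (fun _ : chart M => fun y => `|u y|).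
  apply: (sup_on_ub cO (fun _ => id) (q := fun _ y => `|u y|)) cx dx => // c1 y cy _.
  exact/tends_norm/(tends_u clu).
rewrite /A /C1_norm; apply: le_trans h1 _; rewrite lerDr; exact: le_trans h2.
Qed.

Let A0 : 0 <= A.
Proof.
have [x Ox] := neO; have [c dx] := dom_cover x.
by apply: le_trans (gradient_norm_le (subset_closure Ox) dx); exact: sqrtr_ge0.
Qed.

Lemma frame_du_le c x (V : 'M[R]_n) : cl x -> dom c x -> V *m metric c (local_coord c x) *m V^T = 1%:M ->
  forall i, `|(du c x *m V^T) 0 i| <= A.
Proof.
move=> cx dx VG i; apply: le_trans (gradient_norm_le cx dx).
have [_ pG _] := metric_gm c.
have ug : metric c (local_coord c x) \in unitmx by apply/posdef_unit/pG; exists x.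
have uV : V \in unitmx by have := @unitmx1 R n; rewrite -VG !unitmx_mul => /andP[/andP[]].
rewrite /gradient_norm -(covec_norm_congr _ uV ug) VG; exact: coord_le_covec_norm.
Qed.

Lemma frame_aug c x (V : 'M[R]_n) : V *m metric c (local_coord c x) *m V^T = 1%:M ->
  V *m W c x *m V^T = V *m hessian du d2u c x *m V^T
    + a *: ((du c x *m V^T)^T *m (du c x *m V^T)) + K%:M.
Proof.
move=> VG; rewrite /aug !mulmxDr !mulmxDl -!scalemxAr -!scalemxAl VG scalemx1.
by rewrite trmx_mul trmxK !mulmxA.
Qed.

Lemma rank_one_entry (w : E) i j : (w^T *m w) i j = w 0 i * w 0 j.
Proof. by rewrite mxE big_ord1 mxE. Qed.

(** Inside, the trace is positive because the eigenvalues lie in the cone; on the closure the weak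
    inequality survives the limit. *)
Lemma trace_aug_ge0 c x : cl x -> dom c x ->
  0 <= \tr (invmx (metric c (local_coord c x)) *m W c x).
Proof.
move=> cx dx.
apply: (tends_ge0 cx (nbhs_dom dx) (q := fun y => \tr (invmx (metric c (local_coord c y)) *m W c y))).
  apply: tends_sum => i; apply: (mtendsM (mtends_invmetric _ dx)).
  exact: (mtends_aug clu cx dx).
move=> y Oy dy; have [_ pG _] := metric_gm c.
have pg : posdef (metric c (local_coord c y)) by apply: pG; exists y.
have [V [d [VG VW]]] := simdiag pg (aug_sym oO su clu a K (subset_closure Oy) dy).
rewrite (trace_frame (posdef_unit pg) VG VW).
have [lam [slam Glam _]] := eqn Oy dy.
have [s ds] := is_spectrum_uniq slam (is_spectrum_frame (posdef_unit pg) VG VW).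
have [Gd _] := F_sym_perm adm s Glam; rewrite -ds in Gd.
exact/ltW/(cone_sup_sum adm Gd).
Qed.

(** In an orthonormal frame every entry of W is at most [bd] in absolute value, and such a form is
    at most n bd |xi|^2. *)
Lemma frontier_top_le L c x xi : frontier Omega x -> dom c x -> xi != 0 ->
  L * bform (metric c (local_coord c x)) xi xi <= bform (W c x) xi xi -> L <= n%:R * bd.
Proof.
move=> fx dx xi0 hL; have cx : cl x by case: fx.
have [_ pG _] := metric_gm c.
have pg : posdef (metric c (local_coord c x)) by apply: pG; exists x.
have [V VG] := posdef_frame pg.
have uV : V \in unitmx by have := @unitmx1 R n; rewrite -VG !unitmx_mul => /andP[/andP[]].
have hB : hessian_norm du d2u c x <= Bd.
  apply: (sup_on_ub cO) fx dx => [y [] //|c1 c2 y|c1 y].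
    exact: (hessian_norm_indep oO su clu).
  exact: (tends_hessian_norm clu).
have bf (B : 'M[R]_n) : bform B xi xi = bform (V *m B *m V^T) (xi *m invmx V) (xi *m invmx V).
  by rewrite -bform_mul mulmxKV.
set eta := xi *m invmx V in bf.
have eta0 : eta != 0.
  by apply/eqP => e; move/eqP: xi0; apply; rewrite -[xi](mulmxKV uV) -/eta e mul0mx.
rewrite !bf VG bform1 in hL.
rewrite -(ler_pM2r (sqn_gt0 eta0)); apply: le_trans hL _.
apply: le_trans (ler_norm _) _; apply: bform_norm_le => i j.
rewrite (frame_aug VG) !mxE_add mxE_scale rank_one_entry.
have b1 : `|(V *m hessian du d2u c x *m V^T) i j| <= Bd.
  apply: le_trans (entry_le_tensor_norm _ i j) _; apply: le_trans hB.
  by rewrite /hessian_norm -(tensor_norm_congr _ uV (posdef_unit pg)) VG.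
have b2 : `|a * ((du c x *m V^T) 0 i * (du c x *m V^T) 0 j)| <= `|a| * A ^+ 2.
  apply: norm_mulr_le => //; rewrite expr2.
  by apply: norm_mulr_le; exact: frame_du_le.
have b3 : `|(K%:M : 'M[R]_n) i j| <= K.
  by rewrite mxE; case: (i == j); rewrite ?mulr1n ?mulr0n ?normr0 ?ger0_norm.
by apply: le_trans (ler_normD _ _) _; apply: lerD => //; apply: le_trans (ler_normD _ _) _; exact: lerD.
Qed.

Lemma hessian_norm_le LL L c x : (forall y, cl y -> below du d2u a K L y) -> L <= LL ->
  cl x -> dom c x -> hessian_norm du d2u c x <= n%:R * (n%:R * LL + `|a| * A ^+ 2 + K).
Proof.
move=> hL LLL cx dx; have [_ pG _] := metric_gm c.
have pg : posdef (metric c (local_coord c x)) by apply: pG; exists x.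
have [V [d [VG VW]]] := simdiag pg (aug_sym oO su clu a K cx dx).
have uV : V \in unitmx by have := @unitmx1 R n; rewrite -VG !unitmx_mul => /andP[/andP[]].
have N1 : 1 <= n%:R :> R by rewrite ler1n.
have dle i : d 0 i <= LL.
  have := hL x cx c dx (row i V).
  have r (B : 'M[R]_n) : bform B (row i V) (row i V) = (V *m B *m V^T) i i.
    by rewrite rowE bform_mul bform_delta.
  rewrite !r VG VW !mxE eqxx !mulr1n mulr1 => h1; exact: le_trans LLL.
have tr0 := trace_aug_ge0 cx dx; rewrite (trace_frame (posdef_unit pg) VG VW) in tr0.
(* The trace is nonnegative and at most n LL. *)
have LL0 : 0 <= LL.
  have : \sum_i d 0 i <= \sum_(i < n) LL by apply: ler_sum.
  move/(le_trans tr0); rewrite sumr_const card_ord -[_ *+ n]mulr_natl.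
  by rewrite pmulr_rge0// ltr0n.
(* In a nonnegative trace a negative eigenvalue is balanced by the n - 1 others, each at most LL. *)
have dabs i : `|d 0 i| <= n%:R * LL.
  rewrite (bigD1 i)//= in tr0.
  have h2 : \sum_(j < n | j != i) d 0 j <= (n%:R - 1) * LL.
    apply: le_trans (ler_sum _ (fun j _ => dle j)) _.
    rewrite sumr_const cardC1 card_ord -[leLHS]mulr_natl ler_wpM2r//.
    by rewrite -subn1 natrB.
  have n2 : 0 <= (n%:R - 1) * LL by rewrite mulr_ge0 ?subr_ge0.
  have := dle i; rewrite ler_norml; move: h2 n2; rewrite mulrBl mul1r => h2 n2 di.
  by apply/andP; split; lra.
have aA : 0 <= `|a| * A ^+ 2 by rewrite mulr_ge0 ?sqr_ge0.
have b0 : 0 <= n%:R * LL + `|a| * A ^+ 2 + K by rewrite !addr_ge0 ?mulr_ge0.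
rewrite /hessian_norm -(tensor_norm_congr _ uV (posdef_unit pg)) VG.
apply: tensor_norm1_le => // i j.
have -> : V *m hessian du d2u c x *m V^T = diag_mx d - K%:M - a *: ((du c x *m V^T)^T *m (du c x *m V^T)).
  by rewrite -VW (frame_aug VG) addrK addrK.
rewrite !mxE_add !mxE_opp mxE_scale rank_one_entry.
have b1 : `|diag_mx d i j| <= n%:R * LL.
  by rewrite mxE; case: (eqVneq i j) => [->|_]; rewrite ?mulr1n ?mulr0n ?normr0 ?mulr_ge0.
have b2 : `|a * ((du c x *m V^T) 0 i * (du c x *m V^T) 0 j)| <= `|a| * A ^+ 2.
  apply: norm_mulr_le => //; rewrite expr2.
  by apply: norm_mulr_le; exact: frame_du_le.
have b3 : `|(K%:M : 'M[R]_n) i j| <= K.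
  by rewrite mxE; case: (i == j); rewrite ?mulr1n ?mulr0n ?normr0 ?ger0_norm.
apply: le_trans (ler_normB _ _) _; rewrite addrAC; apply: lerD => //.
by apply: le_trans (ler_normB _ _) _; exact: lerD.
Qed.

Lemma global_bound c x : cl x -> dom c x -> hessian_norm du d2u c x <=
  n%:R * (n%:R * Num.max (top_bound n a K eps es cs ci A) (n%:R * bd) + `|a| * A ^+ 2 + K).
Proof.
move=> cx dx.
have [L [hL [c1 [x1 [xi [cx1 dx1 xi0 hxi]]]]]] := top_attained oO su clu a K cO n0 neO.
apply: (hessian_norm_le hL) cx dx; rewrite le_max.
have [Ox1|nOx1] := pselect (Omega x1); last first.
  by rewrite (frontier_top_le _ dx1 xi0 hxi) ?orbT//; split.
apply/orP; left.
have duE y : Omega y -> dom c1 y -> gradient du c1 y = grad (metric c1) (u \o cinv c1) (local_coord c1 y).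
  by move=> Oy dy; rewrite /gradient /grad (C2_closure_duE clu)// partials_dcol.
have [ci0 hci] := inf_on_gt0 cO neO (fun y _ => f0 y (u y)) (fun y cy =>
  let: ex_intro c' dy := dom_cover y in tends_f clu sf cy dy).
have eqW y : img c1 Omega y -> exists lam, [/\
    is_spectrum (invmx (metric c1 y) *m augW (metric c1) (u \o cinv c1) a K y) lam, Gam lam &
    F lam = f (cinv c1 y) ((u \o cinv c1) y) * h c1 y (grad (metric c1) (u \o cinv c1) y)].
  move=> [z [dz Oz] <-]; have [lam [slam Glam Flam]] := eqn Oz dz; exists lam; split; last 2 first.
  - exact: Glam.
  - by rewrite /= local_coordK// -duE.
  by rewrite -(aug_augW clu a K Oz dz).
have maxW y : img c1 Omega y -> forall w : E, bform (augW (metric c1) (u \o cinv c1) a K y) w w <=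
    L * bform (metric c1 y) w w.
  move=> [z [dz Oz] <-] w; rewrite -(aug_augW clu a K Oz dz).
  by apply: hL => //; exact: subset_closure.
apply: (interior_top_le K0 hK adm sf f0 sh xh h0 eps0 ch oO (smooth_u su c1 (isT : (4 <= 4)%N))
  eqW maxW dx1 Ox1) => //.
- by exists xi => //; rewrite -(aug_augW clu a K Ox1 dx1).
- by rewrite -(C2_closure_duE clu)//; exact: (gradient_norm_le cx1 dx1).
- rewrite -duE//; apply: (sup_on_ub cO (@subset_closure _ Omega)
    (q := fun c x => h_jet_norm h c x (gradient du c x))) Ox1 dx1 => [c2 c3 y|c2 y].
    exact: (h_jet_norm_gradient_indep oO su clu th sh).
  exact: (tends_h_jet_norm clu sh).
- apply: (sup_on_ub cO (@subset_closure _ Omega)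
    (q := fun c x => f_jet_norm f c x (u x))) Ox1 dx1 => [c2 c3 y _|c2 y].
    exact: f_jet_norm_indep.
  exact: (tends_f_jet_norm clu sf).
- exact: hci.
Qed.

End Assembly.

Theorem theorem2 (R : realType) :
  exists C4 : nat -> R -> R -> R -> R -> R -> R -> R -> R -> R,
  forall (n : nat) (M : riemannianManifold R n) (K : R)
    (Gamma : set 'rV[R]_n) (F : 'rV[R]_n -> R) (a eps : R)
    (f : M -> R -> R) (h : chart M -> 'rV[R]_n -> 'rV[R]_n -> R)
    (Omega : set M) (u : M -> R)
    (du : chart M -> M -> 'rV[R]_n) (d2u : chart M -> M -> 'M[R]_n),
  (2 <= n)%N ->
  0 <= K -> constant_sectional_curvature M K ->
  admissible Gamma F ->
  C2_point_value f -> (forall x z, 0 < f x z) ->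
  tangent_function h -> C2_tangent h -> x_independent h ->
  (forall c x p, dom c x -> 0 < h c (local_coord c x) p) ->
  0 < eps -> uniformly_convex_in_p h eps ->
  bounded_domain Omega ->
  C_on 4 Omega u -> C2_closure Omega u du d2u ->
  (forall c x, Omega x -> dom c x ->
    exists lam : 'rV[R]_n,
      [/\ is_spectrum (augmented_hessian du d2u a K c x) lam,
          Gamma lam &
          F lam = f x (u x) * h c (local_coord c x) (gradient du c x)]) ->
  let e_sup := sup_on Omega (fun c x => h_jet_norm h c x (gradient du c x)) in
  let c_sup := sup_on Omega (fun c x => f_jet_norm f c x (u x)) in
  let c_inf := inf_on Omega (fun _ x => f x (u x)) in
  forall c x, closure Omega x -> dom c x ->
    hessian_norm du d2u c x <=
    C4 n a K eps e_sup c_sup c_inf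
      (C1_norm u du (closure Omega))
      (sup_on (frontier Omega) (hessian_norm du d2u)).
Proof.
(* The outer n passes from entries to the tensor norm, the next one from an upper bound on the
   eigenvalues of W to one on their absolute values, and the n before the boundary data from entries
   of W to its top eigenvalue. The terms in a and K account for the passage between W and D^2 u. *)
exists (fun n a K eps es cs ci A Bd => n%:R * (n%:R * Num.max (top_bound n a K eps es cs ci A)
  (n%:R * (Bd + `|a| * A ^+ 2 + K)) + `|a| * A ^+ 2 + K)).
move=> n M K Gamma F a eps f h Omega u du d2u n2 K0 hK adm sf f0 th sh xh h0 eps0 ch bO su clu eqn.
by move=> es cs ci c x cx dx; apply: (global_bound _ K0 hK adm sf f0 th sh xh h0 eps0 ch bO su clu
  eqn cx dx); exact: leq_trans n2.
Qed.
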